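(* Let $\Omega\subset\mathbb{R}^2$ be a bounded connected open set which is piecewise $C^2$ without concave corners, with corner set $\mathcal C=\{y_1,\dots,y_m\}$, and starshaped with respect to the origin (i.e. $\langle y,\nu(y)\rangle>0$ for every $y\in\partial\Omega\setminus\mathcal C$). Assume that one of the following holds: (i) $\Omega$ is of class $C^1$ and there exists $y_0\in\partial\Omega\setminus\mathcal C$ with $\kappa(y_0)=\max_{y\in\partial\Omega\setminus\mathcal C}\kappa(y)$ and $\varphi(y_0)\ge |\Omega|/|\partial\Omega|$; (ii) $\varphi$ is constant on $\partial\Omega\setminus\mathcal C$. Then $\Omega$ is a ball (disk).
   Context: A bounded connected open set $\Omega\subset\mathbb{R}^2$ is piecewise $C^2$ without concave corners if it satisfies a uniform exterior sphere condition and $\partial\Omega=\bigcup_{i=1}^m\Gamma_i$, where each $\Gamma_i$ is a simple $C^2$ arc up to its endpoints $y_{i-1},y_i$ (with $y_0=y_m$), and $\Gamma_i\cap\Gamma_{i+1}=\{y_i\}$ for $1\le i\le m-1$, $\Gamma_m\cap\Gamma_1=\{y_m\}$, and $\Gamma_i\cap\Gamma_j=\emptyset$ if $i-j\ne\pm1$ (mod $m$). The corner set is $\mathcal C=\{y_1,\dots,y_m\}$. For $y\in\partial\Omega\setminus\mathcal C$, $\nu(y)$ is the outward unit normal and $\kappa(y)$ the curvature of $\partial\Omega$ at $y$ (a disk of radius $r$ has curvature $1/r$). $d_\Omega(x)=\min_{z\in\partial\Omega}|x-z|$; the cut value is $\lambda(y)=\sup\{t\ge0:\ d_\Omega(y-t\nu(y))=t\}$,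 and $\varphi(y)=\int_0^{\lambda(y)}(1-t\kappa(y))\,dt=\lambda(y)-\tfrac12\lambda(y)^2\kappa(y)$ for $y\in\partial\Omega\setminus\mathcal C$. $|\Omega|$ denotes area and $|\partial\Omega|$ perimeter. *)

(* Defs.v *)
From Stdlib Require Import Reals Lra Lia ZArith List ClassicalEpsilon.
Open Scope R_scope.

Definition R2 : Type := (R * R)%type.

Definition vadd (x y : R2) : R2 := (fst x + fst y, snd x + snd y).
Definition vsub (x y : R2) : R2 := (fst x - fst y, snd x - snd y).
Definition vscale (a : R) (x : R2) : R2 := (a * fst x, a * snd x).
Definition dot (x y : R2) : R := fst x * fst y + snd x * snd y.
Definition vnorm (x : R2) : R := sqrt (dot x x).

(** Supremum / infimum of a set of reals (value unspecified if no l.u.b.). *)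
Definition Rsup (S : R -> Prop) : R := epsilon (inhabits 0) (fun l => is_lub S l).
Definition Rinf (S : R -> Prop) : R := - Rsup (fun x => S (- x)).

Definition open2 (U : R2 -> Prop) : Prop :=
  forall x, U x -> exists e, 0 < e /\ forall z, vnorm (vsub z x) < e -> U z.
Definition bounded2 (U : R2 -> Prop) : Prop :=
  exists M, forall x, U x -> vnorm x <= M.
Definition connected2 (U : R2 -> Prop) : Prop :=
  (exists x, U x) /\
  forall A B : R2 -> Prop, open2 A -> open2 B ->
    (forall x, U x -> A x \/ B x) ->
    (forall x, U x -> A x -> B x -> False) ->
    (exists x, U x /\ A x) -> (exists x, U x /\ B x) -> False.
Definition closure2 (U : R2 -> Prop) (p : R2) : Prop :=
  forall e, 0 < e -> exists x, U x /\ vnorm (vsub x p) < e.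
(* boundary2 of an open set: closure2 minus the set *)
Definition boundary2 (U : R2 -> Prop) (p : R2) : Prop := closure2 U p /\ ~ U p.

Definition uniform_exterior_sphere (Om : R2 -> Prop) : Prop :=
  exists r, 0 < r /\ forall y, boundary2 Om y ->
    exists c, vnorm (vsub y c) = r /\
      forall x, vnorm (vsub x c) < r -> ~ closure2 Om x.

(** A C^2 curve g : R -> R2 with first derivative g1 and second derivative g2
    (g2 continuous). Being C^2 up to the endpoints of [0,1] is expressed by
    asking for a C^2 extension to R, which always exists. *)
Definition C2_curve (g g1 g2 : R -> R2) : Prop :=
  (forall t, derivable_pt_lim (fun s => fst (g s)) t (fst (g1 t))) /\
  (forall t, derivable_pt_lim (fun s => snd (g s)) t (snd (g1 t))) /\
  (forall t, derivable_pt_lim (fun s => fst (g1 s)) t (fst (g2 t))) /\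
  (forall t, derivable_pt_lim (fun s => snd (g1 s)) t (snd (g2 t))) /\
  continuity (fun s => fst (g2 s)) /\ continuity (fun s => snd (g2 s)).

Definition simple_C2_arc (g g1 g2 : R -> R2) : Prop :=
  C2_curve g g1 g2 /\
  (forall t, 0 <= t <= 1 -> g1 t <> (0, 0)) /\
  (forall s t, 0 <= s <= 1 -> 0 <= t <= 1 -> g s = g t -> s = t).

Definition on_arc (g : R -> R2) (p : R2) : Prop := exists t, 0 <= t <= 1 /\ p = g t.

(** Piecewise C^2 without concave corners. Arcs are indexed 0..m-1
    (arc k = Gamma_{k+1} of the paper); arc k runs from corner g (k-1 mod m) 1
    to corner g k 1 (= y_{k+1}). *)
Definition piecewise_C2_no_concave (Om : R2 -> Prop) (m : nat)
    (g g1 g2 : nat -> R -> R2) : Prop :=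
  uniform_exterior_sphere Om /\
  (0 < m)%nat /\
  (forall k, (k < m)%nat -> simple_C2_arc (g k) (g1 k) (g2 k)) /\
  (forall k, (k < m)%nat -> g ((k + 1) mod m)%nat 0 = g k 1) /\
  (forall p, boundary2 Om p <-> exists k, (k < m)%nat /\ on_arc (g k) p) /\
  (forall k, (k < m)%nat -> forall p,
     (on_arc (g k) p /\ on_arc (g ((k + 1) mod m)%nat) p) <-> p = g k 1) /\
  (forall i j, (i < m)%nat -> (j < m)%nat -> i <> j ->
     ((i + 1) mod m)%nat <> j -> ((j + 1) mod m)%nat <> i ->
     forall p, ~ (on_arc (g i) p /\ on_arc (g j) p)).

Definition corner (m : nat) (g : nat -> R -> R2) (p : R2) : Prop :=
  exists k, (k < m)%nat /\ p = g k 1.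

Definition reg_bd (Om : R2 -> Prop) (m : nat) (g : nat -> R -> R2) (y : R2) : Prop :=
  boundary2 Om y /\ ~ corner m g y.

Definition outward_normal_spec (Om : R2 -> Prop) (m : nat) (g g1 : nat -> R -> R2)
    (nu : R2 -> R2) : Prop :=
  forall k t, (k < m)%nat -> 0 < t < 1 ->
    vnorm (nu (g k t)) = 1 /\ dot (nu (g k t)) (g1 k t) = 0 /\
    exists d, 0 < d /\ forall s, 0 < s < d -> Om (vsub (g k t) (vscale s (nu (g k t)))).

(** kappa is the curvature (a disk of radius r has curvature 1/r). *)
Definition curvature_spec (m : nat) (g g1 g2 : nat -> R -> R2) (nu : R2 -> R2)
    (kappa : R2 -> R) : Prop :=
  forall k t, (k < m)%nat -> 0 < t < 1 ->
    kappa (g k t) = - dot (g2 k t) (nu (g k t)) / dot (g1 k t) (g1 k t).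

Definition dist_bd (Om : R2 -> Prop) (x : R2) : R :=
  Rinf (fun d => exists z, boundary2 Om z /\ d = vnorm (vsub x z)).
Definition cut_value (Om : R2 -> Prop) (nu : R2 -> R2) (y : R2) : R :=
  Rsup (fun t => 0 <= t /\ dist_bd Om (vsub y (vscale t (nu y))) = t).
Definition phi (Om : R2 -> Prop) (nu : R2 -> R2) (kappa : R2 -> R) (y : R2) : R :=
  let l := cut_value Om nu y in l - / 2 * l ^ 2 * kappa y.

(** Area: Lebesgue measure of an open set = sup of areas of finite unions of
    closed dyadic squares contained in it. *)
Definition in_dyadic_square (n : nat) (ij : Z * Z) (x : R2) : Prop :=
  IZR (fst ij) / 2 ^ n <= fst x <= IZR (fst ij + 1) / 2 ^ n /\
  IZR (snd ij) / 2 ^ n <= snd x <= IZR (snd ij + 1) / 2 ^ n.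
Definition area (Om : R2 -> Prop) : R :=
  Rsup (fun a => exists (n : nat) (l : list (Z * Z)), NoDup l /\
          (forall ij, In ij l -> forall x, in_dyadic_square n ij x -> Om x) /\
          a = INR (length l) / 4 ^ n).

Fixpoint chord_sum (g : R -> R2) (a : R) (l : list R) : R :=
  match l with
  | nil => 0
  | b :: l' => vnorm (vsub (g b) (g a)) + chord_sum g b l'
  end.
Fixpoint increasing_from (a : R) (l : list R) : Prop :=
  match l with
  | nil => True
  | b :: l' => a < b /\ increasing_from b l'
  end.
Definition arc_length (g : R -> R2) : R :=
  Rsup (fun L => exists l : list R, l <> nil /\ increasing_from 0 l /\
                  last l 0 = 1 /\ L = chord_sum g 0 l).
Definition perimeter (m : nat) (g : nat -> R -> R2) : R :=
  fold_right Rplus 0 (map (fun k => arc_length (g k)) (seq 0 m)).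

(** Omega is of class C^1: locally the subgraph of a C^1 function in rotated
    coordinates. *)
Definition C1_domain (Om : R2 -> Prop) : Prop :=
  forall p, boundary2 Om p -> exists r a b (f f' : R -> R),
    0 < r /\ a ^ 2 + b ^ 2 = 1 /\
    (forall s, derivable_pt_lim f s (f' s)) /\ continuity f' /\
    forall x, vnorm (vsub x p) < r ->
      (Om x <-> - b * (fst x - fst p) + a * (snd x - snd p)
                  < f (a * (fst x - fst p) + b * (snd x - snd p))).

Definition is_disk (Om : R2 -> Prop) : Prop :=
  exists c r, 0 < r /\ forall x, Om x <-> vnorm (vsub x c) < r.

(* Main.v *)
(** Along an arc with unit tangent [T] one has [d<y,T> = (1 - kappa <y,nu>) ds]. When
    the tangents of consecutive arcs match at the corners, integration gives
    Minkowski's formula: the integral of [kappa <y,nu>] over the boundary is the length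
    [L]; by starshapedness the integral [I] of [<y,nu>] is at most twice the area. If
    [kappa <= k0] then [L <= k0 I], and equality forces [kappa = k0] everywhere, so that
    [nu - k0 y] is constant along the boundary, which lies on a circle of radius [1/k0].

    In case (i), [phi(y0) <= 1/(2 k0)] because [l - l^2 k0/2] is maximal at [l = 1/k0];
    hence [k0 I <= 2 k0 |Om| <= L].

    In case (ii), [phi = c > 0] forces a uniform interior ball condition, which together
    with the exterior spheres excludes corners; moreover [l - l^2 kappa/2 = c] yields
    [kappa <= 1/(2c)] and shows that the cut value is a continuous function of the
    curvature. Every point of the domain lies on the inner normal of a nearest boundary
    point, before the cut value, so the area is at most [c L], that is [I <= 2 c L]. *)

Require Import Defs.
From Stdlib Require Import Reals Lra Lia Psatz ZArith List ClassicalEpsilon Classical.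
From Coquelicot Require Import Coquelicot.
Open Scope R_scope.

(** * Area by counting lattice points *)

(** The hypothesis on [dot y (nu y)] is infinitesimal and says nothing at corners, where the support
    may vanish in the limit and the ray from the origin may be tangent to the boundary. Turning it
    into global starshapedness is the main obstacle; exterior balls settle it by showing that no ray
    re-enters the domain directly beyond a boundary point. Both cases go through [smooth_boundary],
    a one-sided weakening of C^1 which, against the exterior balls, makes normals, tangents and
    orientations match at corners. Areas are handled by counting points of the lattices [2^-n Z^2]:
    [area_le] is subadditive, [area_ge] is superadditive on disjoint sets, and triangles suffice to
    feed both. From below, disjoint triangular sectors fill half of the swept integral; from above,
    case (ii) covers the domain by thin trapezoids along the inner normals. Since only inequalities
    are at stake, the sectors may leave gaps and the trapezoids may overlap. The definition [area]
    enters through inscribed dyadic squares, in case (i) alone. *)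

Fixpoint psum (f : nat -> R) (n : nat) : R :=
  match n with O => 0 | S k => psum f k + f k end.

Definition pt (n : nat) (ij : Z * Z) : R2 := (IZR (fst ij) / 2 ^ n, IZR (snd ij) / 2 ^ n).

(* Asymptotic outer and inner area bounds: the lattice [2^-n Z^2] has at most
   (at least) about [4^n A] points in [S]. *)
Definition area_le (S : R2 -> Prop) (A : R) : Prop :=
  forall e, 0 < e -> exists n0, forall n, (n0 <= n)%nat -> forall l : list (Z * Z),
    NoDup l -> (forall ij, In ij l -> S (pt n ij)) -> INR (length l) <= 4 ^ n * (A + e).

Definition area_ge (S : R2 -> Prop) (A : R) : Prop :=
  forall e, 0 < e -> exists n0, forall n, (n0 <= n)%nat -> exists l : list (Z * Z),
    NoDup l /\ (forall ij, In ij l -> S (pt n ij)) /\ 4 ^ n * (A - e) <= INR (length l).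

Lemma pow_4_pos n : 0 < 4 ^ n.
Proof. apply pow_lt; lra. Qed.

Lemma pow_2_pos n : 0 < 2 ^ n.
Proof. apply pow_lt; lra. Qed.

Lemma pow_4_2 n : 4 ^ n = 2 ^ n * 2 ^ n.
Proof. rewrite <- Rpow_mult_distr. f_equal; lra. Qed.

Lemma area_le_mono (S S' : R2 -> Prop) A A' :
  (forall x, S' x -> S x) -> A <= A' -> area_le S A -> area_le S' A'.
Proof.
  intros HS HA H e He. destruct (H e He) as [n0 Hn]. exists n0. intros n Hle l Hl Hin.
  apply Rle_trans with (4 ^ n * (A + e)).
  - apply Hn; auto.
  - apply Rmult_le_compat_l; [left; apply pow_4_pos | lra].
Qed.

Lemma area_le_closed (S : R2 -> Prop) A :
  (forall e, 0 < e -> area_le S (A + e)) -> area_le S A.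
Proof.
  intros H e He. destruct (H (e / 2) ltac:(lra) (e / 2) ltac:(lra)) as [n0 Hn].
  exists n0. intros n Hle l Hl Hin. specialize (Hn n Hle l Hl Hin).
  replace (A + e) with (A + e / 2 + e / 2) by field. exact Hn.
Qed.

Lemma area_ge_mono (S S' : R2 -> Prop) A A' :
  (forall x, S x -> S' x) -> A' <= A -> area_ge S A -> area_ge S' A'.
Proof.
  intros HS HA H e He. destruct (H e He) as [n0 Hn]. exists n0. intros n Hle.
  destruct (Hn n Hle) as (l & Hl & Hin & Hlen). exists l. repeat split; auto.
  apply Rle_trans with (4 ^ n * (A - e)); auto.
  apply Rmult_le_compat_l; [left; apply pow_4_pos | lra].
Qed.

Lemma area_ge_closed (S : R2 -> Prop) A :
  (forall e, 0 < e -> area_ge S (A - e)) -> area_ge S A.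
Proof.
  intros H e He. destruct (H (e / 2) ltac:(lra) (e / 2) ltac:(lra)) as [n0 Hn].
  exists n0. intros n Hle. destruct (Hn n Hle) as (l & Hl & Hin & Hlen).
  exists l. repeat split; auto.
  replace (A - e) with (A - e / 2 - e / 2) by field. exact Hlen.
Qed.

Lemma area_le_union (S1 S2 : R2 -> Prop) A1 A2 :
  area_le S1 A1 -> area_le S2 A2 -> area_le (fun x => S1 x \/ S2 x) (A1 + A2).
Proof.
  intros H1 H2 e He.
  destruct (H1 (e / 2) ltac:(lra)) as [n1 Hn1]. destruct (H2 (e / 2) ltac:(lra)) as [n2 Hn2].
  exists (Nat.max n1 n2). intros n Hle l Hl Hin.
  set (f := fun ij => if excluded_middle_informative (S1 (pt n ij)) then true else false).
  rewrite <- (filter_length f l), plus_INR.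
  replace (4 ^ n * (A1 + A2 + e)) with (4 ^ n * (A1 + e / 2) + 4 ^ n * (A2 + e / 2)) by field.
  apply Rplus_le_compat.
  - apply Hn1; [lia | apply NoDup_filter; auto |].
    intros ij Hij. apply filter_In in Hij as [_ Hf]. unfold f in Hf.
    destruct (excluded_middle_informative (S1 (pt n ij))); [auto | discriminate].
  - apply Hn2; [lia | apply NoDup_filter; auto |].
    intros ij Hij. apply filter_In in Hij as [Hi Hf]. unfold f in Hf.
    destruct (excluded_middle_informative (S1 (pt n ij))); [discriminate |].
    destruct (Hin ij Hi); tauto.
Qed.

Lemma area_ge_union (S1 S2 : R2 -> Prop) A1 A2 :
  (forall x, S1 x -> S2 x -> False) ->
  area_ge S1 A1 -> area_ge S2 A2 -> area_ge (fun x => S1 x \/ S2 x) (A1 + A2).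
Proof.
  intros Hd H1 H2 e He.
  destruct (H1 (e / 2) ltac:(lra)) as [n1 Hn1]. destruct (H2 (e / 2) ltac:(lra)) as [n2 Hn2].
  exists (Nat.max n1 n2). intros n Hle.
  destruct (Hn1 n ltac:(lia)) as (l1 & Hl1 & Hi1 & Hc1).
  destruct (Hn2 n ltac:(lia)) as (l2 & Hl2 & Hi2 & Hc2).
  exists (l1 ++ l2). repeat split.
  - apply NoDup_app; auto. intros a Ha Ha'. eauto.
  - intros ij Hij. apply in_app_or in Hij as [?|?]; auto.
  - rewrite length_app, plus_INR. nra.
Qed.

Lemma area_le_empty (S : R2 -> Prop) : (forall x, ~ S x) -> area_le S 0.
Proof.
  intros HS e He. exists 0%nat. intros n _ [|ij l] _ Hin.
  - simpl. generalize (pow_4_pos n). nra.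
  - destruct (HS _ (Hin ij (or_introl eq_refl))).
Qed.

Lemma area_ge_nonpos (S : R2 -> Prop) A : A <= 0 -> area_ge S A.
Proof.
  intros HA e He. exists 0%nat. intros n _. exists nil. repeat split.
  - constructor.
  - intros ij [].
  - simpl. generalize (pow_4_pos n). nra.
Qed.

Lemma area_le_bigunion (S : nat -> R2 -> Prop) (A : nat -> R) (m : nat) :
  (forall i, (i < m)%nat -> area_le (S i) (A i)) ->
  area_le (fun x => exists i, (i < m)%nat /\ S i x) (psum A m).
Proof.
  induction m as [|m IH]; intros H; simpl.
  - apply area_le_empty. intros x (i & Hi & _). lia.
  - apply area_le_mono with (fun x => (exists i, (i < m)%nat /\ S i x) \/ S m x) (psum A m + A m);
      [| lra | apply area_le_union; auto].
    intros x (i & Hi & Hx). destruct (Nat.eq_dec i m) as [-> | Hne]; [auto |].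
    left. exists i. split; [lia | auto].
Qed.

Lemma area_ge_bigunion (S : nat -> R2 -> Prop) (A : nat -> R) (m : nat) :
  (forall i, (i < m)%nat -> area_ge (S i) (A i)) ->
  (forall i j x, (i < j < m)%nat -> S i x -> S j x -> False) ->
  area_ge (fun x => exists i, (i < m)%nat /\ S i x) (psum A m).
Proof.
  induction m as [|m IH]; intros H Hd; simpl.
  - apply area_ge_nonpos; lra.
  - apply area_ge_mono with (fun x => (exists i, (i < m)%nat /\ S i x) \/ S m x) (psum A m + A m);
      [| lra | apply area_ge_union; auto].
    + intros x [(i & Hi & Hx) | Hx]; [exists i | exists m]; split; auto.
    + intros x (i & Hi & Hx) Hx'. apply (Hd i m x); auto.
    + apply IH; auto. intros i j x Hij. apply Hd. lia.
Qed.

(** One fine lattice serves both bounds: a list witnessing the lower one is subject to the upper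
    one. This comparison stands in for the uniqueness of area. *)
Lemma area_ge_le (S : R2 -> Prop) A B : area_ge S B -> area_le S A -> B <= A.
Proof.
  intros HB HA. apply Rnot_lt_le. intros Hlt.
  destruct (HB ((B - A) / 4) ltac:(lra)) as [n1 H1].
  destruct (HA ((B - A) / 4) ltac:(lra)) as [n2 H2].
  destruct (H1 (Nat.max n1 n2) ltac:(lia)) as (l & Hl & Hi & Hc).
  specialize (H2 (Nat.max n1 n2) ltac:(lia) l Hl Hi).
  generalize (pow_4_pos (Nat.max n1 n2)). nra.
Qed.

(** A symmetry of every lattice [2^-n Z^2] permutes its points, so counts are preserved exactly. The
    two axis reflections are obtained this way. *)
Lemma area_le_involution (F : R2 -> R2) (f : Z * Z -> Z * Z) (S : R2 -> Prop) A :
  (forall n ij, pt n (f ij) = F (pt n ij)) -> (forall ij, f (f ij) = ij) ->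
  area_le S A -> area_le (fun x => S (F x)) A.
Proof.
  intros HF Hf H e He. destruct (H e He) as [n0 Hn]. exists n0. intros n Hle l Hl Hin.
  rewrite <- (length_map f l). apply Hn; auto.
  - apply NoDup_map_NoDup_ForallPairs; auto.
    intros a b _ _ Hab. rewrite <- (Hf a), Hab; auto.
  - intros ij Hij. apply in_map_iff in Hij as (kl & <- & Hkl). rewrite HF. auto.
Qed.

Lemma area_ge_involution (F : R2 -> R2) (f : Z * Z -> Z * Z) (S : R2 -> Prop) A :
  (forall n ij, pt n (f ij) = F (pt n ij)) -> (forall ij, f (f ij) = ij) ->
  area_ge S A -> area_ge (fun x => S (F x)) A.
Proof.
  intros HF Hf H e He. destruct (H e He) as [n0 Hn]. exists n0. intros n Hle.
  destruct (Hn n Hle) as (l & Hl & Hi & Hc). exists (map f l). repeat split.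
  - apply NoDup_map_NoDup_ForallPairs; auto.
    intros a b _ _ Hab. rewrite <- (Hf a), Hab; auto.
  - intros ij Hij. apply in_map_iff in Hij as (kl & <- & Hkl). rewrite <- HF, Hf. auto.
  - rewrite length_map. auto.
Qed.

Definition flipx (x : R2) : R2 := (- fst x, snd x).
Definition flipy (x : R2) : R2 := (fst x, - snd x).

Lemma pt_flipx n ij : pt n ((- fst ij)%Z, snd ij) = flipx (pt n ij).
Proof.
  unfold pt, flipx; simpl. rewrite opp_IZR. f_equal. unfold Rdiv. ring.
Qed.

Lemma pt_flipy n ij : pt n (fst ij, (- snd ij)%Z) = flipy (pt n ij).
Proof.
  unfold pt, flipy; simpl. rewrite opp_IZR. f_equal. unfold Rdiv. ring.
Qed.

Lemma area_le_flipx (S : R2 -> Prop) A : area_le S A -> area_le (fun x => S (flipx x)) A.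
Proof.
  apply area_le_involution with (fun ij => ((- fst ij)%Z, snd ij)).
  - apply pt_flipx.
  - intros [i j]; simpl. rewrite Z.opp_involutive; auto.
Qed.

Lemma area_ge_flipx (S : R2 -> Prop) A : area_ge S A -> area_ge (fun x => S (flipx x)) A.
Proof.
  apply area_ge_involution with (fun ij => ((- fst ij)%Z, snd ij)).
  - apply pt_flipx.
  - intros [i j]; simpl. rewrite Z.opp_involutive; auto.
Qed.

Lemma area_le_flipy (S : R2 -> Prop) A : area_le S A -> area_le (fun x => S (flipy x)) A.
Proof.
  apply area_le_involution with (fun ij => (fst ij, (- snd ij)%Z)).
  - apply pt_flipy.
  - intros [i j]; simpl. rewrite Z.opp_involutive; auto.
Qed.

Lemma area_ge_flipy (S : R2 -> Prop) A : area_ge S A -> area_ge (fun x => S (flipy x)) A.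
Proof.
  apply area_ge_involution with (fun ij => (fst ij, (- snd ij)%Z)).
  - apply pt_flipy.
  - intros [i j]; simpl. rewrite Z.opp_involutive; auto.
Qed.

(** * Integer points in intervals, columns and wedges *)

Definition zceil (x : R) : Z := (- Int_part (- x))%Z.

Lemma zceil_spec x : x <= IZR (zceil x) < x + 1.
Proof.
  unfold zceil. rewrite opp_IZR. generalize (base_Int_part (- x)). lra.
Qed.

Lemma floor_spec x : x - 1 < IZR (Int_part x) <= x.
Proof. generalize (base_Int_part x). lra. Qed.

Definition zrange (p : Z) (k : nat) : list Z := map (fun i => (p + Z.of_nat i)%Z) (seq 0 k).

Definition zinterval (a b : R) : list Z :=
  zrange (zceil a) (Z.to_nat (Int_part b - zceil a + 1)).

Lemma NoDup_zrange p k : NoDup (zrange p k).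
Proof.
  apply NoDup_map_NoDup_ForallPairs; [| apply seq_NoDup].
  intros i j _ _ H. lia.
Qed.

Lemma In_zrange p k z : In z (zrange p k) <-> (p <= z < p + Z.of_nat k)%Z.
Proof.
  unfold zrange. rewrite in_map_iff. split.
  - intros (i & <- & Hi). apply in_seq in Hi. lia.
  - intros H. exists (Z.to_nat (z - p)). rewrite in_seq. lia.
Qed.

Lemma zceil_le x z : (zceil x <= z)%Z <-> x <= IZR z.
Proof.
  generalize (zceil_spec x); intros H. split; intros Hz.
  - apply IZR_le in Hz. lra.
  - assert (IZR (zceil x) < IZR (z + 1)) by (rewrite plus_IZR; lra).
    apply lt_IZR in H0. lia.
Qed.

Lemma floor_ge x z : (z <= Int_part x)%Z <-> IZR z <= x.
Proof.
  generalize (floor_spec x); intros H. split; intros Hz.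
  - apply IZR_le in Hz. lra.
  - assert (IZR z < IZR (Int_part x + 1)) by (rewrite plus_IZR; lra).
    apply lt_IZR in H0. lia.
Qed.

Lemma In_zinterval a b z : In z (zinterval a b) <-> a <= IZR z <= b.
Proof.
  unfold zinterval. rewrite In_zrange, <- zceil_le, <- floor_ge. lia.
Qed.

Lemma zinterval_count a b : a <= b ->
  b - a - 1 <= INR (Z.to_nat (Int_part b - zceil a + 1)) <= b - a + 1.
Proof.
  intros H. generalize (zceil_spec a) (floor_spec b); intros Ha Hb.
  (* When [[a, b]] contains no integer this expression is [0], never negative, so [Z.to_nat] loses
     nothing. *)
  assert (0 <= Int_part b - zceil a + 1)%Z.
  { assert (IZR (-1) < IZR (Int_part b - zceil a + 1)) by
      (rewrite plus_IZR, minus_IZR; lra).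
    apply lt_IZR in H0. lia. }
  rewrite INR_IZR_INZ, Z2Nat.id by auto. rewrite plus_IZR, minus_IZR. lra.
Qed.

Lemma length_zinterval a b : a <= b ->
  b - a - 1 <= INR (length (zinterval a b)) <= b - a + 1.
Proof.
  intros H. unfold zinterval, zrange. rewrite length_map, length_seq.
  apply zinterval_count; auto.
Qed.

Definition columns (F : Z -> list Z) (l : list Z) : list (Z * Z) :=
  flat_map (fun i => map (fun j => (i, j)) (F i)) l.

Lemma In_columns F l ij : In ij (columns F l) <-> In (fst ij) l /\ In (snd ij) (F (fst ij)).
Proof.
  unfold columns. rewrite in_flat_map. split.
  - intros (i & Hi & Hij). apply in_map_iff in Hij as (j & <- & Hj). auto.
  - intros [Hi Hj]. exists (fst ij). split; auto. apply in_map_iff. exists (snd ij).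
    destruct ij; auto.
Qed.

Lemma NoDup_columns F l : NoDup l -> (forall i, NoDup (F i)) -> NoDup (columns F l).
Proof.
  intros Hl HF. induction Hl as [|i l Hi Hl IH]; simpl; [constructor |].
  apply NoDup_app; auto.
  - apply NoDup_map_NoDup_ForallPairs; auto. intros a b _ _ H. congruence.
  - intros a Ha Hb. apply in_map_iff in Ha as (j & <- & _).
    apply In_columns in Hb as [Hb _]. auto.
Qed.

(** Column [i] holds [s * (i - X)] points up to one; summing over [k] consecutive abscissas from [p]
    gives an arithmetic progression, with an error of one per column. *)
Lemma length_columns F (s X : R) p k :
  (forall i, In i (zrange p k) -> Rabs (INR (length (F i)) - s * (IZR i - X)) <= 1) ->
  Rabs (INR (length (columns F (zrange p k)))
        - s * (INR k * (INR k - 1) / 2 + INR k * (IZR p - X))) <= INR k.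
Proof.
  induction k as [|k IH]; intros H.
  - simpl. replace (_ - _) with 0 by field. rewrite Rabs_R0; lra.
  - unfold zrange. rewrite seq_S, map_app. fold (zrange p k).
    unfold columns. rewrite flat_map_app, length_app, plus_INR. fold (columns F (zrange p k)).
    simpl flat_map. rewrite app_nil_r, length_map.
    assert (H1 : Rabs (INR (length (columns F (zrange p k)))
        - s * (INR k * (INR k - 1) / 2 + INR k * (IZR p - X))) <= INR k).
    { apply IH. intros i Hi. apply H. apply In_zrange in Hi. apply In_zrange. lia. }
    assert (H2 := H (p + Z.of_nat k)%Z ltac:(apply In_zrange; lia)).
    rewrite plus_IZR, <- INR_IZR_INZ in H2.
    simpl Nat.add. rewrite S_INR.
    apply Rle_trans with (2 := Rplus_le_compat _ _ _ _ H1 H2).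
    eapply Rle_trans; [| apply Rabs_triang]. right. f_equal. field.
Qed.

(** The main term is quadratic in the size [W], the error linear: after scaling by [2^n] the error
    is of order [2^n] against [4^n]. *)
Lemma integer_points_wedge X Y W m1 m2 : 0 <= W -> m1 <= m2 ->
  exists l, NoDup l /\
    (forall ij, In ij l <-> X <= IZR (fst ij) <= X + W /\
       Y + m1 * (IZR (fst ij) - X) <= IZR (snd ij) <= Y + m2 * (IZR (fst ij) - X)) /\
    Rabs (INR (length l) - (m2 - m1) * (W * W) / 2) <= (2 * (m2 - m1) + 1) * (W + 1).
Proof.
  intros HW Hm.
  set (F := fun i => zinterval (Y + m1 * (IZR i - X)) (Y + m2 * (IZR i - X))).
  exists (columns F (zinterval X (X + W))). split; [| split].
  - apply NoDup_columns; [apply NoDup_zrange |]. intros i. apply NoDup_zrange.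
  - intros ij. rewrite In_columns. unfold F. rewrite !In_zinterval. reflexivity.
  - unfold zinterval at 1.
    set (k := Z.to_nat (Int_part (X + W) - zceil X + 1)).
    assert (Hk := zinterval_count X (X + W) ltac:(lra)). fold k in Hk.
    assert (H : Rabs (INR (length (columns F (zrange (zceil X) k)))
        - (m2 - m1) * (INR k * (INR k - 1) / 2 + INR k * (IZR (zceil X) - X))) <= INR k).
    { apply length_columns. intros i Hi. apply In_zrange in Hi.
      assert (Hi' : X <= IZR i) by (apply zceil_le; lia).
      unfold F. generalize (length_zinterval (Y + m1 * (IZR i - X)) (Y + m2 * (IZR i - X)) ltac:(nra)).
      intros Hl. apply Rabs_le. lra. }
    generalize (zceil_spec X); intros Hp.
    set (f := IZR (zceil X) - X) in *. assert (Hf : 0 <= f < 1) by (unfold f; lra).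
    assert (Hk0 := pos_INR k).
    assert (HkZ : INR k = 0 \/ 1 <= INR k).
    { destruct k; [left; auto | right]. rewrite S_INR. generalize (pos_INR k). lra. }
    set (K := INR k) in *.
    (* The number [K] of columns is within [1] of [W] and the first column is at distance [f < 1]
       from the apex, so the progression is [W^2 / 2] up to a linear error. *)
    assert (HS : Rabs (K * (K - 1) / 2 + K * f - W * W / 2) <= 2 * (W + 1)).
    { assert (HKW : W - 1 <= K <= W + 1) by lra.
      apply Rabs_le. split.
      - assert (0 <= K * f) by (apply Rmult_le_pos; lra).
        assert (0 <= K * (K - 1)) by (destruct HkZ as [-> | H1]; [lra | apply Rmult_le_pos; lra]).
        destruct (Rle_dec W 4) as [H4 | H4].
        + assert (0 <= W * (4 - W)) by (apply Rmult_le_pos; lra). lra.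
        + assert ((W - 1) * (W - 2) <= K * (K - 1)) by (apply Rmult_le_compat; lra). lra.
      - assert (K * f <= K * 1) by (apply Rmult_le_compat_l; lra).
        assert (K * (K + 1) <= (W + 1) * (W + 2)) by (apply Rmult_le_compat; lra). lra. }
    apply Rabs_le_between in H. apply Rabs_le_between in HS. apply Rabs_le_between.
    assert (HD : 0 <= m2 - m1) by lra. set (D := m2 - m1) in *. clearbody D.
    set (Q := K * (K - 1) / 2 + K * f) in *. clearbody Q.
    set (w2 := W * W) in *. clearbody w2.
    assert (- (2 * (W + 1)) * D <= (Q - w2 / 2) * D <= 2 * (W + 1) * D) by (split; apply Rmult_le_compat_r; lra).
    lra.
Qed.

(** A triangle with apex [(x0, y0)] and a vertical opposite side. The vertical through the middle
    vertex of a triangle cuts it into two of these, one of them reflected. *)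
Definition wedge (x0 y0 w m1 m2 : R) (x : R2) : Prop :=
  x0 <= fst x <= x0 + w /\ y0 + m1 * (fst x - x0) <= snd x <= y0 + m2 * (fst x - x0).

Lemma wedge_scale N x0 y0 w m1 m2 x : 0 < N ->
  wedge x0 y0 w m1 m2 x <->
  N * x0 <= N * fst x <= N * x0 + N * w /\
  N * y0 + m1 * (N * fst x - N * x0) <= N * snd x <= N * y0 + m2 * (N * fst x - N * x0).
Proof.
  intros HN. unfold wedge.
  replace (N * x0 + N * w) with (N * (x0 + w)) by ring.
  replace (N * y0 + m1 * (N * fst x - N * x0)) with (N * (y0 + m1 * (fst x - x0))) by ring.
  replace (N * y0 + m2 * (N * fst x - N * x0)) with (N * (y0 + m2 * (fst x - x0))) by ring.
  split; intros [[H1 H2] [H3 H4]].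
  - repeat split; apply Rmult_le_compat_l; lra.
  - repeat split; apply Rmult_le_reg_l with N; auto.
Qed.

Lemma wedge_count x0 y0 w m1 m2 : 0 <= w -> m1 <= m2 ->
  exists C, 0 <= C /\ forall n, exists l, NoDup l /\
    (forall ij, In ij l <-> wedge x0 y0 w m1 m2 (pt n ij)) /\
    Rabs (INR (length l) - 4 ^ n * ((m2 - m1) * (w * w) / 2)) <= C * 2 ^ n.
Proof.
  intros Hw Hm. exists ((2 * (m2 - m1) + 1) * (w + 1)). split; [nra |].
  intros n. assert (Hn := pow_2_pos n).
  destruct (integer_points_wedge (2 ^ n * x0) (2 ^ n * y0) (2 ^ n * w) m1 m2 ltac:(nra) Hm)
    as (l & Hl & Hi & Hc).
  exists l. split; [auto | split].
  - intros ij. rewrite Hi, (wedge_scale (2 ^ n)) by auto. unfold pt; simpl.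
    replace (2 ^ n * (IZR (fst ij) / 2 ^ n)) with (IZR (fst ij)) by (field; lra).
    replace (2 ^ n * (IZR (snd ij) / 2 ^ n)) with (IZR (snd ij)) by (field; lra).
    reflexivity.
  - assert (H1 : 1 <= 2 ^ n) by (apply pow_R1_Rle; lra).
    rewrite pow_4_2.
    replace (2 ^ n * 2 ^ n * ((m2 - m1) * (w * w) / 2)) with
      ((m2 - m1) * (2 ^ n * w * (2 ^ n * w)) / 2) by field.
    eapply Rle_trans; [exact Hc |].
    rewrite Rmult_assoc. apply Rmult_le_compat_l; nra.
Qed.

Lemma pow_2_eventually_large (C e : R) : 0 < e ->
  exists n0, forall n, (n0 <= n)%nat -> C * 2 ^ n <= 4 ^ n * e.
Proof.
  intros He. destruct (Pow_x_infinity 2 ltac:(rewrite Rabs_pos_eq; lra) (C / e)) as [n0 H].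
  exists n0. intros n Hn. specialize (H n Hn). assert (Hp := pow_2_pos n).
  rewrite Rabs_pos_eq in H by lra. rewrite pow_4_2.
  apply Rge_le in H. apply Rmult_le_compat_r with (r := e) in H; [| lra].
  field_simplify in H; [| lra]. nra.
Qed.

Lemma wedge_area_le x0 y0 w m1 m2 : 0 <= w -> m1 <= m2 ->
  area_le (wedge x0 y0 w m1 m2) ((m2 - m1) * (w * w) / 2).
Proof.
  intros Hw Hm e He. destruct (wedge_count x0 y0 w m1 m2 Hw Hm) as (C & HC & H).
  destruct (pow_2_eventually_large C e He) as [n0 Hn]. exists n0.
  intros n Hle l Hl Hi. specialize (Hn n Hle). destruct (H n) as (l' & Hl' & Hi' & Hc).
  assert (INR (length l) <= INR (length l')).
  { apply le_INR. apply NoDup_incl_length; auto. intros ij Hij. apply Hi'; auto. }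
  apply Rabs_le_between in Hc. lra.
Qed.

Lemma wedge_area_ge x0 y0 w m1 m2 : 0 <= w -> m1 <= m2 ->
  area_ge (wedge x0 y0 w m1 m2) ((m2 - m1) * (w * w) / 2).
Proof.
  intros Hw Hm e He. destruct (wedge_count x0 y0 w m1 m2 Hw Hm) as (C & HC & H).
  destruct (pow_2_eventually_large C e He) as [n0 Hn]. exists n0.
  intros n Hle. specialize (Hn n Hle). destruct (H n) as (l' & Hl' & Hi' & Hc).
  exists l'. split; [auto | split].
  - intros ij. apply Hi'.
  - apply Rabs_le_between in Hc. lra.
Qed.

(** * The area of triangles *)

Definition triangle (a b c x : R2) : Prop :=
  exists u v w, 0 <= u /\ 0 <= v /\ 0 <= w /\ u + v + w = 1 /\
    fst x = u * fst a + v * fst b + w * fst c /\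
    snd x = u * snd a + v * snd b + w * snd c.

Definition det (a b : R2) : R := fst a * snd b - snd a * fst b.

Definition rot (v : R2) : R2 := (snd v, - fst v).

Definition seg (x y : R2) (s : R) : R2 := vadd x (vscale s (vsub y x)).

Ltac vec_ring :=
  unfold det, dot, rot, seg, vadd, vsub, vscale; simpl; first [ring | f_equal; ring].

Lemma common_scale a b : 0 < a -> 0 < b -> exists d, 0 < d /\ d <= a /\ d <= b.
Proof.
  intros Ha Hb. exists (Rmin a b). split; [apply Rmin_glb_lt; auto |].
  split; [apply Rmin_l | apply Rmin_r].
Qed.

Fixpoint all_of (P : R -> Prop) (l : list R) : Prop :=
  match l with nil => True | x :: l' => P x /\ all_of P l' end.

Lemma common_scales l : all_of (Rlt 0) l -> exists d, 0 < d /\ all_of (Rle d) l.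
Proof.
  induction l as [|x l IH]; intros H; simpl in *; [exists 1; split; [lra | auto] |].
  destruct H as [Hx Hl]. destruct (IH Hl) as (d & Hd & Hle).
  destruct (common_scale x d Hx Hd) as (e & He & Hex & Hed). exists e. repeat split; auto.
  clear IH Hl. induction l as [|y l IHl]; simpl in *; auto. destruct Hle. split; [lra | auto].
Qed.

(** Narrowing the wedge by [eta] loses at most [eta * (m2 - m1) * w]. The two halves of a triangle
    share their vertical side, and dropping it from one makes them disjoint. *)
Lemma wedge_area_ge_open x0 y0 w m1 m2 : 0 <= w -> m1 <= m2 ->
  area_ge (fun x => wedge x0 y0 w m1 m2 x /\ fst x < x0 + w) ((m2 - m1) * (w * w) / 2).
Proof.
  intros Hw Hm. destruct (Rle_lt_or_eq_dec 0 w Hw) as [Hpos | <-];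
    [| apply area_ge_nonpos; lra].
  apply area_ge_closed. intros e He.
  assert (Hd : 0 < (m2 - m1) * w + 1) by nra.
  destruct (common_scale w (e / ((m2 - m1) * w + 1))) as (eta & He1 & He2 & He3);
    [auto | apply Rdiv_lt_0_compat; auto |].
  apply Rle_div_r in He3; auto.
  apply area_ge_mono with (3 := wedge_area_ge x0 y0 (w - eta) m1 m2 ltac:(lra) Hm).
  - intros x [[H1 H2] H3]. unfold wedge. lra.
  - replace ((m2 - m1) * ((w - eta) * (w - eta)) / 2) with
      ((m2 - m1) * (w * w) / 2 - eta * ((m2 - m1) * w) + (m2 - m1) * (eta * eta) / 2) by field.
    assert (0 <= (m2 - m1) * (eta * eta)) by (apply Rmult_le_pos; nra). lra.
Qed.

(** [be] is the barycentric weight of [b], the ratio of the heights of [x] and [b] over the chord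
    from [a] to [c]; the abscissa then determines the two other weights. *)
Lemma triangle_above_chord (a b c x : R2) (be : R) :
  fst a < fst c -> 0 <= be ->
  be * (fst b - fst a) <= fst x - fst a -> be * (fst c - fst b) <= fst c - fst x ->
  let m := (snd c - snd a) / (fst c - fst a) in
  snd x = snd a + m * (fst x - fst a) + be * (snd b - (snd a + m * (fst b - fst a))) ->
  triangle a b c x.
Proof.
  intros Hac Hbe H1 H2 m Hx.
  assert (HW : 0 < fst c - fst a) by lra.
  exists ((fst c - fst x - be * (fst c - fst b)) / (fst c - fst a)), be,
    ((fst x - fst a - be * (fst b - fst a)) / (fst c - fst a)).
  repeat split; auto.
  - apply Rmult_le_pos; [lra | left; apply Rinv_0_lt_compat; lra].
  - apply Rmult_le_pos; [lra | left; apply Rinv_0_lt_compat; lra].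
  - field. lra.
  - field. lra.
  - rewrite Hx. unfold m. field. lra.
Qed.

(** The sign of [det] puts [b] on or above the chord from [a] to [c]. The vertical through [b] cuts
    the triangle into wedges with apices [a] and [c]; [h] is the height of [b] over the chord, [k1]
    and [k2] are the excess slopes of the other two sides, the second one after reflection. *)
Lemma triangle_area_sorted_up (a b c : R2) :
  fst a <= fst b <= fst c -> fst a < fst c -> det (vsub b a) (vsub c a) <= 0 ->
  area_le (triangle a b c) (- det (vsub b a) (vsub c a) / 2) /\
  area_ge (triangle a b c) (- det (vsub b a) (vsub c a) / 2).
Proof.
  intros [Hab Hbc] Hac Hdet.
  set (m := (snd c - snd a) / (fst c - fst a)).
  set (h := snd b - (snd a + m * (fst b - fst a))).
  assert (Hdh : - det (vsub b a) (vsub c a) = (fst c - fst a) * h).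
  { unfold det, vsub, h, m; simpl. field. lra. }
  assert (Hc : snd c = snd a + m * (fst c - fst a)) by (unfold m; field; lra).
  assert (Hh : 0 <= h) by nra.
  (* If [b] shares its abscissa with [a] or [c], the quotient by [0] is [0] and the corresponding
     wedge degenerates. *)
  set (k1 := h / (fst b - fst a)). set (k2 := h / (fst c - fst b)).
  assert (Hk1 : 0 <= k1).
  { destruct Hab as [Hab | Hab]; unfold k1.
    - apply Rmult_le_pos; auto. left; apply Rinv_0_lt_compat; lra.
    - rewrite Hab, Rminus_diag. unfold Rdiv. rewrite Rinv_0. lra. }
  assert (Hk2 : 0 <= k2).
  { destruct Hbc as [Hbc | Hbc]; unfold k2.
    - apply Rmult_le_pos; auto. left; apply Rinv_0_lt_compat; lra.
    - rewrite Hbc, Rminus_diag. unfold Rdiv. rewrite Rinv_0. lra. }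
  set (V1 := wedge (fst a) (snd a) (fst b - fst a) m (m + k1)).
  set (V2 := wedge (- fst c) (snd c) (fst c - fst b) (- m) (- m + k2)).
  assert (HA : - det (vsub b a) (vsub c a) / 2 =
    (m + k1 - m) * ((fst b - fst a) * (fst b - fst a)) / 2 +
    (- m + k2 - - m) * ((fst c - fst b) * (fst c - fst b)) / 2).
  { assert (Hk : forall w, h / w * (w * w) = h * w).
    { intros w. destruct (Req_dec w 0) as [-> | Hw]; [ring | field; auto]. }
    rewrite Hdh. unfold k1, k2.
    replace (m + h / (fst b - fst a) - m) with (h / (fst b - fst a)) by ring.
    replace (- m + h / (fst c - fst b) - - m) with (h / (fst c - fst b)) by ring.
    rewrite !Hk. field. }
  rewrite HA. split.
  - eapply area_le_mono;
      [| | apply (area_le_union V1 (fun x => V2 (flipx x)));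
           [apply wedge_area_le; lra | apply area_le_flipx, wedge_area_le; lra]]; [| lra].
    intros x (u & v & w & Hu & Hv & Hw & Hs & Hx & Hy).
    assert (Hy' : snd x = snd a + m * (fst x - fst a) + v * h).
    { rewrite Hx, Hy, Hc. unfold h. replace u with (1 - v - w) by lra. ring. }
    assert (Hxa : fst x - fst a = v * (fst b - fst a) + w * (fst c - fst a)).
    { rewrite Hx. replace u with (1 - v - w) by lra. ring. }
    assert (Hxc : fst c - fst x = v * (fst c - fst b) + u * (fst c - fst a)).
    { rewrite Hx. replace w with (1 - v - u) by lra. ring. }
    assert (0 <= v * h) by nra.
    assert (0 <= w * (fst c - fst a)) by nra.
    assert (0 <= u * (fst c - fst a)) by nra.
    assert (0 <= v * (fst b - fst a)) by nra.
    assert (0 <= v * (fst c - fst b)) by nra.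
    destruct (Rlt_dec (fst a) (fst b)) as [Hlt | Hlt].
    + destruct (Rle_dec (fst x) (fst b)) as [Hxb | Hxb].
      * left. unfold V1, wedge. split; [lra |]. rewrite Hy'. split; [lra |].
        replace (v * h) with (k1 * (v * (fst b - fst a))) by (unfold k1; field; lra).
        nra.
      * right. unfold V2, wedge, flipx; simpl. split; [lra |]. rewrite Hy', Hc.
        split; [lra |].
        replace (v * h) with (k2 * (v * (fst c - fst b))) by (unfold k2; field; lra).
        nra.
    + right. assert (E : fst a = fst b) by lra.
      unfold V2, wedge, flipx; simpl. split; [lra |].
      rewrite Hy', Hc. split; [lra |].
      replace (v * h) with (k2 * (v * (fst c - fst b))) by (unfold k2; field; lra). nra.
  - eapply area_ge_mono;
      [| | apply (area_ge_union (fun x => V1 x /\ fst x < fst a + (fst b - fst a))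
                    (fun x => V2 (flipx x)));
           [| apply wedge_area_ge_open; lra | apply area_ge_flipx, wedge_area_ge; lra]];
      [| lra |].
    2: { intros x [_ H1] [H2 _]. unfold flipx in H2; simpl in H2. lra. }
    assert (Hbe : forall k d w, 0 <= d <= w -> 0 <= k <= h / w * d ->
              exists be, k = be * h /\ 0 <= be <= 1 /\ be * w <= d).
    { intros k d w Hd Hk. destruct (Req_dec w 0) as [-> | Hw].
      { exists 0. unfold Rdiv in Hk. rewrite Rinv_0 in Hk. lra. }
      destruct Hh as [Hh | Hh].
      - assert (Hq : k / h * w <= d).
        { apply Rmult_le_reg_r with (h / w); [apply Rdiv_lt_0_compat; lra |].
          replace (k / h * w * (h / w)) with k by (field; lra). lra. }
        exists (k / h). repeat split; [field; lra | apply Rdiv_le_0_compat; lra | nra | auto].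
      - exists 0. rewrite <- Hh in *. unfold Rdiv in Hk. lra. }
    intros x [[[H1 H2] H3] | [H1 H2]].
    + destruct (Hbe (snd x - (snd a + m * (fst x - fst a))) (fst x - fst a) (fst b - fst a))
        as (be & E & Hbe0 & Hbe1); [lra | fold k1; lra |].
      apply triangle_above_chord with be; auto; [lra | nra |].
      fold m. fold h. lra.
    + unfold flipx in *; simpl in *.
      destruct (Hbe (snd x - (snd a + m * (fst x - fst a))) (fst c - fst x) (fst c - fst b))
        as (be & E & Hbe0 & Hbe1); [lra | fold k2; lra |].
      apply triangle_above_chord with be; auto; [lra | nra |].
      fold m. fold h. lra.
Qed.

Lemma triangle_flipy a b c x :
  triangle (flipy a) (flipy b) (flipy c) (flipy x) <-> triangle a b c x.
Proof.
  unfold triangle, flipy; simpl.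
  split; intros (u & v & w & Hu & Hv & Hw & Hs & Hx & Hy);
    exists u, v, w; repeat split; auto; lra.
Qed.

Lemma triangle_swap12 a b c x : triangle a b c x <-> triangle b a c x.
Proof.
  unfold triangle.
  split; intros (u & v & w & Hu & Hv & Hw & Hs & Hx & Hy);
    exists v, u, w; repeat split; auto; lra.
Qed.

Lemma triangle_swap23 a b c x : triangle a b c x <-> triangle a c b x.
Proof.
  unfold triangle.
  split; intros (u & v & w & Hu & Hv & Hw & Hs & Hx & Hy);
    exists u, w, v; repeat split; auto; lra.
Qed.

Lemma triangle_area_sorted (a b c : R2) :
  fst a <= fst b <= fst c -> fst a < fst c ->
  area_le (triangle a b c) (Rabs (det (vsub b a) (vsub c a)) / 2) /\
  area_ge (triangle a b c) (Rabs (det (vsub b a) (vsub c a)) / 2).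
Proof.
  intros Hs Hac. destruct (Rle_dec (det (vsub b a) (vsub c a)) 0) as [Hd | Hd].
  - rewrite Rabs_left1 by auto. apply triangle_area_sorted_up; auto.
  - rewrite Rabs_pos_eq by lra.
    replace (det (vsub b a) (vsub c a) / 2) with
      (- det (vsub (flipy b) (flipy a)) (vsub (flipy c) (flipy a)) / 2)
      by (unfold det, vsub, flipy; simpl; field).
    destruct (triangle_area_sorted_up (flipy a) (flipy b) (flipy c)) as [H1 H2]; auto.
    { revert Hd. unfold det, vsub, flipy; simpl. lra. }
    split.
    + apply area_le_mono with (3 := area_le_flipy _ _ H1); [| lra].
      intros x. apply triangle_flipy.
    + apply area_ge_mono with (3 := area_ge_flipy _ _ H2); [| lra].
      intros x. apply triangle_flipy.
Qed.

(** A degenerate vertical triangle lies in a right triangle with vertical side [2 * M] and width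
    [e / M], hence of area [e], for every [e > 0]. *)
Lemma triangle_area_vertical (a b c : R2) :
  fst a = fst b -> fst b = fst c ->
  area_le (triangle a b c) (Rabs (det (vsub b a) (vsub c a)) / 2) /\
  area_ge (triangle a b c) (Rabs (det (vsub b a) (vsub c a)) / 2).
Proof.
  intros Hab Hbc. replace (det (vsub b a) (vsub c a)) with 0
    by (unfold det, vsub; simpl; rewrite Hab, Hbc; ring).
  rewrite Rabs_R0. split; [| apply area_ge_nonpos; lra].
  apply area_le_closed. intros e He.
  set (M := Rabs (snd a) + Rabs (snd b) + Rabs (snd c) + 1).
  assert (Ha := Rabs_pos (snd a)). assert (Hb := Rabs_pos (snd b)).
  assert (Hc := Rabs_pos (snd c)).
  assert (Ha' := Rle_abs (snd a)). assert (Hb' := Rle_abs (snd b)).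
  assert (Hc' := Rle_abs (snd c)).
  assert (Ha2 := Rle_abs (- snd a)). assert (Hb2 := Rle_abs (- snd b)).
  assert (Hc2 := Rle_abs (- snd c)). rewrite Rabs_Ropp in Ha2, Hb2, Hc2.
  assert (HM : 0 < M) by (unfold M; lra).
  set (d := e / M). assert (Hd : 0 < d) by (apply Rdiv_lt_0_compat; auto).
  destruct (triangle_area_sorted (fst a, - M) (fst a, M) (fst a + d, - M)) as [H _];
    [simpl; lra | simpl; lra |].
  apply area_le_mono with (3 := H).
  - intros x (u & v & w & Hu & Hv & Hw & Hs & Hx & Hy).
    assert (Hy1 : - M <= snd x <= M).
    { rewrite Hy. unfold M. split; nra. }
    exists ((M - snd x) / (2 * M)), ((M + snd x) / (2 * M)), 0. simpl.
    repeat split; try lra.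
    + apply Rdiv_le_0_compat; lra.
    + apply Rdiv_le_0_compat; lra.
    + field; lra.
    + rewrite Hx, <- Hbc, <- Hab. replace u with (1 - v - w) by lra. field. lra.
    + field. lra.
  - unfold det, vsub; simpl. unfold d.
    replace ((fst a - fst a) * (- M - - M) - (M - - M) * (fst a + e / M - fst a))
      with (- (2 * e)) by (field; lra).
    rewrite Rabs_left1; lra.
Qed.

Lemma triangle_area (a b c : R2) :
  area_le (triangle a b c) (Rabs (det (vsub b a) (vsub c a)) / 2) /\
  area_ge (triangle a b c) (Rabs (det (vsub b a) (vsub c a)) / 2).
Proof.
  set (P := fun a b c => area_le (triangle a b c) (Rabs (det (vsub b a) (vsub c a)) / 2) /\
    area_ge (triangle a b c) (Rabs (det (vsub b a) (vsub c a)) / 2)).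
  assert (H12 : forall a b c, P b a c -> P a b c).
  { intros a' b' c' [H1 H2]. split.
    - apply area_le_mono with (3 := H1); [intros x; apply triangle_swap12 |].
      right. f_equal. rewrite <- (Rabs_Ropp (det (vsub b' a') _)).
      f_equal. vec_ring.
    - apply area_ge_mono with (3 := H2); [intros x; apply triangle_swap12 |].
      right. f_equal. rewrite <- (Rabs_Ropp (det (vsub b' a') _)).
      f_equal. vec_ring. }
  assert (H23 : forall a b c, P a c b -> P a b c).
  { intros a' b' c' [H1 H2]. split.
    - apply area_le_mono with (3 := H1); [intros x; apply triangle_swap23 |].
      right. f_equal. rewrite <- (Rabs_Ropp (det (vsub b' a') _)).
      f_equal. vec_ring.
    - apply area_ge_mono with (3 := H2); [intros x; apply triangle_swap23 |].
      right. f_equal. rewrite <- (Rabs_Ropp (det (vsub b' a') _)).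
      f_equal. vec_ring. }
  assert (Hs : forall a b c, fst a <= fst b <= fst c -> P a b c).
  { intros a' b' c' Hs. destruct (Req_dec (fst a') (fst c')).
    - apply triangle_area_vertical; lra.
    - apply triangle_area_sorted; lra. }
  change (P a b c).
  destruct (Rle_dec (fst a) (fst b)), (Rle_dec (fst b) (fst c)), (Rle_dec (fst a) (fst c));
    first [ apply Hs; lra | apply H12, Hs; lra | apply H23, Hs; lra
          | apply H12, H23, Hs; lra | apply H23, H12, Hs; lra
          | apply H12, H23, H12, Hs; lra ].
Qed.

(** * Planar geometry *)

Lemma Rsup_is_lub (S : R -> Prop) : (exists x, S x) -> bound S -> is_lub S (Rsup S).
Proof.
  intros Hx Hb. unfold Rsup. apply epsilon_spec.
  destruct (completeness S Hb Hx) as [l Hl]. exists l; auto.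
Qed.

Lemma vsub_eq_0 x y : vsub x y = (0, 0) -> x = y.
Proof.
  destruct x, y. unfold vsub; simpl. intros H. injection H; intros. f_equal; lra.
Qed.

Lemma vsub_diag x : vsub x x = (0, 0).
Proof. unfold vsub. f_equal; ring. Qed.

Lemma dot_self_nonneg x : 0 <= dot x x.
Proof. unfold dot. nra. Qed.

Lemma dot_self_0 x : dot x x = 0 -> x = (0, 0).
Proof.
  destruct x as [a b]. unfold dot; simpl. intros H.
  assert (a = 0) by nra. assert (b = 0) by nra. subst; auto.
Qed.

Lemma dot_self_pos x : x <> (0, 0) -> 0 < dot x x.
Proof.
  intros Hx. destruct (dot_self_nonneg x) as [H | H]; auto.
  destruct Hx. apply dot_self_0; auto.
Qed.

Lemma vnorm_nonneg x : 0 <= vnorm x.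
Proof. apply sqrt_pos. Qed.

Lemma vnorm_sq x : vnorm x * vnorm x = dot x x.
Proof. apply sqrt_sqrt, dot_self_nonneg. Qed.

Lemma vnorm_lt x r : 0 < r -> vnorm x < r <-> dot x x < r * r.
Proof.
  intros Hr. rewrite <- vnorm_sq. assert (H := vnorm_nonneg x). split; intros; nra.
Qed.

Lemma vnorm_le x r : 0 <= r -> vnorm x <= r <-> dot x x <= r * r.
Proof.
  intros Hr. rewrite <- vnorm_sq. assert (H := vnorm_nonneg x). split; intros; nra.
Qed.

Lemma cauchy_schwarz_sq x y : dot x y * dot x y <= dot x x * dot y y.
Proof.
  unfold dot. assert (0 <= (fst x * snd y - snd x * fst y) ^ 2) by apply pow2_ge_0. nra.
Qed.

Lemma cauchy_schwarz x y : Rabs (dot x y) <= vnorm x * vnorm y.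
Proof.
  assert (Hx := vnorm_nonneg x). assert (Hy := vnorm_nonneg y).
  apply Rsqr_incr_0_var; [| nra]. rewrite <- Rsqr_abs. unfold Rsqr.
  replace (vnorm x * vnorm y * (vnorm x * vnorm y)) with
    ((vnorm x * vnorm x) * (vnorm y * vnorm y)) by ring.
  rewrite !vnorm_sq. apply cauchy_schwarz_sq.
Qed.

Lemma vnorm_vadd_le x y : vnorm (vadd x y) <= vnorm x + vnorm y.
Proof.
  assert (Hx := vnorm_nonneg x). assert (Hy := vnorm_nonneg y).
  apply vnorm_le; [lra |].
  assert (H := cauchy_schwarz x y). assert (H' := Rle_abs (dot x y)).
  replace (dot (vadd x y) (vadd x y)) with (dot x x + 2 * dot x y + dot y y) by vec_ring.
  rewrite <- !vnorm_sq. nra.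
Qed.

Lemma vnorm_vscale a x : vnorm (vscale a x) = Rabs a * vnorm x.
Proof.
  unfold vnorm. replace (dot (vscale a x) (vscale a x)) with (Rsqr a * dot x x)
    by (unfold dot, vscale, Rsqr; simpl; ring).
  rewrite sqrt_mult, sqrt_Rsqr_abs; auto; [apply Rle_0_sqr | apply dot_self_nonneg].
Qed.

Lemma vnorm_vsub_sym x y : vnorm (vsub x y) = vnorm (vsub y x).
Proof. unfold vnorm. f_equal. unfold dot, vsub; simpl. ring. Qed.

Lemma vnorm_triangle x y z : vnorm (vsub x z) <= vnorm (vsub x y) + vnorm (vsub y z).
Proof.
  eapply Rle_trans; [| apply vnorm_vadd_le]. right. f_equal.
  unfold vadd, vsub; simpl. f_equal; ring.
Qed.

Lemma vnorm_pos x : x <> (0, 0) -> 0 < vnorm x.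
Proof. intros H. apply sqrt_lt_R0, dot_self_pos; auto. Qed.

Lemma abs_fst_le_vnorm x : Rabs (fst x) <= vnorm x.
Proof.
  replace (fst x) with (dot x (1, 0)) by vec_ring.
  eapply Rle_trans; [apply cauchy_schwarz |].
  replace (vnorm (1, 0)) with 1; [lra |]. unfold vnorm, dot; simpl.
  replace (1 * 1 + 0 * 0) with 1 by ring. rewrite sqrt_1; auto.
Qed.

Lemma abs_snd_le_vnorm x : Rabs (snd x) <= vnorm x.
Proof.
  replace (snd x) with (dot x (0, 1)) by vec_ring.
  eapply Rle_trans; [apply cauchy_schwarz |].
  replace (vnorm (0, 1)) with 1; [lra |]. unfold vnorm, dot; simpl.
  replace (0 * 0 + 1 * 1) with 1 by ring. rewrite sqrt_1; auto.
Qed.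

Lemma vnorm_le_abs x : vnorm x <= Rabs (fst x) + Rabs (snd x).
Proof.
  assert (H1 := Rabs_pos (fst x)). assert (H2 := Rabs_pos (snd x)).
  apply vnorm_le; [lra |]. unfold dot.
  assert (E1 : fst x * fst x = Rabs (fst x) * Rabs (fst x))
    by (rewrite <- Rabs_mult, Rabs_pos_eq; nra).
  assert (E2 : snd x * snd x = Rabs (snd x) * Rabs (snd x))
    by (rewrite <- Rabs_mult, Rabs_pos_eq; nra).
  rewrite E1, E2. nra.
Qed.

Lemma vnorm_seg_diff x y s t :
  vnorm (vsub (seg x y s) (seg x y t)) = Rabs (s - t) * vnorm (vsub y x).
Proof.
  rewrite <- vnorm_vscale. f_equal. unfold seg, vadd, vscale, vsub; simpl. f_equal; ring.
Qed.

(** The exit parameter is the supremum of those up to which the segment stays in [Om]; openness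
    keeps the point reached out of [Om], and earlier points approach it. *)
Lemma segment_exit (Om : R2 -> Prop) x y : open2 Om -> Om x -> ~ Om y ->
  exists s, 0 < s <= 1 /\ boundary2 Om (seg x y s) /\
    forall s', 0 <= s' < s -> Om (seg x y s').
Proof.
  intros Ho Hx Hy.
  set (E := fun s => 0 <= s <= 1 /\ forall s', 0 <= s' <= s -> Om (seg x y s')).
  assert (E0 : seg x y 0 = x)
    by (destruct x; unfold seg, vadd, vscale, vsub; simpl; f_equal; ring).
  assert (E1 : seg x y 1 = y)
    by (destruct y; unfold seg, vadd, vscale, vsub; simpl; f_equal; ring).
  set (L := vnorm (vsub y x)). assert (HL : 0 <= L) by apply vnorm_nonneg.
  assert (Hnear : forall s, Om (seg x y s) -> exists d, 0 < d /\
            forall s', Rabs (s' - s) < d -> Om (seg x y s')).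
  { intros s Hs. destruct (Ho _ Hs) as (e & He & Hball).
    exists (e / (L + 1)). split; [apply Rdiv_lt_0_compat; lra |].
    intros s' Hs'. apply Hball. rewrite vnorm_seg_diff. fold L.
    apply Rmult_lt_compat_r with (r := L + 1) in Hs'; [| lra].
    replace (e / (L + 1) * (L + 1)) with e in Hs' by (field; lra).
    assert (H := Rabs_pos (s' - s)). nra. }
  assert (HE0 : E 0).
  { split; [lra |]. intros s' Hs'. replace s' with 0 by lra. rewrite E0; auto. }
  destruct (completeness E) as [s [Hub Hlub]].
  { exists 1. intros s [Hs _]. lra. }
  { exists 0; auto. }
  assert (Hs0 : 0 <= s) by (apply Hub; auto).
  assert (Hs1 : s <= 1) by (apply Hlub; intros s' [H _]; lra).
  assert (Hin : forall s', 0 <= s' < s -> Om (seg x y s')).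
  { intros s' Hs'. apply NNPP. intros Hn.
    assert (s <= s'); [| lra]. apply Hlub. intros t [Ht1 Ht2].
    apply Rnot_lt_le. intros Hlt. apply Hn, Ht2. lra. }
  assert (Hnot : ~ Om (seg x y s)).
  { intros Hs. destruct (Hnear s Hs) as (d & Hd & Hball).
    assert (Hlt : s < 1).
    { destruct Hs1 as [|Heq]; auto. rewrite Heq, E1 in Hs. contradiction. }
    assert (HE : E (Rmin 1 (s + d / 2))).
    { split; [split; [apply Rmin_glb; lra | apply Rmin_l] |].
      intros s' [Hs'1 Hs'2]. destruct (Rlt_dec s' s); [apply Hin; lra |].
      apply Hball. assert (H := Rmin_r 1 (s + d / 2)). apply Rabs_lt_between'. lra. }
    apply Hub in HE. assert (s < Rmin 1 (s + d / 2)) by (apply Rmin_glb_lt; lra). lra. }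
  assert (Hpos : 0 < s).
  { destruct Hs0 as [|Heq]; auto. rewrite <- Heq, E0 in Hnot. contradiction. }
  exists s. repeat split; auto.
  intros e He. exists (seg x y (Rmax 0 (s - e / (2 * (L + 1))))).
  assert (Hd : 0 < e / (2 * (L + 1))) by (apply Rdiv_lt_0_compat; lra).
  assert (Hm1 := Rmax_l 0 (s - e / (2 * (L + 1)))).
  assert (Hm2 := Rmax_r 0 (s - e / (2 * (L + 1)))).
  assert (Hm3 : Rmax 0 (s - e / (2 * (L + 1))) < s) by (apply Rmax_lub_lt; lra).
  split; [apply Hin; lra |].
  rewrite vnorm_seg_diff. fold L. rewrite Rabs_left by lra.
  apply Rle_lt_trans with (e / (2 * (L + 1)) * (L + 1)); [apply Rmult_le_compat; lra |].
  replace (e / (2 * (L + 1)) * (L + 1)) with (e / 2) by (field; lra). lra.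
Qed.

(** A segment from [x0] to a missing point of the ball would exit through a boundary point, which
    convexity places inside the ball. *)
Lemma boundary_free_ball_inside (Om : R2 -> Prop) c rho x0 : open2 Om ->
  (forall z, boundary2 Om z -> rho <= vnorm (vsub z c)) ->
  vnorm (vsub x0 c) < rho -> Om x0 ->
  forall x, vnorm (vsub x c) < rho -> Om x.
Proof.
  intros Ho Hb Hx0 H0 x Hx. apply NNPP. intros Hn.
  destruct (segment_exit Om x0 x Ho H0 Hn) as (s & Hs & Hbd & _).
  specialize (Hb _ Hbd). apply Rle_not_lt in Hb. apply Hb.
  replace (vsub (seg x0 x s) c) with (vadd (vscale (1 - s) (vsub x0 c)) (vscale s (vsub x c)))
    by vec_ring.
  eapply Rle_lt_trans; [apply vnorm_vadd_le |]. rewrite !vnorm_vscale.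
  rewrite !Rabs_pos_eq by lra. nra.
Qed.

(** A point of [Om] outside the circle, pushed away from [c], would leave the bounded set through a
    boundary point farther than [rho]. Openness then excludes points on the circle, and the open
    disk, free of boundary points, is filled. *)
Lemma disk_of_boundary_in_circle (Om : R2 -> Prop) c rho :
  0 < rho -> open2 Om -> bounded2 Om -> (exists x, Om x) ->
  (forall z, boundary2 Om z -> vnorm (vsub z c) = rho) -> is_disk Om.
Proof.
  intros Hr Ho [M HM] [x0 Hx0] Hb.
  assert (Hout : forall x, Om x -> vnorm (vsub x c) <= rho).
  { intros x Hx. apply Rnot_lt_le. intros Hlt.
    (* Chosen so that [K * rho] exceeds [M + vnorm c], which puts [y] beyond the bound [M]. *)
    set (K := (Rabs M + vnorm c + 1) / rho + 1).
    assert (HK : 1 < K).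
    { unfold K. assert (0 < (Rabs M + vnorm c + 1) / rho); [| lra].
      apply Rdiv_lt_0_compat; auto.
      assert (H1 := Rabs_pos M). assert (H2 := vnorm_nonneg c). lra. }
    set (y := vadd c (vscale K (vsub x c))).
    assert (Hy : ~ Om y).
    { intros Hy. apply HM in Hy. assert (H1 := vnorm_triangle y (0, 0) c).
      replace (vsub y c) with (vscale K (vsub x c)) in H1
        by (unfold y, vadd, vscale, vsub; simpl; f_equal; ring).
      rewrite vnorm_vscale, Rabs_pos_eq in H1 by lra.
      replace (vsub y (0, 0)) with y in H1 by (unfold vsub; destruct y; simpl; f_equal; ring).
      rewrite (vnorm_vsub_sym (0, 0) c) in H1.
      replace (vsub c (0, 0)) with c in H1 by (unfold vsub; destruct c; simpl; f_equal; ring).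
      assert (H2 : K * rho <= K * vnorm (vsub x c)) by (apply Rmult_le_compat_l; lra).
      replace (K * rho) with (Rabs M + vnorm c + 1 + rho) in H2 by (unfold K; field; lra).
      assert (H3 := Rle_abs M). lra. }
    destruct (segment_exit Om x y Ho Hx Hy) as (s & Hs & Hbd & _).
    apply Hb in Hbd.
    replace (vsub (seg x y s) c) with (vscale (1 + s * (K - 1)) (vsub x c)) in Hbd
      by (unfold seg, y, vadd, vscale, vsub; simpl; f_equal; ring).
    rewrite vnorm_vscale, Rabs_pos_eq in Hbd by nra.
    assert (0 <= s * (K - 1)) by (apply Rmult_le_pos; lra).
    assert (0 <= s * (K - 1) * vnorm (vsub x c)) by (apply Rmult_le_pos; lra). lra. }
  assert (Hon : forall x, Om x -> vnorm (vsub x c) < rho).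
  { intros x Hx. destruct (Hout x Hx) as [|Heq]; auto. exfalso.
    destruct (Ho x Hx) as (e & He & Hball).
    set (t := e / (2 * rho)). assert (Ht : 0 < t) by (apply Rdiv_lt_0_compat; lra).
    assert (Hz : Om (vadd x (vscale t (vsub x c)))).
    { apply Hball. replace (vsub (vadd x (vscale t (vsub x c))) x) with (vscale t (vsub x c))
        by vec_ring.
      rewrite vnorm_vscale, Rabs_pos_eq, Heq by lra. unfold t.
      replace (e / (2 * rho) * rho) with (e / 2) by (field; lra). lra. }
    apply Hout in Hz.
    replace (vsub (vadd x (vscale t (vsub x c))) c) with (vscale (1 + t) (vsub x c)) in Hz
      by vec_ring.
    rewrite vnorm_vscale, Rabs_pos_eq, Heq in Hz by lra. nra. }
  exists c, rho. split; auto. intros x. split; [apply Hon |].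
  apply boundary_free_ball_inside with x0; auto.
  intros z Hz. right. symmetry. auto.
Qed.

(** Otherwise the point dividing the segment of centres in the ratio [r1 : r2] would lie in both
    balls. *)
Lemma separated_balls c1 r1 c2 r2 : 0 < r1 -> 0 < r2 ->
  (forall x, vnorm (vsub x c1) < r1 -> vnorm (vsub x c2) < r2 -> False) ->
  r1 + r2 <= vnorm (vsub c1 c2).
Proof.
  intros H1 H2 Hd. apply Rnot_lt_le. intros Hlt.
  apply (Hd (seg c1 c2 (r1 / (r1 + r2)))).
  - replace (vsub (seg c1 c2 (r1 / (r1 + r2))) c1) with (vscale (r1 / (r1 + r2)) (vsub c2 c1))
      by vec_ring.
    rewrite vnorm_vscale, Rabs_pos_eq, vnorm_vsub_sym by (apply Rdiv_le_0_compat; lra).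
    apply Rmult_lt_reg_l with ((r1 + r2) / r1); [apply Rdiv_lt_0_compat; lra |].
    field_simplify; lra.
  - replace (vsub (seg c1 c2 (r1 / (r1 + r2))) c2) with (vscale (r2 / (r1 + r2)) (vsub c1 c2))
      by (unfold seg, vadd, vscale, vsub; simpl; f_equal; field; lra).
    rewrite vnorm_vscale, Rabs_pos_eq by (apply Rdiv_le_0_compat; lra).
    apply Rmult_lt_reg_l with ((r1 + r2) / r2); [apply Rdiv_lt_0_compat; lra |].
    field_simplify; lra.
Qed.

(** [Rsup] is unspecified on unbounded sets; this box count supplies the bound that makes [area] a
    genuine supremum. *)
Lemma dyadic_points_bounded M n (l : list (Z * Z)) : 0 <= M -> NoDup l ->
  (forall ij, In ij l -> Rabs (fst (pt n ij)) <= M /\ Rabs (snd (pt n ij)) <= M) ->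
  INR (length l) <= 4 ^ n * ((2 * M + 1) * (2 * M + 1)).
Proof.
  intros HM Hl Hin. assert (Hp := pow_2_pos n).
  assert (Hp1 : 1 <= 2 ^ n) by (apply pow_R1_Rle; lra).
  set (I := zinterval (- (2 ^ n * M)) (2 ^ n * M)).
  assert (HI : INR (length I) <= 2 ^ n * (2 * M + 1)).
  { destruct (length_zinterval (- (2 ^ n * M)) (2 ^ n * M) ltac:(nra)) as [_ H].
    fold I in H. nra. }
  assert (Hle : (length l <= length (list_prod I I))%nat).
  { apply NoDup_incl_length; auto. intros [i j] Hij.
    destruct (Hin _ Hij) as [H1 H2]. unfold pt in H1, H2; simpl in H1, H2.
    assert (Hq : forall k, Rabs (IZR k / 2 ^ n) <= M -> In k I).
    { intros k Hk. rewrite Rabs_le_between in Hk. unfold I. rewrite In_zinterval.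
      replace (IZR k) with (2 ^ n * (IZR k / 2 ^ n)) by (field; lra).
      split; nra. }
    apply in_prod; auto. }
  apply le_INR in Hle. rewrite length_prod, mult_INR in Hle. rewrite pow_4_2.
  assert (H0 := pos_INR (length I)).
  apply Rle_trans with (1 := Hle).
  replace (2 ^ n * 2 ^ n * ((2 * M + 1) * (2 * M + 1))) with
    ((2 ^ n * (2 * M + 1)) * (2 ^ n * (2 * M + 1))) by ring.
  apply Rmult_le_compat; auto.
Qed.

(** A lattice point of [S] is the lower left corner of a dyadic square which, for mesh at most
    [eta / 2], stays within [eta] of the point and hence in [Om]. The margin turns counted points
    into inscribed squares. *)
Lemma area_ge_area (Om S : R2 -> Prop) eta A : bounded2 Om -> 0 < eta ->
  (forall x z, S x -> vnorm (vsub z x) < eta -> Om z) ->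
  area_ge S A -> A <= area Om.
Proof.
  intros [M HM] Heta HS HA. unfold area.
  set (E := fun a => exists (n : nat) (l : list (Z * Z)), NoDup l /\
          (forall ij, In ij l -> forall x, in_dyadic_square n ij x -> Om x) /\
          a = INR (length l) / 4 ^ n).
  assert (Hlub : is_lub E (Rsup E)).
  { apply Rsup_is_lub.
    - exists 0, 0%nat, nil. repeat split; [constructor | intros ij [] | simpl; field].
    - exists ((2 * Rabs M + 1) * (2 * Rabs M + 1)). intros a (n & l & Hl & Hin & ->).
      assert (Hp := pow_4_pos n).
      apply Rmult_le_reg_l with (4 ^ n); auto.
      replace (4 ^ n * (INR (length l) / 4 ^ n)) with (INR (length l)) by (field; lra).
      apply dyadic_points_bounded; auto using Rabs_pos.
      intros ij Hij. assert (Hx : Om (pt n ij)).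
      { apply (Hin ij Hij). assert (Hp2 := pow_2_pos n).
        unfold in_dyadic_square, pt; simpl.
        rewrite !plus_IZR. unfold Rdiv. assert (0 < / 2 ^ n) by (apply Rinv_0_lt_compat; auto).
        split; split; nra. }
      apply HM in Hx. assert (H1 := abs_fst_le_vnorm (pt n ij)).
      assert (H2 := abs_snd_le_vnorm (pt n ij)). assert (H3 := Rle_abs M). lra. }
  apply le_epsilon. intros e He.
  destruct (HA e He) as [n0 Hn0].
  destruct (pow_2_eventually_large 2 eta Heta) as [n1 Hn1].
  set (n := Nat.max n0 n1). destruct (Hn0 n ltac:(unfold n; lia)) as (l & Hl & Hi & Hc).
  specialize (Hn1 n ltac:(unfold n; lia)).
  assert (Hp := pow_4_pos n). assert (Hp2 := pow_2_pos n).
  assert (Hin : E (INR (length l) / 4 ^ n)).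
  { exists n, l. repeat split; auto. intros ij Hij x [[H1 H2] [H3 H4]].
    apply (HS (pt n ij)); auto.
    assert (Hv : 0 < / 2 ^ n) by (apply Rinv_0_lt_compat; auto).
    assert (Hd : 2 * / 2 ^ n <= eta).
    { rewrite pow_4_2 in Hn1.
      apply Rmult_le_reg_r with (2 ^ n * 2 ^ n); [apply Rmult_lt_0_compat; auto |].
      replace (2 * / 2 ^ n * (2 ^ n * 2 ^ n)) with (2 * 2 ^ n) by (field; lra). lra. }
    rewrite plus_IZR in H2, H4. unfold Rdiv in *.
    apply vnorm_lt; auto. unfold dot, vsub, pt; simpl. unfold Rdiv.
    set (h := / 2 ^ n) in *. clearbody h.
    assert (0 <= fst x - IZR (fst ij) * h <= h) by lra.
    assert (0 <= snd x - IZR (snd ij) * h <= h) by lra.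
    nra. }
  apply Hlub in Hin.
  apply Rle_div_l in Hin; auto.
  assert (H : 4 ^ n * (A - e) <= 4 ^ n * Rsup E) by lra.
  apply Rmult_le_reg_l in H; auto. lra.
Qed.

(** * Calculus along plane curves *)

Lemma dot_rot x v : dot x (rot v) = det x v.
Proof. unfold dot, rot, det; simpl. ring. Qed.

Definition vcont (f : R -> R2) (t : R) : Prop :=
  continuity_pt (fun s => fst (f s)) t /\ continuity_pt (fun s => snd (f s)) t.

Lemma continuity_pt_cst c t : continuity_pt (fun _ => c) t.
Proof. apply continuity_pt_const. intros ? ?. auto. Qed.

Lemma vcont_const v t : vcont (fun _ => v) t.
Proof. split; apply continuity_pt_cst. Qed.

Lemma vcont_vadd f h t : vcont f t -> vcont h t -> vcont (fun s => vadd (f s) (h s)) t.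
Proof. intros [H1 H2] [H3 H4]. split; simpl; apply continuity_pt_plus; auto. Qed.

Lemma vcont_vsub f h t : vcont f t -> vcont h t -> vcont (fun s => vsub (f s) (h s)) t.
Proof. intros [H1 H2] [H3 H4]. split; simpl; apply continuity_pt_minus; auto. Qed.

Lemma vcont_vscale a f t :
  continuity_pt a t -> vcont f t -> vcont (fun s => vscale (a s) (f s)) t.
Proof. intros Ha [H1 H2]. split; simpl; apply continuity_pt_mult; auto. Qed.

Lemma vcont_rot f t : vcont f t -> vcont (fun s => rot (f s)) t.
Proof. intros [H1 H2]. split; simpl; auto. apply continuity_pt_opp; auto. Qed.

Lemma continuity_pt_dot f h t :
  vcont f t -> vcont h t -> continuity_pt (fun s => dot (f s) (h s)) t.
Proof.
  intros [H1 H2] [H3 H4].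
  apply (continuity_pt_plus (fun s => fst (f s) * fst (h s)) (fun s => snd (f s) * snd (h s)));
    apply continuity_pt_mult; auto.
Qed.

Lemma continuity_pt_det f h t :
  vcont f t -> vcont h t -> continuity_pt (fun s => det (f s) (h s)) t.
Proof.
  intros [H1 H2] [H3 H4].
  apply (continuity_pt_minus (fun s => fst (f s) * snd (h s)) (fun s => snd (f s) * fst (h s)));
    apply continuity_pt_mult; auto.
Qed.

Lemma continuity_pt_vnorm f t : vcont f t -> continuity_pt (fun s => vnorm (f s)) t.
Proof.
  intros H. apply (continuity_pt_comp (fun s => dot (f s) (f s)) sqrt).
  - apply continuity_pt_dot; auto.
  - apply continuity_pt_sqrt, dot_self_nonneg.
Qed.

Lemma continuity_pt_eps f t : continuity_pt f t ->
  forall e, 0 < e -> exists d, 0 < d /\ forall s, Rabs (s - t) < d -> Rabs (f s - f t) < e.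
Proof.
  intros H e He. destruct (H e He) as (d & Hd & Hs). exists d. split; auto.
  intros s Hst. destruct (Req_dec s t) as [-> | Hne].
  - rewrite Rminus_diag, Rabs_R0; auto.
  - apply Hs. split; auto. split; [exact I | auto].
Qed.

Lemma vcont_eps f t : vcont f t ->
  forall e, 0 < e ->
  exists d, 0 < d /\ forall s, Rabs (s - t) < d -> vnorm (vsub (f s) (f t)) < e.
Proof.
  intros [H1 H2] e He.
  destruct (continuity_pt_eps _ _ H1 (e / 2) ltac:(lra)) as (d1 & Hd1 & Hs1).
  destruct (continuity_pt_eps _ _ H2 (e / 2) ltac:(lra)) as (d2 & Hd2 & Hs2).
  destruct (common_scale d1 d2 Hd1 Hd2) as (d & Hd & Hl & Hr).
  exists d. split; auto. intros s Hs.
  eapply Rle_lt_trans; [apply vnorm_le_abs |]. unfold vsub; simpl.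
  specialize (Hs1 s ltac:(lra)). specialize (Hs2 s ltac:(lra)). lra.
Qed.

Definition vder (f : R -> R2) (t : R) (v : R2) : Prop :=
  derivable_pt_lim (fun s => fst (f s)) t (fst v) /\
  derivable_pt_lim (fun s => snd (f s)) t (snd v).

Lemma vder_vcont f t v : vder f t v -> vcont f t.
Proof.
  intros [H1 H2]. split; apply derivable_continuous_pt; eexists; eauto.
Qed.

Lemma vder_vsub f h t u v : vder f t u -> vder h t v ->
  vder (fun s => vsub (f s) (h s)) t (vsub u v).
Proof. intros [H1 H2] [H3 H4]. split; simpl; apply derivable_pt_lim_minus; auto. Qed.

Lemma vder_vscale_const a f t u : vder f t u ->
  vder (fun s => vscale a (f s)) t (vscale a u).
Proof. intros [H1 H2]. split; simpl; apply derivable_pt_lim_scal; auto. Qed.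

Lemma derivable_pt_lim_dot f h t u v : vder f t u -> vder h t v ->
  derivable_pt_lim (fun s => dot (f s) (h s)) t (dot u (h t) + dot (f t) v).
Proof.
  intros [H1 H2] [H3 H4].
  replace (dot u (h t) + dot (f t) v) with
    ((fst u * fst (h t) + fst (f t) * fst v) + (snd u * snd (h t) + snd (f t) * snd v)) by vec_ring.
  apply (derivable_pt_lim_plus (fun s => fst (f s) * fst (h s)) (fun s => snd (f s) * snd (h s)));
    [apply (derivable_pt_lim_mult (fun s => fst (f s)) (fun s => fst (h s)))
    |apply (derivable_pt_lim_mult (fun s => snd (f s)) (fun s => snd (h s)))]; auto.
Qed.

Lemma vder_const c t : vder (fun _ => c) t (0, 0).
Proof. split; apply derivable_pt_lim_const. Qed.

Lemma derivable_pt_lim_dot_const f t u e : vder f t u ->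
  derivable_pt_lim (fun s => dot (f s) e) t (dot u e).
Proof.
  intros H. replace (dot u e) with (dot u e + dot (f t) (0, 0)) by vec_ring.
  apply (derivable_pt_lim_dot f (fun _ => e)); auto. apply vder_const.
Qed.

Lemma derivable_pt_lim_vnorm f t u : vder f t u -> f t <> (0, 0) ->
  derivable_pt_lim (fun s => vnorm (f s)) t (dot (f t) u / vnorm (f t)).
Proof.
  intros H Hne. assert (Hp := dot_self_pos _ Hne).
  replace (dot (f t) u / vnorm (f t)) with
    (/ (2 * sqrt (dot (f t) (f t))) * (dot u (f t) + dot (f t) u)).
  - apply (derivable_pt_lim_comp (fun s => dot (f s) (f s)) sqrt).
    + apply derivable_pt_lim_dot; auto.
    + apply derivable_pt_lim_sqrt; auto.
  - assert (Hq := vnorm_pos _ Hne). unfold vnorm in *.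
    replace (dot u (f t)) with (dot (f t) u) by vec_ring. field. lra.
Qed.

(** [rot] turns clockwise, so for a curve running counterclockwise around the origin [sigma = 1]
    gives the outer side; [sigma = -1] serves the other direction. *)
Definition unit_normal (sigma : R) (f1 : R -> R2) (t : R) : R2 :=
  vscale (sigma / vnorm (f1 t)) (rot (f1 t)).

Definition signed_curvature (sigma : R) (f1 f2 : R -> R2) (t : R) : R :=
  - dot (f2 t) (unit_normal sigma f1 t) / dot (f1 t) (f1 t).

Lemma unit_normal_norm sigma f1 t : sigma * sigma = 1 -> f1 t <> (0, 0) ->
  dot (unit_normal sigma f1 t) (unit_normal sigma f1 t) = 1.
Proof.
  intros Hs Hne. assert (Hq := vnorm_pos _ Hne). assert (Hd := vnorm_sq (f1 t)).
  unfold unit_normal.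
  replace (dot (vscale (sigma / vnorm (f1 t)) (rot (f1 t))) (vscale (sigma / vnorm (f1 t)) (rot (f1 t))))
    with (sigma * sigma * (dot (f1 t) (f1 t) / (vnorm (f1 t) * vnorm (f1 t))))
    by (unfold dot, vscale, rot; simpl; field; lra).
  rewrite Hs, <- Hd. field. lra.
Qed.

Lemma unit_normal_orth sigma f1 t : dot (unit_normal sigma f1 t) (f1 t) = 0.
Proof. unfold unit_normal, dot, vscale, rot; simpl. ring. Qed.

Lemma vcont_unit_normal sigma f1 t : vcont f1 t -> f1 t <> (0, 0) ->
  vcont (unit_normal sigma f1) t.
Proof.
  intros H Hne. apply vcont_vscale; [| apply vcont_rot; auto].
  apply continuity_pt_mult; [apply continuity_pt_cst |].
  apply continuity_pt_inv; [apply continuity_pt_vnorm; auto |].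
  apply Rgt_not_eq, vnorm_pos; auto.
Qed.

Lemma continuity_pt_signed_curvature sigma f1 f2 t : vcont f1 t -> vcont f2 t ->
  f1 t <> (0, 0) -> continuity_pt (signed_curvature sigma f1 f2) t.
Proof.
  intros H1 H2 Hne. apply continuity_pt_mult.
  - apply continuity_pt_opp, continuity_pt_dot; auto. apply vcont_unit_normal; auto.
  - apply continuity_pt_inv; [apply continuity_pt_dot; auto |].
    apply Rgt_not_eq, dot_self_pos; auto.
Qed.

(* Frenet's formula for the normal, valid for both orientations. *)
Lemma vder_unit_normal sigma f1 f2 t : vder f1 t (f2 t) -> f1 t <> (0, 0) ->
  vder (unit_normal sigma f1) t (vscale (signed_curvature sigma f1 f2 t) (f1 t)).
Proof.
  intros H Hne. assert (Hq := vnorm_pos _ Hne). assert (Hd := vnorm_sq (f1 t)).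
  assert (Hn := derivable_pt_lim_vnorm _ _ _ H Hne).
  assert (Hi : derivable_pt_lim (fun s => sigma / vnorm (f1 s)) t
    ((0 * vnorm (f1 t) - dot (f1 t) (f2 t) / vnorm (f1 t) * sigma) / Rsqr (vnorm (f1 t)))).
  { apply (derivable_pt_lim_div (fun _ => sigma) (fun s => vnorm (f1 s)));
      [apply derivable_pt_lim_const | auto | lra]. }
  destruct H as [H1 H2].
  unfold signed_curvature, unit_normal. rewrite <- Hd.
  set (q := vnorm (f1 t)) in *.
  assert (Hdd : q * q = fst (f1 t) * fst (f1 t) + snd (f1 t) * snd (f1 t)) by exact Hd.
  split; simpl.
  - replace (- dot (f2 t) (vscale (sigma / q) (rot (f1 t))) / (q * q) * fst (f1 t)) with
      ((0 * q - dot (f1 t) (f2 t) / q * sigma) / Rsqr q * snd (f1 t) + sigma / q * snd (f2 t)).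
    + apply (derivable_pt_lim_mult (fun s => sigma / vnorm (f1 s)) (fun s => snd (f1 s))); auto.
    + unfold Rsqr, dot, vscale, rot; simpl.
      apply Rmult_eq_reg_l with (q * q * q); [| apply Rgt_not_eq, Rmult_lt_0_compat; nra].
      field_simplify; [| lra | lra].
      replace (q ^ 2) with (fst (f1 t) * fst (f1 t) + snd (f1 t) * snd (f1 t)) by (rewrite <- Hdd; ring).
      ring.
  - replace (- dot (f2 t) (vscale (sigma / q) (rot (f1 t))) / (q * q) * snd (f1 t)) with
      ((0 * q - dot (f1 t) (f2 t) / q * sigma) / Rsqr q * - fst (f1 t) + sigma / q * - fst (f2 t)).
    + apply (derivable_pt_lim_mult (fun s => sigma / vnorm (f1 s)) (fun s => - fst (f1 s))); auto.
      apply derivable_pt_lim_opp; auto.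
    + unfold Rsqr, dot, vscale, rot; simpl.
      apply Rmult_eq_reg_l with (q * q * q); [| apply Rgt_not_eq, Rmult_lt_0_compat; nra].
      field_simplify; [| lra | lra].
      replace (q ^ 2) with (fst (f1 t) * fst (f1 t) + snd (f1 t) * snd (f1 t)) by (rewrite <- Hdd; ring).
      ring.
Qed.

(* The pointwise form of Minkowski's formula. *)
Lemma derivable_pt_lim_support sigma f f1 f2 t : sigma * sigma = 1 ->
  vder f t (f1 t) -> vder f1 t (f2 t) -> f1 t <> (0, 0) ->
  derivable_pt_lim (fun s => dot (f s) (f1 s) / vnorm (f1 s)) t
    (vnorm (f1 t) -
     signed_curvature sigma f1 f2 t * (dot (f t) (unit_normal sigma f1 t) * vnorm (f1 t))).
Proof.
  intros Hs H0 H1 Hne. assert (Hq := vnorm_pos _ Hne). assert (Hd := vnorm_sq (f1 t)).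
  assert (Hn := derivable_pt_lim_vnorm _ _ _ H1 Hne).
  assert (Hp := derivable_pt_lim_dot _ _ _ _ _ H0 H1).
  assert (Hdiv := derivable_pt_lim_div _ _ _ _ _ Hp Hn (Rgt_not_eq _ _ Hq)).
  match type of Hdiv with derivable_pt_lim _ _ ?l =>
    match goal with |- derivable_pt_lim _ _ ?l' => replace l' with l; [exact Hdiv |] end end.
  unfold signed_curvature, unit_normal. rewrite <- Hd.
  set (q := vnorm (f1 t)) in *.
  assert (Hdd : q * q = fst (f1 t) * fst (f1 t) + snd (f1 t) * snd (f1 t)) by exact Hd.
  unfold Rsqr.
  replace (- dot (f2 t) (vscale (sigma / q) (rot (f1 t))) / (q * q) *
   (dot (f t) (vscale (sigma / q) (rot (f1 t))) * q)) with
   (- (sigma * sigma) * (dot (f2 t) (rot (f1 t)) * dot (f t) (rot (f1 t)) / (q * q * q)))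
   by (unfold dot, vscale; simpl; field; lra).
  rewrite Hs. unfold dot, rot in *; simpl.
  apply Rmult_eq_reg_l with (q * q * q); [| apply Rgt_not_eq, Rmult_lt_0_compat; nra].
  field_simplify; [| lra | lra].
  replace (q ^ 4) with ((q * q) * (q * q)) by ring.
  replace (q ^ 2) with (q * q) by ring.
  rewrite Hdd. ring.
Qed.

(** * Integrals, uniform continuity and mean values *)

Lemma continuity_pt_continuous (f : R -> R) t : continuity_pt f t -> continuous f t.
Proof. apply continuity_pt_filterlim. Qed.

Lemma ex_RInt_cont (f : R -> R) a b : a <= b ->
  (forall t, a <= t <= b -> continuity_pt f t) -> ex_RInt f a b.
Proof.
  intros Hab H. apply (ex_RInt_continuous (V := R_CompleteNormedModule)).
  intros z Hz. rewrite Rmin_left, Rmax_right in Hz by lra.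
  apply continuity_pt_continuous; auto.
Qed.

Lemma RInt_derivative (f f' : R -> R) a b : a <= b ->
  (forall t, a <= t <= b -> derivable_pt_lim f t (f' t)) ->
  (forall t, a <= t <= b -> continuity_pt f' t) ->
  RInt f' a b = f b - f a.
Proof.
  intros Hab Hd Hc. apply is_RInt_unique.
  apply (is_RInt_derive (V := R_CompleteNormedModule)); intros t Ht;
    rewrite Rmin_left, Rmax_right in Ht by lra.
  - apply is_derive_Reals; auto.
  - apply continuity_pt_continuous; auto.
Qed.

Lemma RInt_const_bounds (f : R -> R) a b c w : a <= b ->
  (forall t, a <= t <= b -> continuity_pt f t) ->
  (forall t, a <= t <= b -> Rabs (f t - c) <= w) ->
  Rabs ((b - a) * c - RInt f a b) <= w * (b - a).
Proof.
  intros Hab Hc Hw. assert (Hex := ex_RInt_cont f a b Hab Hc).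
  assert (H1 : RInt f a b <= RInt (fun _ => c + w) a b).
  { apply RInt_le; auto; [apply ex_RInt_const |].
    intros t Ht. specialize (Hw t ltac:(lra)). apply Rabs_le_between in Hw. lra. }
  assert (H2 : RInt (fun _ => c - w) a b <= RInt f a b).
  { apply RInt_le; auto; [apply ex_RInt_const |].
    intros t Ht. specialize (Hw t ltac:(lra)). apply Rabs_le_between in Hw. lra. }
  rewrite RInt_const in H1, H2. unfold scal in H1, H2; simpl in H1, H2.
  unfold mult in H1, H2; simpl in H1, H2. apply Rabs_le_between. lra.
Qed.

Lemma riemann_sum_close (f : R -> R) a b w M : a <= b -> (0 < M)%nat ->
  (forall t, a <= t <= b -> continuity_pt f t) ->
  (forall s t, a <= s <= b -> a <= t <= b -> Rabs (s - t) <= (b - a) / INR M ->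
     Rabs (f s - f t) <= w) ->
  Rabs (psum (fun i => (b - a) / INR M * f (a + INR i * ((b - a) / INR M))) M - RInt f a b)
    <= w * (b - a).
Proof.
  intros Hab HM Hc Hw. set (h := (b - a) / INR M).
  assert (HM0 : 0 < INR M) by (apply lt_0_INR; auto).
  assert (Hh : 0 <= h) by (apply Rdiv_le_0_compat; lra).
  assert (HMh : INR M * h = b - a) by (unfold h; field; lra).
  assert (H : forall k, (k <= M)%nat ->
    Rabs (psum (fun i => h * f (a + INR i * h)) k - RInt f a (a + INR k * h)) <= w * (INR k * h)).
  { induction k as [|k IH]; intros Hk.
    - simpl. rewrite Rmult_0_l, Rplus_0_r, RInt_point. unfold zero; simpl.
      rewrite Rminus_diag, Rabs_R0. lra.
    - assert (Hk1 : INR (S k) * h <= b - a).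
      { rewrite <- HMh. apply Rmult_le_compat_r; auto. apply le_INR; auto. }
      rewrite S_INR in Hk1 |- *. assert (Hk0 : 0 <= INR k * h) by (apply Rmult_le_pos; auto; apply pos_INR).
      specialize (IH ltac:(lia)). simpl psum.
      rewrite <- (RInt_Chasles (V := R_CompleteNormedModule) f a (a + INR k * h)).
      2,3: apply ex_RInt_cont; [lra |]; intros; apply Hc; lra.
      unfold plus; simpl.
      assert (Hb := RInt_const_bounds f (a + INR k * h) (a + (INR k + 1) * h) (f (a + INR k * h)) w
         ltac:(lra)).
      assert (Hb' : Rabs ((a + (INR k + 1) * h - (a + INR k * h)) * f (a + INR k * h) -
        RInt f (a + INR k * h) (a + (INR k + 1) * h)) <= w * (a + (INR k + 1) * h - (a + INR k * h))).
      { apply Hb; intros t Ht; [apply Hc; lra |]. apply Hw; try lra.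
        fold h. apply Rabs_le_between. lra. }
      replace (a + (INR k + 1) * h - (a + INR k * h)) with h in Hb' by ring.
      apply Rabs_le_between in IH. apply Rabs_le_between in Hb'. apply Rabs_le_between. lra. }
  specialize (H M (le_n _)). rewrite HMh in H. replace (a + (b - a)) with b in H by ring.
  exact H.
Qed.

Lemma uniform_modulus (f : R -> R) a b e : 0 < e ->
  (forall t, a <= t <= b -> continuity_pt f t) ->
  exists d, 0 < d /\ forall s t, a <= s <= b -> a <= t <= b -> Rabs (s - t) <= d ->
    Rabs (f s - f t) <= e.
Proof.
  intros He Hc. destruct (Heine_cor2 Hc (mkposreal e He)) as [d Hd].
  assert (Hdp := cond_pos d). exists (d / 2). split; [lra |].
  intros s t Hs Ht Hst. left. apply Hd; auto. lra.
Qed.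

Lemma vuniform_modulus (f : R -> R2) a b e : 0 < e ->
  (forall t, a <= t <= b -> vcont f t) ->
  exists d, 0 < d /\ forall s t, a <= s <= b -> a <= t <= b -> Rabs (s - t) <= d ->
    vnorm (vsub (f s) (f t)) <= e.
Proof.
  intros He Hc.
  destruct (uniform_modulus (fun s => fst (f s)) a b (e / 2)) as (d1 & Hd1 & H1);
    [lra | intros; apply Hc; auto |].
  destruct (uniform_modulus (fun s => snd (f s)) a b (e / 2)) as (d2 & Hd2 & H2);
    [lra | intros; apply Hc; auto |].
  destruct (common_scale d1 d2 Hd1 Hd2) as (d & Hd & Hl & Hr).
  exists d. split; auto. intros s t Hs Ht Hst.
  eapply Rle_trans; [apply vnorm_le_abs |]. unfold vsub; simpl.
  specialize (H1 s t Hs Ht ltac:(lra)). specialize (H2 s t Hs Ht ltac:(lra)). lra.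
Qed.

(** The scalar mean value theorem, applied to the component along the error vector [e] itself,
    bounds [dot e e] by [w * (b - a) * vnorm e]. *)
Lemma vector_mean_value (f f' : R -> R2) a b c w : a <= b ->
  (forall t, a <= t <= b -> vder f t (f' t)) ->
  (forall t, a <= t <= b -> vnorm (vsub (f' t) c) <= w) ->
  vnorm (vsub (vsub (f b) (f a)) (vscale (b - a) c)) <= w * (b - a).
Proof.
  intros [Hab | <-] Hd Hw.
  2: { replace (vsub (vsub (f a) (f a)) (vscale (a - a) c)) with (0, 0) by vec_ring.
       unfold vnorm, dot; simpl. replace (0 * 0 + 0 * 0) with 0 by ring. rewrite sqrt_0. lra. }
  set (e := vsub (vsub (f b) (f a)) (vscale (b - a) c)).
  destruct (MVT_cor2 (fun s => dot (f s) e) (fun s => dot (f' s) e) a b Hab) as (x & Hx & Hxab).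
  { intros t Ht. apply derivable_pt_lim_dot_const; auto. }
  assert (He : dot e e = (b - a) * dot (vsub (f' x) c) e).
  { replace (dot e e) with (dot (f b) e - dot (f a) e - (b - a) * dot c e)
      by (unfold e at 4; unfold dot, vsub, vscale; simpl; ring).
    rewrite Hx. unfold dot, vsub; simpl. ring. }
  assert (Hcs := cauchy_schwarz (vsub (f' x) c) e).
  assert (Hle := Rle_abs (dot (vsub (f' x) c) e)).
  specialize (Hw x ltac:(lra)).
  assert (Hn := vnorm_nonneg e). assert (Hsq := vnorm_sq e).
  destruct Hn as [Hn | Hn].
  - apply Rmult_le_reg_r with (vnorm e); auto. rewrite Hsq, He.
    replace (w * (b - a) * vnorm e) with ((b - a) * (w * vnorm e)) by ring.
    apply Rmult_le_compat_l; [lra |].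
    assert (vnorm (vsub (f' x) c) * vnorm e <= w * vnorm e) by (apply Rmult_le_compat_r; lra).
    lra.
  - rewrite <- Hn. assert (0 <= w) by (generalize (vnorm_nonneg (vsub (f' x) c)); lra).
    apply Rmult_le_pos; lra.
Qed.

Lemma derivative_at_min (f : R -> R) a b t l : a < t < b ->
  derivable_pt_lim f t l -> (forall s, a < s < b -> f t <= f s) -> l = 0.
Proof.
  intros Ht Hd Hmin.
  assert (pr : derivable_pt f t) by (exists l; exact Hd).
  rewrite <- (proj2 (derive_pt_eq f t l pr) Hd).
  apply deriv_minimum with a b; try tauto. intros s H1 H2. auto.
Qed.

(** A negative [l] would make [f'], which vanishes at [t], negative just to the right, so [f] would
    drop below [f t]. *)
Lemma second_derivative_at_min (f f' : R -> R) a b t l : a < t < b ->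
  (forall s, a < s < b -> derivable_pt_lim f s (f' s)) -> derivable_pt_lim f' t l ->
  (forall s, a < s < b -> f t <= f s) -> 0 <= l.
Proof.
  intros Ht Hd Hd2 Hmin. apply Rnot_lt_le. intros Hl.
  assert (H0 : f' t = 0) by (apply (derivative_at_min f a b t); auto).
  destruct (Hd2 (- l / 2) ltac:(lra)) as [d Hdelta].
  assert (Hdp := cond_pos d).
  destruct (common_scale (d / 2) ((b - t) / 2)) as (h & Hh3 & Hh1 & Hh2); [lra | lra |].
  destruct (MVT_cor2 f f' t (t + h) ltac:(lra)) as (x & Hx & Hxab).
  { intros s Hs. apply Hd. lra. }
  specialize (Hmin (t + h) ltac:(lra)).
  assert (Hx0 := Hdelta (x - t) ltac:(lra) ltac:(rewrite Rabs_pos_eq; lra)).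
  replace (t + (x - t)) with x in Hx0 by ring. rewrite H0 in Hx0.
  apply Rabs_lt_between' in Hx0.
  assert (Hneg : f' x < 0).
  { destruct Hx0 as [_ Hx0]. apply Rlt_div_l in Hx0; [| lra]. nra. }
  assert (f' x * (t + h - t) < 0) by nra. lra.
Qed.

Lemma increasing_near (f : R -> R) t l : derivable_pt_lim f t l -> 0 < l ->
  exists d, 0 < d /\ forall s, 0 < s < d -> f t < f (t + s) /\ f (t - s) < f t.
Proof.
  intros Hd Hl. destruct (Hd l Hl) as [d Hdelta]. exists d. split; [apply cond_pos |].
  intros s Hs. split.
  - assert (H := Hdelta s ltac:(lra) ltac:(rewrite Rabs_pos_eq; lra)).
    apply Rabs_lt_between' in H. destruct H as [H _]. rewrite Rminus_diag in H.
    apply Rlt_div_r in H; [| lra]. lra.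
  - assert (H := Hdelta (- s) ltac:(lra) ltac:(rewrite Rabs_Ropp, Rabs_pos_eq; lra)).
    apply Rabs_lt_between' in H. destruct H as [H _]. rewrite Rminus_diag in H.
    apply Rmult_lt_compat_r with (r := s) in H; [| lra].
    replace ((f (t + - s) - f t) / - s * s) with (f t - f (t - s)) in H
      by (replace (t + - s) with (t - s) by ring; field; lra). lra.
Qed.

Lemma derivable_pt_lim_affine a e x : derivable_pt_lim (fun s => a + e * s) x e.
Proof.
  apply is_derive_Reals. auto_derive; auto. ring.
Qed.

(** * Finite sums, positivity of integrals and triangular sectors *)

Lemma psum_ext f h n : (forall i, (i < n)%nat -> f i = h i) -> psum f n = psum h n.
Proof.
  induction n as [|n IH]; intros H; simpl; auto. rewrite IH, H by auto. auto.
Qed.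

Lemma psum_le f h n : (forall i, (i < n)%nat -> f i <= h i) -> psum f n <= psum h n.
Proof.
  induction n as [|n IH]; intros H; simpl; [lra |].
  apply Rplus_le_compat; auto.
Qed.

Lemma psum_scal c f n : psum (fun i => c * f i) n = c * psum f n.
Proof. induction n as [|n IH]; simpl; [ring | rewrite IH; ring]. Qed.

Lemma psum_minus f h n : psum (fun i => f i - h i) n = psum f n - psum h n.
Proof. induction n as [|n IH]; simpl; [ring | rewrite IH; ring]. Qed.

Lemma psum_nonneg f n : (forall i, (i < n)%nat -> 0 <= f i) -> 0 <= psum f n.
Proof.
  induction n as [|n IH]; intros H; simpl; [lra |].
  assert (0 <= psum f n) by auto. assert (0 <= f n) by auto. lra.
Qed.

Lemma psum_nonneg_eq0 f n : (forall i, (i < n)%nat -> 0 <= f i) -> psum f n <= 0 ->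
  forall i, (i < n)%nat -> f i = 0.
Proof.
  induction n as [|n IH]; intros H H0 i Hi; [lia |]. simpl in H0.
  assert (H1 := psum_nonneg f n ltac:(auto)). assert (H2 := H n ltac:(lia)).
  destruct (Nat.eq_dec i n) as [-> | Hne]; [lra |]. apply IH; auto; [lra | lia].
Qed.

Lemma psum_const c n : psum (fun _ => c) n = INR n * c.
Proof.
  induction n as [|n IH]; [simpl; ring |].
  change (psum (fun _ => c) (S n)) with (psum (fun _ => c) n + c). rewrite IH, S_INR. ring.
Qed.

Lemma psum_cyclic f n : (0 < n)%nat ->
  psum (fun k => f ((k + 1) mod n)%nat - f k) n = 0.
Proof.
  intros Hn. destruct n as [|n]; [lia |].
  change (psum (fun k => f ((k + 1) mod S n)%nat - f k) n + (f ((n + 1) mod S n)%nat - f n) = 0).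
  replace (n + 1)%nat with (S n) by lia. rewrite Nat.Div0.mod_same.
  assert (H : forall k, (k <= n)%nat ->
    psum (fun k => f ((k + 1) mod S n)%nat - f k) k = f k - f 0%nat).
  { induction k as [|k IH]; intros Hk.
    - change (0 = f 0%nat - f 0%nat). ring.
    - change (psum (fun k => f ((k + 1) mod S n)%nat - f k) k + (f ((k + 1) mod S n)%nat - f k)
        = f (S k) - f 0%nat).
      rewrite IH, (Nat.mod_small (k + 1)) by lia. replace (k + 1)%nat with (S k) by lia. ring. }
  rewrite H by lia. ring.
Qed.

Lemma RInt_nonneg_eq0 (f : R -> R) a b t : a < t < b ->
  (forall s, a <= s <= b -> continuity_pt f s) -> (forall s, a < s < b -> 0 <= f s) ->
  RInt f a b <= 0 -> f t = 0.
Proof.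
  intros Ht Hc Hf H0. destruct (Hf t Ht) as [Hpos |]; auto. exfalso.
  destruct (continuity_pt_eps f t (Hc t ltac:(lra)) (f t) Hpos) as (d & Hd & Hs).
  destruct (common_scale (d / 2) ((b - t) / 2)) as (e & H3 & H1 & H2); [lra | lra |].
  assert (I1 : 0 <= RInt f a t).
  { apply RInt_ge_0; [lra | apply ex_RInt_cont; [lra |]; intros; apply Hc; lra |].
    intros; apply Hf; lra. }
  assert (I2 : 0 < RInt f t (t + e)).
  { apply RInt_gt_0; [lra | |].
    - intros x Hx. specialize (Hs x ltac:(rewrite Rabs_pos_eq; lra)).
      apply Rabs_lt_between' in Hs. lra.
    - intros x Hx. apply continuity_pt_continuous, Hc. lra. }
  assert (I3 : 0 <= RInt f (t + e) b).
  { apply RInt_ge_0; [lra | apply ex_RInt_cont; [lra |]; intros; apply Hc; lra |].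
    intros; apply Hf; lra. }
  rewrite <- (RInt_Chasles (V := R_CompleteNormedModule) f a t b) in H0.
  2,3: apply ex_RInt_cont; [lra |]; intros; apply Hc; lra.
  rewrite <- (RInt_Chasles (V := R_CompleteNormedModule) f t (t + e) b) in H0.
  2,3: apply ex_RInt_cont; [lra |]; intros; apply Hc; lra.
  unfold plus in H0; simpl in H0. lra.
Qed.

(* The triangle [0, a, b] contracted towards its barycentre, so that the sectors
   of a subdivision become disjoint and stay away from the curve. *)
Definition shrunk_sector (eta : R) (a b : R2) : R2 -> Prop :=
  let c := vscale (eta / 3) (vadd a b) in
  triangle c (vadd (vscale (1 - eta) a) c) (vadd (vscale (1 - eta) b) c).

Lemma shrunk_sector_area eta a b : 0 < eta <= 1 / 2 ->
  area_ge (shrunk_sector eta a b) ((1 - 2 * eta) * Rabs (det a b) / 2).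
Proof.
  intros He. unfold shrunk_sector.
  eapply area_ge_mono; [intros x Hx; exact Hx | | apply (proj2 (triangle_area _ _ _))].
  set (c := vscale (eta / 3) (vadd a b)).
  replace (det (vsub (vadd (vscale (1 - eta) a) c) c) (vsub (vadd (vscale (1 - eta) b) c) c))
    with ((1 - eta) * (1 - eta) * det a b) by vec_ring.
  rewrite Rabs_mult, (Rabs_pos_eq ((1 - eta) * (1 - eta))) by nra.
  assert (H := Rabs_pos (det a b)). assert (0 <= eta * eta * Rabs (det a b)) by nra. lra.
Qed.

Lemma shrunk_sector_coordinates eta a b x : 0 < eta <= 1 / 2 -> shrunk_sector eta a b x ->
  exists al be, eta / 3 <= al /\ eta / 3 <= be /\ al + be <= 1 - eta / 3 /\
    x = vadd (vscale al a) (vscale be b).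
Proof.
  intros He (u & v & w & Hu & Hv & Hw & Hs & Hx & Hy).
  exists (eta / 3 + (1 - eta) * v), (eta / 3 + (1 - eta) * w).
  assert (0 <= (1 - eta) * v) by (apply Rmult_le_pos; lra).
  assert (0 <= (1 - eta) * w) by (apply Rmult_le_pos; lra).
  assert (0 <= (1 - eta) * u) by (apply Rmult_le_pos; lra).
  repeat split; try lra.
  - assert ((1 - eta) * (u + v + w) = 1 - eta) by (rewrite Hs; ring). lra.
  - rewrite (surjective_pairing x), Hx, Hy. unfold vadd, vscale; simpl.
    replace u with (1 - v - w) by lra. f_equal; ring.
Qed.

(** [det (f u) x] changes sign between [s] and [t], so some [f u] is collinear with [x]. A chord
    triangle may stick out of the curve; the shrinking absorbs this: [f] moves by at most
    [eta * rho / 12] on the piece, so [x] is [al + be] times [f u] up to a relative error [eta / 6],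
    while [al + be <= 1 - eta / 3]. *)
Lemma shrunk_sector_on_ray (f : R -> R2) o s t e eta rho x :
  s < t -> (forall u, vcont f u) -> 0 < eta <= 1 / 2 -> 0 < rho ->
  (forall u, s <= u <= t -> vnorm (vsub (f u) (f s)) <= e) ->
  (forall u, s <= u <= t -> rho <= vnorm (f u)) -> 12 * e <= eta * rho ->
  0 < o * det (f s) (f t) -> shrunk_sector eta (f s) (f t) x ->
  exists u c, s < u < t /\ eta / 3 <= c <= 1 - eta / 6 /\ x = vscale c (f u).
Proof.
  intros Hst Hc He Hrho Hmod Hlow Hsmall Hdet Hx.
  destruct (shrunk_sector_coordinates eta _ _ x He Hx) as (al & be & Hal & Hbe & Hsum & Ex).
  set (a := f s) in *. set (b := f t) in *.
  assert (Hcd : continuity (fun u => o * det (f u) x)).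
  { intros u. apply continuity_pt_mult; [apply continuity_pt_cst |].
    apply continuity_pt_det; [apply Hc | apply vcont_const]. }
  assert (Es : o * det (f s) x = be * (o * det a b)).
  { fold a. rewrite Ex. unfold det, vadd, vscale; simpl. ring. }
  assert (Et : o * det (f t) x = - (al * (o * det a b))).
  { fold b. rewrite Ex. unfold det, vadd, vscale; simpl. ring. }
  assert (Hs0 : 0 < o * det (f s) x) by (rewrite Es; apply Rmult_lt_0_compat; lra).
  assert (Ht0 : o * det (f t) x < 0).
  { rewrite Et. assert (0 < al * (o * det a b)) by (apply Rmult_lt_0_compat; lra). lra. }
  destruct (IVT_cor _ s t Hcd ltac:(lra)) as (u & Hu & Hu0); [nra |].
  assert (Hus : s < u < t).
  { split; apply Rnot_le_lt; intros Hle.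
    - replace u with s in Hu0 by lra. lra.
    - replace u with t in Hu0 by lra. lra. }
  assert (Ho : o <> 0) by (intros E; rewrite E in Hdet; lra).
  assert (Hd0 : det (f u) x = 0) by (apply Rmult_integral in Hu0; tauto).
  set (z := f u) in *.
  assert (Hzr := Hlow u ltac:(lra)). fold z in Hzr.
  assert (Hzz : 0 < dot z z) by (rewrite <- vnorm_sq; nra).
  set (k := al + be) in *. assert (Hk : 0 < k) by (unfold k; lra).
  assert (Hdiff : vnorm (vsub x (vscale k z)) <= k * (2 * e)).
  { replace (vsub x (vscale k z)) with
      (vadd (vscale k (vsub a z)) (vscale be (vsub b a)))
      by (rewrite Ex; unfold k, vsub, vadd, vscale; simpl; f_equal; ring).
    eapply Rle_trans; [apply vnorm_vadd_le |]. rewrite !vnorm_vscale.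
    rewrite !Rabs_pos_eq by lra.
    assert (H1 := Hmod u ltac:(lra)). fold z in H1. rewrite vnorm_vsub_sym in H1.
    assert (H2 := Hmod t ltac:(lra)). fold b in H2.
    assert (k * vnorm (vsub a z) <= k * e) by (apply Rmult_le_compat_l; lra).
    assert (be * vnorm (vsub b a) <= be * e) by (apply Rmult_le_compat_l; lra).
    assert (He0 : 0 <= e) by (generalize (vnorm_nonneg (vsub a z)); lra).
    assert (be * e <= k * e) by (apply Rmult_le_compat_r; unfold k; lra). lra. }
  set (c := dot x z / dot z z).
  assert (Exc : x = vscale c z).
  { rewrite (surjective_pairing x) at 1. unfold c, vscale.
    f_equal; apply Rmult_eq_reg_r with (dot z z); try lra; apply Rminus_diag_uniq.
    - transitivity (- snd z * det z x); [| rewrite Hd0; ring].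
      unfold det, dot in *. field. lra.
    - transitivity (fst z * det z x); [| rewrite Hd0; ring].
      unfold det, dot in *. field. lra. }
  exists u, c. split; auto. split; auto.
  assert (Hck : Rabs (c - k) * rho <= k * (2 * e)).
  { apply Rle_trans with (2 := Hdiff).
    replace (vsub x (vscale k z)) with (vscale (c - k) z)
      by (rewrite Exc at 1; unfold vsub, vscale; simpl; f_equal; ring).
    rewrite vnorm_vscale. apply Rmult_le_compat_l; auto using Rabs_pos. }
  assert (Hck2 : Rabs (c - k) <= k * (eta / 6)).
  { apply Rmult_le_reg_r with rho; auto. apply Rle_trans with (1 := Hck).
    replace (k * (eta / 6) * rho) with (k * (eta * rho / 6)) by field.
    apply Rmult_le_compat_l; lra. }
  apply Rabs_le_between' in Hck2. unfold k in *. split; nra.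
Qed.

Lemma positive_min (f : R -> R) a b : a <= b -> (forall t, a <= t <= b -> continuity_pt f t) ->
  (forall t, a <= t <= b -> 0 < f t) -> exists c, 0 < c /\ forall t, a <= t <= b -> c <= f t.
Proof.
  intros Hab Hc Hp. destruct (continuity_ab_min f a b Hab Hc) as (x & Hx & Hxab).
  exists (f x). auto.
Qed.

Lemma upper_bound_exists (f : R -> R) a b : a <= b ->
  (forall t, a <= t <= b -> continuity_pt f t) ->
  exists c, 0 < c /\ forall t, a <= t <= b -> f t <= c.
Proof.
  intros Hab Hc. destruct (continuity_ab_maj f a b Hab Hc) as (x & Hx & Hxab).
  exists (Rmax 1 (f x)). assert (H1 := Rmax_l 1 (f x)). assert (H2 := Rmax_r 1 (f x)).
  split; [lra |]. intros t Ht. specialize (Hx t Ht). lra.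
Qed.

Lemma RInt_shrink (f : R -> R) e : 0 < e -> (forall t, 0 <= t <= 1 -> continuity_pt f t) ->
  exists d, 0 < d < 1 / 2 /\ RInt f 0 1 - e <= RInt f d (1 - d).
Proof.
  intros He Hc. destruct (upper_bound_exists f 0 1 ltac:(lra) Hc) as (C & HC & Hf).
  destruct (common_scale (1 / 4) (e / (2 * C))) as (d & H3 & H1 & H2); [lra | apply Rdiv_lt_0_compat; lra |].
  apply Rle_div_r in H2; [| lra].
  assert (Hex : forall a b, 0 <= a <= b -> b <= 1 -> ex_RInt f a b).
  { intros a b Ha Hb. apply ex_RInt_cont; [lra |]. intros; apply Hc; lra. }
  assert (Hup : forall a b, 0 <= a <= b -> b <= 1 -> RInt f a b <= C * (b - a)).
  { intros a b Ha Hb. rewrite Rmult_comm.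
    replace ((b - a) * C) with (RInt (fun _ => C) a b)
      by (rewrite RInt_const; reflexivity).
    apply RInt_le; [lra | auto | apply ex_RInt_const | intros; apply Hf; lra]. }
  exists d. split; [lra |].
  rewrite <- (RInt_Chasles (V := R_CompleteNormedModule) f 0 d 1) by (apply Hex; lra).
  rewrite <- (RInt_Chasles (V := R_CompleteNormedModule) f d (1 - d) 1) by (apply Hex; lra).
  unfold plus; simpl.
  assert (U1 := Hup 0 d ltac:(lra) ltac:(lra)).
  assert (U2 := Hup (1 - d) 1 ltac:(lra) ltac:(lra)). lra.
Qed.

(** A Lebesgue number for the compact image of the rectangle [[a, b] x [c0, c1]]. *)
Lemma compact_image_margin (Om : R2 -> Prop) (f : R -> R2) a b c0 c1 : open2 Om ->
  (forall t, vcont f t) ->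
  (forall t c, a <= t <= b -> c0 <= c <= c1 -> Om (vscale c (f t))) ->
  exists eta, 0 < eta /\ forall t c z, a <= t <= b -> c0 <= c <= c1 ->
    vnorm (vsub z (vscale c (f t))) < eta -> Om z.
Proof.
  intros Ho Hf Hin.
  assert (Hloc : forall t c, exists d : posreal, a <= t <= b -> c0 <= c <= c1 ->
    forall t' c' z, Rabs (t' - t) < d -> Rabs (c' - c) < d ->
      vnorm (vsub z (vscale c' (f t'))) < d -> Om z).
  { intros t c. destruct (classic (a <= t <= b /\ c0 <= c <= c1)) as [[Ht Hc] | Hn].
    2: { exists (mkposreal 1 Rlt_0_1). tauto. }
    destruct (Ho _ (Hin t c Ht Hc)) as (e & He & Hball).
    set (K := vnorm (f t)). assert (HK : 0 <= K) by apply vnorm_nonneg.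
    set (Cc := Rabs c). assert (HCc : 0 <= Cc) by apply Rabs_pos.
    assert (He1 : 0 < e / (4 * (Cc + 1))) by (apply Rdiv_lt_0_compat; lra).
    destruct (vcont_eps _ _ (Hf t) (e / (4 * (Cc + 1))) He1) as (d1 & Hd1 & H1).
    assert (He2 : 0 < e / (4 * (K + e / (4 * (Cc + 1)) + 1))) by (apply Rdiv_lt_0_compat; lra).
    set (q := e / (4 * (Cc + 1))) in *.
    set (d2 := e / (4 * (K + q + 1))) in *.
    assert (HD : 0 < Rmin d1 (Rmin d2 (e / 4))) by (repeat apply Rmin_glb_lt; lra).
    exists (mkposreal _ HD). intros _ _ t' c' z Ht' Hc' Hz. simpl in Ht', Hc', Hz.
    assert (M1 := Rmin_l d1 (Rmin d2 (e / 4))). assert (M2 := Rmin_r d1 (Rmin d2 (e / 4))).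
    assert (M3 := Rmin_l d2 (e / 4)). assert (M4 := Rmin_r d2 (e / 4)).
    apply Hball. specialize (H1 t' ltac:(lra)).
    assert (T1 := vnorm_triangle z (vscale c' (f t')) (vscale c (f t))).
    assert (T2 : vnorm (vsub (vscale c' (f t')) (vscale c (f t))) <= e / 4 + e / 4).
    { replace (vsub (vscale c' (f t')) (vscale c (f t))) with
        (vadd (vscale (c' - c) (f t')) (vscale c (vsub (f t') (f t)))) by vec_ring.
      eapply Rle_trans; [apply vnorm_vadd_le |]. rewrite !vnorm_vscale. fold Cc.
      assert (T3 : vnorm (f t') <= K + q).
      { replace (f t') with (vadd (f t) (vsub (f t') (f t)))
          by (unfold vadd, vsub; rewrite (surjective_pairing (f t')); simpl; f_equal; ring).
        eapply Rle_trans; [apply vnorm_vadd_le |]. fold K. lra. }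
      assert (N0 := vnorm_nonneg (f t')). assert (N1 := Rabs_pos (c' - c)).
      assert (N2 := vnorm_nonneg (vsub (f t') (f t))).
      apply Rplus_le_compat.
      - apply Rle_trans with (d2 * (K + q + 1)); [apply Rmult_le_compat; lra |].
        right. unfold d2. field. lra.
      - apply Rle_trans with ((Cc + 1) * q); [apply Rmult_le_compat; lra |].
        right. unfold q. field. lra. }
    lra. }
  (* The gauge on the rectangle must be a function of [t] and [c] with values in [posreal]; it is
     extracted by choice, one variable at a time. *)
  assert (Hch : forall t, exists h : R -> posreal, forall c, a <= t <= b -> c0 <= c <= c1 ->
    forall t' c' z, Rabs (t' - t) < h c -> Rabs (c' - c) < h c ->
      vnorm (vsub z (vscale c' (f t'))) < h c -> Om z).
  { intros t. exists (fun c => proj1_sig (constructive_indefinite_description _ (Hloc t c))).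
    intros c. exact (proj2_sig (constructive_indefinite_description _ (Hloc t c))). }
  set (delta := fun t => proj1_sig (constructive_indefinite_description _ (Hch t))).
  assert (Hdelta : forall t c, a <= t <= b -> c0 <= c <= c1 ->
    forall t' c' z, Rabs (t' - t) < delta t c -> Rabs (c' - c) < delta t c ->
      vnorm (vsub z (vscale c' (f t'))) < delta t c -> Om z).
  { intros t. exact (proj2_sig (constructive_indefinite_description _ (Hch t))). }
  destruct (compactness_value_2d a b c0 c1 delta) as [d Hd].
  exists d. split; [apply cond_pos |]. intros t c z Ht Hc Hz.
  destruct (NNPP _ (Hd t c Ht Hc)) as (u & v & Hu & Hv & H1 & H2 & H3).
  apply (Hdelta u v Hu Hv t c z); auto. lra.
Qed.

Lemma mesh_exists L d : 0 < d -> exists M, (0 < M)%nat /\ L / INR M <= d.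
Proof.
  intros Hd. destruct (INR_unbounded (Rabs L / d)) as [M HM].
  assert (H0 : 0 <= Rabs L / d) by (apply Rdiv_le_0_compat; auto; apply Rabs_pos).
  assert (HM0 : 0 < INR M) by lra.
  exists M. split; [apply INR_lt; auto |].
  apply Rmult_le_reg_r with (INR M); auto.
  replace (L / INR M * INR M) with L by (field; lra).
  apply Rlt_div_l in HM; [| lra].
  assert (H := Rle_abs L). lra.
Qed.

Lemma det_bound a b : Rabs (det a b) <= vnorm a * vnorm b.
Proof.
  rewrite <- dot_rot. replace (vnorm b) with (vnorm (rot b)); [apply cauchy_schwarz |].
  unfold vnorm. f_equal. unfold dot, rot; simpl. ring.
Qed.

Lemma psum_pos f n : (0 < n)%nat -> (forall i, (i < n)%nat -> 0 < f i) -> 0 < psum f n.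
Proof.
  intros Hn H. destruct n as [|n]; [lia |]. simpl.
  assert (0 <= psum f n) by (apply psum_nonneg; intros i Hi; left; auto).
  assert (0 < f n) by auto. lra.
Qed.

Lemma derivable_pt_lim_linear e x : derivable_pt_lim (fun s => e * s) x e.
Proof.
  apply is_derive_Reals. auto_derive; auto. ring.
Qed.

Definition frame_point (o e1 e2 : R2) (u w : R) : R2 := vadd o (vadd (vscale u e1) (vscale w e2)).

(** The diagonal from [P1] to [P3] cuts the trapezoid into two triangles, either of which may be
    degenerate. *)
Lemma trapezoid_area (o e1 e2 : R2) A B l p q : A < B -> Rabs (det e1 e2) = 1 ->
  l <= p + q * A -> l <= p + q * B ->
  area_le (fun x => exists u w, A <= u <= B /\ l <= w <= p + q * u /\ x = frame_point o e1 e2 u w)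
    ((B - A) * ((p + q * A - l) + (p + q * B - l)) / 2).
Proof.
  intros HAB Hdet HA HB.
  set (P1 := frame_point o e1 e2 A l). set (P2 := frame_point o e1 e2 B l).
  set (P3 := frame_point o e1 e2 B (p + q * B)). set (P4 := frame_point o e1 e2 A (p + q * A)).
  assert (T1 := proj1 (triangle_area P1 P2 P3)). assert (T2 := proj1 (triangle_area P1 P3 P4)).
  replace (det (vsub P2 P1) (vsub P3 P1)) with ((B - A) * (p + q * B - l) * det e1 e2) in T1
    by (unfold P1, P2, P3, frame_point, det, vsub, vadd, vscale; simpl; ring).
  replace (det (vsub P3 P1) (vsub P4 P1)) with ((B - A) * (p + q * A - l) * det e1 e2) in T2
    by (unfold P1, P4, P3, frame_point, det, vsub, vadd, vscale; simpl; ring).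
  rewrite Rabs_mult, Hdet, Rabs_pos_eq in T1 by (apply Rmult_le_pos; lra).
  rewrite Rabs_mult, Hdet, Rabs_pos_eq in T2 by (apply Rmult_le_pos; lra).
  eapply area_le_mono; [| | apply (area_le_union _ _ _ _ T1 T2)]; [| right; field].
  intros x (u & w & Hu & Hw & Ex).
  set (la := (u - A) / (B - A)).
  assert (Hla : 0 <= la <= 1).
  { unfold la. split; [apply Rdiv_le_0_compat; lra |].
    apply Rmult_le_reg_r with (B - A); [lra |].
    replace ((u - A) / (B - A) * (B - A)) with (u - A) by (field; lra). lra. }
  assert (Eu : u = A + la * (B - A)) by (unfold la; field; lra).
  set (HhA := p + q * A - l). set (HhB := p + q * B - l).
  assert (H0A : 0 <= HhA) by (unfold HhA; lra). assert (H0B : 0 <= HhB) by (unfold HhB; lra).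
  assert (Hy : 0 <= w - l <= (1 - la) * HhA + la * HhB).
  { split; [lra |]. unfold HhA, HhB.
    replace ((1 - la) * (p + q * A - l) + la * (p + q * B - l)) with
      (p + q * (A + la * (B - A)) - l) by ring. rewrite <- Eu. lra. }
  destruct (Rle_dec (w - l) (la * HhB)) as [Hle | Hgt].
  - left. assert (Hga : exists ga, 0 <= ga <= la /\ w - l = ga * HhB).
    { destruct H0B as [Hp | Hz].
      - exists ((w - l) / HhB). split; [| field; lra].
        split; [apply Rdiv_le_0_compat; lra |]. apply Rmult_le_reg_r with HhB; auto.
        replace ((w - l) / HhB * HhB) with (w - l) by (field; lra). lra.
      - exists 0. rewrite <- Hz in *. lra. }
    destruct Hga as (ga & Hga & Ew). exists (1 - la), (la - ga), ga.
    repeat split; try lra; rewrite Ex; unfold P1, P2, P3, frame_point, vadd, vscale; simpl;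
      replace w with (l + ga * HhB) by lra; unfold HhB; rewrite Eu; ring.
  - right. assert (HA1 : 0 < HhA).
    { destruct H0A as [|Hz]; auto. rewrite <- Hz in Hy. lra. }
    set (ga := (w - l - la * HhB) / HhA).
    assert (Ega : w - l = la * HhB + ga * HhA) by (unfold ga; field; lra).
    assert (Hga : 0 <= ga <= 1 - la).
    { split; [apply Rdiv_le_0_compat; lra |]. apply Rmult_le_reg_r with HhA; auto. lra. }
    exists (1 - la - ga), la, ga.
    repeat split; try lra; rewrite Ex; unfold P1, P4, P3, frame_point, vadd, vscale; simpl;
      replace w with (l + (la * HhB + ga * HhA)) by lra; unfold HhB, HhA; rewrite Eu; ring.
Qed.

Lemma segment_area (a b : R2) :
  area_le (fun x => exists s, 0 <= s <= 1 /\ x = seg a b s) 0.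
Proof.
  assert (T := proj1 (triangle_area a b b)).
  replace (det (vsub b a) (vsub b a)) with 0 in T by vec_ring.
  rewrite Rabs_R0 in T. eapply area_le_mono; [| | exact T]; [| lra].
  intros x (s & Hs & Ex). exists (1 - s), s, 0.
  repeat split; try lra; rewrite Ex; vec_ring.
Qed.

Lemma finite_upper_bound (f : nat -> R -> R) n :
  (forall k t, (k < n)%nat -> 0 <= t <= 1 -> continuity_pt (f k) t) ->
  exists C, 0 < C /\ forall k t, (k < n)%nat -> 0 <= t <= 1 -> f k t <= C.
Proof.
  induction n as [|n IH]; intros H.
  - exists 1. split; [lra |]. intros; lia.
  - destruct IH as (C1 & HC1 & H1); [auto |].
    destruct (upper_bound_exists (f n) 0 1 ltac:(lra) ltac:(auto)) as (C2 & HC2 & H2).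
    exists (Rmax C1 C2). assert (M1 := Rmax_l C1 C2). assert (M2 := Rmax_r C1 C2).
    split; [lra |]. intros k t Hk Ht. destruct (Nat.eq_dec k n) as [-> | Hne].
    + specialize (H2 t Ht). lra.
    + specialize (H1 k t ltac:(lia) Ht). lra.
Qed.

Lemma mesh_cell M s : (0 < M)%nat -> 0 <= s <= 1 ->
  exists i, (i < M)%nat /\ INR i * (1 / INR M) <= s <= INR (S i) * (1 / INR M).
Proof.
  intros HM Hs. assert (HM0 : 0 < INR M) by (apply lt_0_INR; auto).
  assert (H : forall n, (0 < n <= M)%nat -> s <= INR n * (1 / INR M) ->
    exists i, (i < n)%nat /\ INR i * (1 / INR M) <= s <= INR (S i) * (1 / INR M)).
  { induction n as [|n IH]; intros Hn Hsn; [lia |].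
    destruct (Rle_dec (INR n * (1 / INR M)) s) as [Hle | Hgt].
    - exists n. split; [lia | lra].
    - destruct (Nat.eq_dec n 0) as [-> | Hne]; [simpl in Hgt; lra |].
      destruct (IH ltac:(lia) ltac:(lra)) as (i & Hi & Hrest). exists i. split; [lia | auto]. }
  apply H; [lia |]. replace (INR M * (1 / INR M)) with 1 by (field; lra). lra.
Qed.

Lemma orthonormal_decomposition o (tau E : R2) : o * o = 1 -> dot tau tau = 1 ->
  E = vadd (vscale (dot E (vscale o (rot tau))) (vscale o (rot tau))) (vscale (dot E tau) tau).
Proof.
  intros Ho Htau. rewrite (surjective_pairing E) at 1.
  unfold dot in Htau. unfold vadd, vscale, rot, dot; simpl. f_equal.
  - transitivity (fst E * ((o * o) * (snd tau * snd tau) + fst tau * fst tau) +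
      snd E * (fst tau * snd tau * (1 - o * o))); [rewrite Ho | ring].
    replace (1 * (snd tau * snd tau) + fst tau * fst tau) with 1 by lra. ring.
  - transitivity (snd E * ((o * o) * (fst tau * fst tau) + snd tau * snd tau) +
      fst E * (fst tau * snd tau * (1 - o * o))); [rewrite Ho | ring].
    replace (1 * (fst tau * fst tau) + snd tau * snd tau) with 1 by lra. ring.
Qed.

(** * The boundary arcs and their normals *)

Lemma rot_decomposition n v : v <> (0, 0) -> dot n n = 1 -> dot n v = 0 ->
  exists c, n = vscale c (rot v) /\ c * c * dot v v = 1.
Proof.
  intros Hv Hn Ho. assert (Hp := dot_self_pos _ Hv).
  exists (dot n (rot v) / dot v v).
  assert (E : n = vscale (dot n (rot v) / dot v v) (rot v)).
  { destruct n as [n1 n2], v as [v1 v2]. unfold dot, rot, vscale in *; simpl in *.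
    f_equal; apply Rmult_eq_reg_r with (v1 * v1 + v2 * v2); try lra; field_simplify; try lra.
    - replace (n1 * v1 ^ 2) with (n1 * v1 * v1) by ring.
      replace (n1 * v1) with (- (n2 * v2)) by lra. ring.
    - replace (n2 * v2 ^ 2) with (n2 * v2 * v2) by ring.
      replace (n2 * v2) with (- (n1 * v1)) by lra. ring. }
  split; auto.
  assert (Hl : dot n (rot v) * dot n (rot v) = dot n n * dot v v - dot n v * dot n v) by vec_ring.
  rewrite Hn, Ho in Hl.
  replace (dot n (rot v) / dot v v * (dot n (rot v) / dot v v) * dot v v) with
    (dot n (rot v) * dot n (rot v) / dot v v) by (field; lra).
  rewrite Hl. field. lra.
Qed.

Section Domain.

Context (Om : R2 -> Prop) (m : nat) (g g1 g2 : nat -> R -> R2) (nu : R2 -> R2) (kappa : R2 -> R).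
Context (HO : open2 Om) (HB : bounded2 Om).
Context (HPC : piecewise_C2_no_concave Om m g g1 g2).
Context (HNU : outward_normal_spec Om m g g1 nu).
Context (HKA : curvature_spec m g g1 g2 nu kappa).
Context (HST : forall y, reg_bd Om m g y -> dot y (nu y) > 0).

Local Notation nx k := ((k + 1) mod m)%nat.

Lemma m_pos : (0 < m)%nat.
Proof. apply HPC. Qed.

Lemma nx_lt k : (nx k < m)%nat.
Proof. apply Nat.mod_upper_bound. generalize m_pos; lia. Qed.

Lemma arc_vder k t : (k < m)%nat -> vder (g k) t (g1 k t).
Proof.
  intros Hk. destruct HPC as (_ & _ & H & _). destruct (H k Hk) as [(H1 & H2 & _) _].
  split; auto.
Qed.

Lemma arc_vder1 k t : (k < m)%nat -> vder (g1 k) t (g2 k t).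
Proof.
  intros Hk. destruct HPC as (_ & _ & H & _). destruct (H k Hk) as [(_ & _ & H1 & H2 & _) _].
  split; auto.
Qed.

Lemma arc_vcont k t : (k < m)%nat -> vcont (g k) t.
Proof. intros Hk. eapply vder_vcont, arc_vder; auto. Qed.

Lemma arc_vcont1 k t : (k < m)%nat -> vcont (g1 k) t.
Proof. intros Hk. eapply vder_vcont, arc_vder1; auto. Qed.

Lemma arc_vcont2 k t : (k < m)%nat -> vcont (g2 k) t.
Proof.
  intros Hk. destruct HPC as (_ & _ & H & _).
  destruct (H k Hk) as [(_ & _ & _ & _ & H1 & H2) _]. split; auto.
Qed.

Lemma arc_regular k t : (k < m)%nat -> 0 <= t <= 1 -> g1 k t <> (0, 0).
Proof.
  intros Hk. destruct HPC as (_ & _ & H & _). destruct (H k Hk) as (_ & H1 & _). apply H1.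
Qed.

Lemma arc_injective k s t : (k < m)%nat -> 0 <= s <= 1 -> 0 <= t <= 1 ->
  g k s = g k t -> s = t.
Proof.
  intros Hk. destruct HPC as (_ & _ & H & _). destruct (H k Hk) as (_ & _ & H1). apply H1.
Qed.

Lemma arc_glue k : (k < m)%nat -> g (nx k) 0 = g k 1.
Proof. intros Hk. destruct HPC as (_ & _ & _ & H & _). auto. Qed.

Lemma arc_boundary k t : (k < m)%nat -> 0 <= t <= 1 -> boundary2 Om (g k t).
Proof.
  intros Hk Ht. destruct HPC as (_ & _ & _ & _ & H & _). apply H.
  exists k. split; auto. exists t; auto.
Qed.

Lemma boundary_arc p : boundary2 Om p -> exists k t, (k < m)%nat /\ 0 <= t <= 1 /\ p = g k t.
Proof.
  intros Hp. destruct HPC as (_ & _ & _ & _ & H & _). apply H in Hp as (k & Hk & t & Ht & E).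
  exists k, t; auto.
Qed.

Lemma adjacent_arcs_meet k s t : (k < m)%nat -> 0 <= s <= 1 -> 0 <= t <= 1 ->
  g k s = g (nx k) t -> g k s = g k 1.
Proof.
  intros Hk Hs Ht E. destruct HPC as (_ & _ & _ & _ & _ & H & _).
  apply (H k Hk (g k s)). split; [exists s | exists t]; auto.
Qed.

Lemma distinct_arcs_meet i j s t : (i < m)%nat -> (j < m)%nat -> i <> j ->
  0 <= s <= 1 -> 0 <= t <= 1 -> g i s = g j t ->
  (nx i = j /\ s = 1) \/ (nx j = i /\ t = 1).
Proof.
  intros Hi Hj Hij Hs Ht E.
  destruct (Nat.eq_dec (nx i) j) as [<- | H1].
  { left. split; auto. apply (arc_injective i); auto; [lra |].
    eapply adjacent_arcs_meet; eauto. }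
  destruct (Nat.eq_dec (nx j) i) as [<- | H2].
  { right. split; auto. apply (arc_injective j); auto; [lra |].
    apply (adjacent_arcs_meet j t s); auto. }
  exfalso. destruct HPC as (_ & _ & _ & _ & _ & _ & H).
  apply (H i j Hi Hj Hij H1 H2 (g i s)). split; [exists s | exists t]; auto.
Qed.

Lemma arc_interior_reg k t : (k < m)%nat -> 0 < t < 1 -> reg_bd Om m g (g k t).
Proof.
  intros Hk Ht. split; [apply arc_boundary; auto; lra |].
  intros (j & Hj & E).
  destruct (Nat.eq_dec k j) as [<- | Hkj].
  { apply arc_injective in E; auto; lra. }
  destruct (distinct_arcs_meet k j t 1) as [[_ H] | [H _]]; auto; try lra.
  rewrite <- (arc_glue j Hj), H in E. apply arc_injective in E; auto; lra.
Qed.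

Lemma nx_surjective k : (k < m)%nat -> exists j, (j < m)%nat /\ nx j = k.
Proof.
  intros Hk. destruct k as [|k].
  - exists (m - 1)%nat. split; [lia |]. replace (m - 1 + 1)%nat with m by lia.
    apply Nat.Div0.mod_same.
  - exists k. split; [lia |]. rewrite Nat.mod_small; lia.
Qed.

(* Orientation of arc k: +1 if it runs counterclockwise around the origin. *)
Definition orient (k : nat) : R := if Rlt_dec 0 (det (g k (1 / 2)) (g1 k (1 / 2))) then 1 else -1.

Definition nrm (k : nat) (t : R) : R2 := unit_normal (orient k) (g1 k) t.
Definition curv (k : nat) (t : R) : R := signed_curvature (orient k) (g1 k) (g2 k) t.
Definition speed (k : nat) (t : R) : R := vnorm (g1 k t).

Lemma orient_sq k : orient k * orient k = 1.
Proof. unfold orient. destruct Rlt_dec; lra. Qed.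

Lemma orient_abs k : Rabs (orient k) = 1.
Proof. unfold orient. destruct Rlt_dec; [apply Rabs_R1 | rewrite Rabs_left; lra]. Qed.

Lemma nu_perp k t : (k < m)%nat -> 0 < t < 1 ->
  exists c, nu (g k t) = vscale c (rot (g1 k t)) /\ c * c * dot (g1 k t) (g1 k t) = 1 /\
    0 < c * det (g k t) (g1 k t).
Proof.
  intros Hk Ht. destruct (HNU k t Hk Ht) as (H1 & H2 & _).
  destruct (rot_decomposition (nu (g k t)) (g1 k t)) as (c & E & Hc); auto.
  - apply arc_regular; auto; lra.
  - rewrite <- vnorm_sq, H1; ring.
  - exists c. repeat split; auto.
    assert (H := HST _ (arc_interior_reg k t Hk Ht)). rewrite E in H.
    replace (dot (g k t) (vscale c (rot (g1 k t)))) with (c * det (g k t) (g1 k t)) in H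
      by vec_ring. lra.
Qed.

(** Starshapedness keeps this determinant away from zero on the open arc, so by the intermediate
    value theorem it keeps the sign it has at the midpoint, which defines [orient]. *)
Lemma orient_det k t : (k < m)%nat -> 0 < t < 1 -> 0 < orient k * det (g k t) (g1 k t).
Proof.
  intros Hk Ht.
  assert (Hne : forall s, 0 < s < 1 -> det (g k s) (g1 k s) <> 0).
  { intros s Hs E. destruct (nu_perp k s Hk Hs) as (c & _ & _ & H). rewrite E in H. lra. }
  assert (Hc : continuity (fun s => det (g k s) (g1 k s))).
  { intros s. apply continuity_pt_det; [apply arc_vcont | apply arc_vcont1]; auto. }
  apply Rnot_le_lt. intros Hle.
  assert (H2 := Hne (1 / 2) ltac:(lra)).
  assert (Hneg : det (g k (1 / 2)) (g1 k (1 / 2)) * det (g k t) (g1 k t) <= 0).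
  { unfold orient in Hle. destruct Rlt_dec; nra. }
  destruct (Rle_dec (1 / 2) t) as [Hl | Hl].
  - destruct (IVT_cor _ (1 / 2) t Hc Hl Hneg) as (z & Hz & E). apply (Hne z); auto. lra.
  - destruct (IVT_cor _ t (1 / 2) Hc ltac:(lra) ltac:(lra)) as (z & Hz & E).
    apply (Hne z); auto. lra.
Qed.

Lemma speed_pos k t : (k < m)%nat -> 0 <= t <= 1 -> 0 < speed k t.
Proof. intros Hk Ht. apply vnorm_pos, arc_regular; auto. Qed.

(** Both vectors are unit normals of the arc with positive product with the position vector, so they
    agree in sign. Unlike [nu], which is unconstrained at corners, [nrm k] extends continuously to
    [[0, 1]]. *)
Lemma nu_nrm k t : (k < m)%nat -> 0 < t < 1 -> nu (g k t) = nrm k t.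
Proof.
  intros Hk Ht. destruct (nu_perp k t Hk Ht) as (c & E & Hc & Hp).
  assert (Ho := orient_det k t Hk Ht). assert (Hs := speed_pos k t Hk ltac:(lra)).
  rewrite E. unfold nrm, unit_normal. fold (speed k t). f_equal.
  rewrite <- vnorm_sq in Hc. fold (speed k t) in Hc. assert (H1 := orient_sq k).
  apply Rmult_eq_reg_r with (speed k t); [| lra].
  replace (orient k / speed k t * speed k t) with (orient k) by (field; lra).
  assert (Hsq : c * speed k t * (c * speed k t) = 1) by (rewrite <- Hc; ring).
  set (D := det (g k t) (g1 k t)) in *. set (q := speed k t) in *.
  assert (Hq : 0 < orient k * (c * q)).
  { apply Rmult_lt_reg_r with (D * D).
    - assert (D <> 0) by (intros E0; rewrite E0 in Ho; lra).
      apply Rsqr_pos_lt; auto.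
    - replace (orient k * (c * q) * (D * D)) with (orient k * D * (c * D) * q) by ring.
      rewrite Rmult_0_l. apply Rmult_lt_0_compat; [apply Rmult_lt_0_compat |]; auto. }
  assert (Hz : (orient k - c * q) * (orient k + c * q) = 0)
    by (replace ((orient k - c * q) * (orient k + c * q)) with
          (orient k * orient k - c * q * (c * q)) by ring; lra).
  apply Rmult_integral in Hz as [Hz | Hz]; [lra |].
  replace (c * q) with (- orient k) in Hq by lra. lra.
Qed.

Lemma kappa_curv k t : (k < m)%nat -> 0 < t < 1 -> kappa (g k t) = curv k t.
Proof. intros Hk Ht. rewrite (HKA k t Hk Ht), (nu_nrm k t Hk Ht). reflexivity. Qed.

Lemma nrm_unit k t : (k < m)%nat -> 0 <= t <= 1 -> dot (nrm k t) (nrm k t) = 1.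
Proof. intros Hk Ht. apply unit_normal_norm; [apply orient_sq | apply arc_regular; auto]. Qed.

Lemma nrm_vcont k t : (k < m)%nat -> 0 <= t <= 1 -> vcont (nrm k) t.
Proof.
  intros Hk Ht. apply vcont_unit_normal; [apply arc_vcont1 | apply arc_regular]; auto.
Qed.

Lemma curv_continuous k t : (k < m)%nat -> 0 <= t <= 1 -> continuity_pt (curv k) t.
Proof.
  intros Hk Ht. apply continuity_pt_signed_curvature;
    [apply arc_vcont1 | apply arc_vcont2 | apply arc_regular]; auto.
Qed.

Lemma nrm_vder k t : (k < m)%nat -> 0 <= t <= 1 -> vder (nrm k) t (vscale (curv k t) (g1 k t)).
Proof.
  intros Hk Ht. apply vder_unit_normal; [apply arc_vder1 | apply arc_regular]; auto.
Qed.

Lemma speed_continuous k t : (k < m)%nat -> continuity_pt (speed k) t.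
Proof. intros Hk. apply continuity_pt_vnorm, arc_vcont1; auto. Qed.

Definition support (k : nat) (t : R) : R := dot (g k t) (nrm k t).

Lemma support_det k t : (k < m)%nat -> 0 <= t <= 1 ->
  support k t * speed k t = orient k * det (g k t) (g1 k t).
Proof.
  intros Hk Ht. assert (Hs := speed_pos k t Hk Ht).
  unfold support, nrm, unit_normal. fold (speed k t).
  unfold dot, vscale, rot, det; simpl. field. lra.
Qed.

Lemma support_pos k t : (k < m)%nat -> 0 < t < 1 -> 0 < support k t.
Proof.
  intros Hk Ht. rewrite <- (Rmult_0_l (speed k t)) .
  assert (Hs := speed_pos k t Hk ltac:(lra)).
  apply Rmult_lt_reg_r with (speed k t); auto. rewrite support_det by (auto; lra).
  rewrite !Rmult_0_l. apply orient_det; auto.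
Qed.

Lemma interior_parameter_near t d : 0 <= t <= 1 -> 0 < d ->
  exists s, 0 < s < 1 /\ Rabs (s - t) < d.
Proof.
  intros Ht Hd. destruct (common_scale (d / 2) (1 / 4)) as (e & H3 & H1 & H2); [lra | lra |].
  destruct (Rle_dec t (1 / 2)).
  - exists (t + e). split; [lra |]. apply Rabs_lt_between'. lra.
  - exists (t - e). split; [lra |]. apply Rabs_lt_between'. lra.
Qed.

(** At the ends of an arc zero is not excluded: there the ray from the origin may be tangent to the
    boundary. *)
Lemma support_nonneg k t : (k < m)%nat -> 0 <= t <= 1 -> 0 <= support k t.
Proof.
  intros Hk Ht. apply Rnot_lt_le. intros Hlt.
  assert (Hc : continuity_pt (support k) t).
  { apply continuity_pt_dot; [apply arc_vcont | apply nrm_vcont]; auto. }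
  destruct (continuity_pt_eps _ _ Hc (- support k t) ltac:(lra)) as (d & Hd & Hs).
  destruct (interior_parameter_near t d Ht Hd) as (s & Hs1 & Hs2).
  specialize (Hs s Hs2). assert (Hp := support_pos k s Hk Hs1).
  apply Rabs_lt_between' in Hs. lra.
Qed.

(** At a corner the hypothesis provides one ball; here a ball is centred on the one-sided normal of
    each of the two arcs meeting there. *)
Definition exterior_ball (r : R) : Prop := forall k t, (k < m)%nat -> 0 <= t <= 1 ->
  forall x, vnorm (vsub x (vadd (g k t) (vscale r (nrm k t)))) < r -> ~ closure2 Om x.

(** At an interior parameter the arc stays outside the given ball while touching its sphere, so the
    centre is on the normal line; the inward segment of [outward_normal_spec] decides the side. The
    ends of the arc follow by continuity. *)
Lemma exterior_ball_exists : exists r, 0 < r /\ exterior_ball r.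
Proof.
  destruct HPC as ((r & Hr & Hext) & _). exists r. split; auto.
  assert (Hint : forall k t, (k < m)%nat -> 0 < t < 1 ->
    forall x, vnorm (vsub x (vadd (g k t) (vscale r (nrm k t)))) < r -> ~ closure2 Om x).
  { intros k t Hk Ht. destruct (Hext (g k t)) as (c & Hc & Hball).
    { apply arc_boundary; auto; lra. }
    assert (Hort : dot (g1 k t) (vsub (g k t) c) = 0).
    { assert (Hd : derivable_pt_lim (fun s => dot (vsub (g k s) c) (vsub (g k s) c)) t
        (dot (vsub (g1 k t) (0,0)) (vsub (g k t) c) + dot (vsub (g k t) c) (vsub (g1 k t) (0,0)))).
      { assert (Hv : vder (fun s => vsub (g k s) c) t (vsub (g1 k t) (0,0))).
        { apply (vder_vsub (g k) (fun _ => c)); [apply arc_vder; auto | apply vder_const]. }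
        apply (derivable_pt_lim_dot (fun s => vsub (g k s) c) (fun s => vsub (g k s) c)); auto. }
      assert (E : dot (vsub (g1 k t) (0, 0)) (vsub (g k t) c) +
        dot (vsub (g k t) c) (vsub (g1 k t) (0, 0)) = 0).
      { apply (derivative_at_min _ 0 1 t _ Ht Hd). intros s Hs. rewrite <- !vnorm_sq, Hc.
        assert (Hge : r <= vnorm (vsub (g k s) c)).
        { apply Rnot_lt_le. intros Hlt. apply (Hball _ Hlt).
          apply arc_boundary; auto; lra. }
        nra. }
      revert E. unfold dot, vsub; simpl. lra. }
    destruct (HNU k t Hk Ht) as (_ & _ & d & Hd & Hin). rewrite (nu_nrm k t Hk Ht) in Hin.
    assert (Hu := nrm_unit k t Hk ltac:(lra)).
    destruct (rot_decomposition (vscale (/ r) (vsub (g k t) c)) (g1 k t)) as (a & Ea & Ha).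
    { apply arc_regular; auto; lra. }
    { replace (dot (vscale (/ r) (vsub (g k t) c)) (vscale (/ r) (vsub (g k t) c))) with
        (/ r * / r * dot (vsub (g k t) c) (vsub (g k t) c)) by vec_ring.
      rewrite <- vnorm_sq, Hc. field. lra. }
    { replace (dot (vscale (/ r) (vsub (g k t) c)) (g1 k t)) with
        (/ r * dot (g1 k t) (vsub (g k t) c)) by vec_ring.
      rewrite Hort. ring. }
    assert (Hs := speed_pos k t Hk ltac:(lra)). assert (Ho := orient_sq k).
    set (q := speed k t) in *.
    assert (Hq : dot (g1 k t) (g1 k t) = q * q) by (symmetry; apply vnorm_sq).
    rewrite Hq in Ha.
    set (b := r * a * q * orient k).
    assert (Ec : vsub (g k t) c = vscale b (nrm k t)).
    { replace (vsub (g k t) c) with (vscale r (vscale (/ r) (vsub (g k t) c)))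
        by (unfold vscale, vsub; simpl; f_equal; field; lra).
      rewrite Ea. unfold nrm, unit_normal, b. fold (speed k t). fold q.
      unfold vscale; simpl. f_equal.
      - replace (r * a * q * orient k * (orient k / q * snd (g1 k t))) with
          (r * a * (orient k * orient k) * snd (g1 k t)) by (field; lra). rewrite Ho; ring.
      - replace (r * a * q * orient k * (orient k / q * - fst (g1 k t))) with
          (r * a * (orient k * orient k) * - fst (g1 k t)) by (field; lra). rewrite Ho; ring. }
    assert (Hb : b = r \/ b = - r).
    { assert (E : (b - r) * (b + r) = 0).
      { unfold b. replace ((r * a * q * orient k - r) * (r * a * q * orient k + r)) with
          (r * r * (a * a * (q * q) * (orient k * orient k) - 1)) by ring.
        rewrite Ha, Ho. ring. }
      apply Rmult_integral in E. lra. }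
    assert (Eg : c = vadd (g k t) (vscale (- b) (nrm k t))).
    { destruct c as [c1 c2]. injection Ec. unfold vadd, vscale; simpl. intros.
      f_equal; lra. }
    destruct Hb as [-> | ->].
    (* Here the centre is on the inner side, and the ball contains points of the inward segment. *)
    - exfalso. destruct (common_scale (d / 2) r) as (s & Hs3 & Hs1 & Hs2); [lra | lra |].
      apply (Hball (vsub (g k t) (vscale s (nrm k t)))).
      + rewrite Eg. replace (vsub (vsub (g k t) (vscale s (nrm k t)))
          (vadd (g k t) (vscale (- r) (nrm k t)))) with (vscale (r - s) (nrm k t)) by vec_ring.
        apply vnorm_lt; auto.
        replace (dot (vscale (r - s) (nrm k t)) (vscale (r - s) (nrm k t))) with
          ((r - s) * (r - s) * dot (nrm k t) (nrm k t)) by vec_ring.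
        rewrite Hu. nra.
      + intros e He. exists (vsub (g k t) (vscale s (nrm k t))). split; [apply Hin; lra |].
        apply vnorm_lt; auto. unfold dot, vsub; simpl. nra.
    - rewrite Ropp_involutive in Eg. rewrite <- Eg. exact Hball. }
  intros k t Hk Ht x Hx.
  set (F := fun s => vsub x (vadd (g k s) (vscale r (nrm k s)))).
  assert (HF : vcont F t).
  { apply vcont_vsub; [apply vcont_const | apply vcont_vadd; [apply arc_vcont; auto |]].
    apply vcont_vscale; [apply continuity_pt_cst | apply nrm_vcont; auto]. }
  destruct (continuity_pt_eps _ _ (continuity_pt_vnorm _ _ HF) (r - vnorm (F t)))
    as (d & Hd & Hs); [unfold F; lra |].
  destruct (interior_parameter_near t d Ht Hd) as (s & Hs1 & Hs2).
  apply (Hint k s Hk Hs1). specialize (Hs s Hs2). apply Rabs_lt_between' in Hs.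
  unfold F in Hs. lra.
Qed.

(** The squared distance to the centre, expanded: near the boundary point a quadratic term competes
    with a linear one. *)
Lemma exterior_ball_point r k t x : 0 < r -> exterior_ball r -> (k < m)%nat -> 0 <= t <= 1 ->
  dot (vsub x (g k t)) (vsub x (g k t)) < 2 * r * dot (vsub x (g k t)) (nrm k t) ->
  ~ closure2 Om x.
Proof.
  intros Hr He Hk Ht H. apply (He k t Hk Ht). apply vnorm_lt; auto.
  assert (Hu := nrm_unit k t Hk Ht).
  replace (dot (vsub x (vadd (g k t) (vscale r (nrm k t)))) (vsub x (vadd (g k t) (vscale r (nrm k t)))))
    with (dot (vsub x (g k t)) (vsub x (g k t)) - 2 * r * dot (vsub x (g k t)) (nrm k t)
          + r * r * dot (nrm k t) (nrm k t)) by vec_ring.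
  rewrite Hu. lra.
Qed.

Lemma subset_closure x : Om x -> closure2 Om x.
Proof.
  intros Hx e He. exists x. split; auto. apply vnorm_lt; auto. unfold dot, vsub; simpl. nra.
Qed.

Definition inner_cone (p n : R2) : Prop :=
  forall v, dot v n < 0 -> exists s0, 0 < s0 /\ forall s, 0 < s < s0 -> Om (vadd p (vscale s v)).

(** The part of C^1 regularity that both cases can provide: at every boundary point the domain
    fills, direction by direction, an open half-plane. A convex corner violates it. *)
Definition smooth_boundary : Prop :=
  forall p, boundary2 Om p -> exists n, vnorm n = 1 /\ inner_cone p n.

(** If [n] differed from [nrm k t], the direction [v = nrm k t - n] would have negative product with
    [n] and positive product with [nrm k t]: it would enter both [Om] and the exterior ball. *)
Lemma smooth_inner_cone k t : smooth_boundary -> (k < m)%nat -> 0 <= t <= 1 ->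
  forall n, vnorm n = 1 -> inner_cone (g k t) n -> n = nrm k t.
Proof.
  intros Hsm Hk Ht n Hn Hcone. destruct exterior_ball_exists as (r & Hr & Hext).
  assert (Hu := nrm_unit k t Hk Ht). assert (Hn2 := vnorm_sq n). rewrite Hn in Hn2.
  set (N := nrm k t) in *. set (v := vsub N n).
  assert (Hvn : dot v n = dot N n - 1) 
    by (replace (dot v n) with (dot N n - dot n n) by (unfold v, dot, vsub; simpl; ring); lra).
  assert (HvN : dot v N = 1 - dot N n) 
    by (replace (dot v N) with (dot N N - dot N n) by (unfold v, dot, vsub; simpl; ring); lra).
  assert (Hvv : dot v v = 2 * (1 - dot N n)).
  { replace (dot v v) with (dot N N + dot n n - 2 * dot N n) by (unfold v, dot, vsub; simpl; ring).
    rewrite Hu, <- Hn2. ring. }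
  destruct (dot_self_nonneg v) as [Hpos | Hz].
  - exfalso. destruct (Hcone v) as (s0 & Hs0 & Hin); [lra |].
    destruct (common_scale (s0 / 2) (r / 2)) as (s & H3 & H1 & H2); [lra | lra |].
    apply (exterior_ball_point r k t (vadd (g k t) (vscale s v)) Hr Hext Hk Ht).
    + replace (vsub (vadd (g k t) (vscale s v)) (g k t)) with (vscale s v) by vec_ring.
      fold N. replace (dot (vscale s v) (vscale s v)) with (s * (s * dot v v)) by vec_ring.
      replace (dot (vscale s v) N) with (s * dot v N) by vec_ring.
      rewrite HvN, Hvv. replace (2 * r * (s * (1 - dot N n))) with (s * (r * (2 * (1 - dot N n)))) by ring.
      apply Rmult_lt_compat_l; auto. apply Rmult_lt_compat_r; lra.
    + apply subset_closure, Hin. lra.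
  - symmetry in Hz. apply dot_self_0 in Hz. symmetry. apply vsub_eq_0, Hz.
Qed.

Lemma nrm_inner_cone k t : smooth_boundary -> (k < m)%nat -> 0 <= t <= 1 ->
  inner_cone (g k t) (nrm k t).
Proof.
  intros Hsm Hk Ht. destruct (Hsm (g k t)) as (n & Hn & Hc); [apply arc_boundary; auto |].
  rewrite <- (smooth_inner_cone k t Hsm Hk Ht n Hn Hc). auto.
Qed.

(** The vector [n] at the corner is the same for both arcs, and [smooth_inner_cone] identifies it
    with either one-sided normal. *)
Lemma nrm_glue k : smooth_boundary -> (k < m)%nat -> nrm (nx k) 0 = nrm k 1.
Proof.
  intros Hsm Hk. destruct (Hsm (g k 1)) as (n & Hn & Hc); [apply arc_boundary; auto; lra |].
  rewrite <- (smooth_inner_cone k 1 Hsm Hk ltac:(lra) n Hn Hc). symmetry.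
  apply smooth_inner_cone; auto using nx_lt; [lra |]. rewrite arc_glue; auto.
Qed.

(** * Matching of the arcs and starshapedness *)

Lemma g1_nrm k t : (k < m)%nat -> 0 <= t <= 1 ->
  g1 k t = vscale (orient k * speed k t) (- snd (nrm k t), fst (nrm k t)).
Proof.
  intros Hk Ht. assert (Hq := speed_pos k t Hk Ht). assert (Ho := orient_sq k).
  unfold nrm, unit_normal. fold (speed k t). unfold vscale, rot; simpl.
  rewrite (surjective_pairing (g1 k t)) at 1. f_equal.
  - replace (orient k * speed k t * - (orient k / speed k t * - fst (g1 k t))) with
      (orient k * orient k * fst (g1 k t)) by (field; lra). rewrite Ho; ring.
  - replace (orient k * speed k t * (orient k / speed k t * snd (g1 k t))) with
      (orient k * orient k * snd (g1 k t)) by (field; lra). rewrite Ho; ring.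
Qed.

(** Equal normals make the tangents parallel; the product of orientations leaves open whether they
    agree or form a cusp. *)
Lemma corner_tangents k : smooth_boundary -> (k < m)%nat ->
  g1 k 1 = vscale (orient k * orient (nx k) * (speed k 1 / speed (nx k) 0)) (g1 (nx k) 0).
Proof.
  intros Hsm Hk. assert (Hq' := speed_pos (nx k) 0 (nx_lt k) ltac:(lra)).
  assert (Ho' := orient_sq (nx k)).
  rewrite (g1_nrm k 1 Hk ltac:(lra)), (g1_nrm (nx k) 0 (nx_lt k) ltac:(lra)), nrm_glue by auto.
  set (j := nx k) in *. clearbody j. set (n := nrm k 1). clearbody n. unfold vscale; simpl. f_equal.
  - replace (orient k * orient j * (speed k 1 / speed j 0) *
      (orient j * speed j 0 * - snd n)) with
      (orient j * orient j * (orient k * speed k 1 * - snd n)) by (field; lra). rewrite Ho'. ring.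
  - replace (orient k * orient j * (speed k 1 / speed j 0) *
      (orient j * speed j 0 * fst n)) with
      (orient j * orient j * (orient k * speed k 1 * fst n)) by (field; lra). rewrite Ho'. ring.
Qed.

(* Two boundary points lying on a common line parallel to both normals: the
   outer one is in the exterior ball of the inner one. *)
Lemma no_stacked_points r n i s j t h : 0 < r -> exterior_ball r ->
  (i < m)%nat -> (j < m)%nat -> 0 <= s <= 1 -> 0 <= t <= 1 -> dot n n = 1 ->
  vsub (g j t) (g i s) = vscale h n -> 0 < h < r -> 1 / 2 < dot n (nrm i s) -> False.
Proof.
  intros Hr He Hi Hj Hs Ht Hn E Hh Hd.
  apply (exterior_ball_point r i s (g j t) Hr He Hi Hs); [| apply arc_boundary; auto].
  rewrite E.
  replace (dot (vscale h n) (vscale h n)) with (h * h * dot n n) by vec_ring.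
  replace (dot (vscale h n) (nrm i s)) with (h * dot n (nrm i s)) by vec_ring.
  rewrite Hn. assert (h * (1 / 2) < h * dot n (nrm i s)) by (apply Rmult_lt_compat_l; lra).
  assert (r * (h * (1 / 2)) < r * (h * dot n (nrm i s))) by (apply Rmult_lt_compat_l; lra).
  assert (h * h < h * r) by (apply Rmult_lt_compat_l; lra). lra.
Qed.

Lemma common_value (u v : R -> R) d : 0 < d -> continuity u -> continuity v ->
  u 0 = 0 -> v 0 = 0 -> 0 < u d -> 0 < v d ->
  exists s t, 0 < s <= d /\ 0 < t <= d /\ u s = v t.
Proof.
  intros Hd Hu Hv Hu0 Hv0 Hud Hvd.
  assert (H : forall (f : R -> R) y, continuity f -> f 0 = 0 -> 0 < y <= f d ->
    exists s, 0 < s <= d /\ f s = y).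
  { intros f y Hf H0 Hy.
    assert (Hc : continuity (fun s => f s - y)).
    { intros x. apply continuity_pt_minus; [apply Hf |].
      apply continuity_pt_cst. }
    destruct (IVT_cor _ 0 d Hc ltac:(lra)) as (s & Hs & E).
    - rewrite H0. nra.
    - exists s. split; [| lra]. destruct (Req_dec s 0) as [-> | Hne]; lra. }
  destruct (Rle_dec (u d) (v d)) as [Hle | Hle].
  - destruct (H v (u d)) as (t & Ht & E); auto; try lra. exists d, t. repeat split; lra.
  - destruct (H u (v d)) as (s & Hs & E); auto; try lra. exists s, d. repeat split; lra.
Qed.

(** With opposite orientations both arcs would leave the corner along the same tangent direction
    [T]. Two points of them with equal component along [T] differ by a multiple of the normal, so
    one lies in the exterior ball of the other. *)
Lemma orient_glue k : smooth_boundary -> (k < m)%nat -> orient (nx k) = orient k.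
Proof.
  intros Hsm Hk. set (j := nx k). assert (Hj : (j < m)%nat) by apply nx_lt.
  assert (Hcases : orient j = orient k \/ orient j = - orient k)
    by (unfold orient; do 2 destruct Rlt_dec; lra).
  destruct Hcases as [H | Hopp]; auto. exfalso.
  destruct exterior_ball_exists as (r & Hr & Hext).
  assert (Hq := speed_pos k 1 Hk ltac:(lra)). assert (Hq' := speed_pos j 0 Hj ltac:(lra)).
  set (T := g1 j 0). set (c := speed k 1 / speed j 0).
  assert (Hc : 0 < c) by (apply Rdiv_lt_0_compat; auto).
  assert (E1 : g1 k 1 = vscale (- c) T).
  { unfold T, c. rewrite (corner_tangents k Hsm Hk). fold j. f_equal.
    rewrite Hopp. replace (orient k * - orient k) with (- (orient k * orient k)) by ring.
    rewrite orient_sq. ring. }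
  assert (HT : 0 < dot T T) by (apply dot_self_pos, arc_regular; auto; lra).
  set (p := g k 1). assert (Ep : g j 0 = p) by (apply arc_glue; auto).
  set (n := nrm k 1). assert (En : nrm j 0 = n) by (apply nrm_glue; auto).
  assert (Hn : dot n n = 1) by (apply nrm_unit; auto; lra).
  assert (HnT : dot n T = 0) by (rewrite <- En; apply unit_normal_orth).
  set (u := fun s => dot (vsub (g k (1 - s)) p) T).
  set (v := fun s => dot (vsub (g j s) p) T).
  assert (Hdu : derivable_pt_lim (fun s => dot (vsub (g k s) p) T) 1 (dot (g1 k 1) T)).
  { replace (dot (g1 k 1) T) with (dot (vsub (g1 k 1) (0, 0)) T) by vec_ring.
    apply (derivable_pt_lim_dot_const (fun s => vsub (g k s) p)).
    apply (vder_vsub (g k) (fun _ => p)); [apply arc_vder; auto | apply vder_const]. }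
  assert (Hdv : derivable_pt_lim v 0 (dot T T)).
  { replace (dot T T) with (dot (vsub T (0, 0)) T) by vec_ring.
    apply (derivable_pt_lim_dot_const (fun s => vsub (g j s) p)).
    apply (vder_vsub (g j) (fun _ => p)); [apply arc_vder; auto | apply vder_const]. }
  apply derivable_pt_lim_opp in Hdu.
  destruct (increasing_near _ _ _ Hdu) as (d1 & Hd1 & Hinc1).
  { rewrite E1. replace (dot (vscale (- c) T) T) with (- (c * dot T T)) by vec_ring. nra. }
  destruct (increasing_near _ _ _ Hdv HT) as (d2 & Hd2 & Hinc2).
  assert (Hck : continuity_pt (fun s => dot n (nrm k s)) 1).
  { apply continuity_pt_dot; [apply vcont_const | apply nrm_vcont; auto; lra]. }
  assert (Hcj : continuity_pt (fun s => dot n (nrm j s)) 0).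
  { apply continuity_pt_dot; [apply vcont_const | apply nrm_vcont; auto; lra]. }
  destruct (continuity_pt_eps _ _ Hck (1 / 2) ltac:(lra)) as (d3 & Hd3 & Hc3).
  destruct (continuity_pt_eps _ _ Hcj (1 / 2) ltac:(lra)) as (d4 & Hd4 & Hc4).
  destruct (vcont_eps _ _ (arc_vcont k 1 Hk) (r / 4) ltac:(lra)) as (d5 & Hd5 & Hc5).
  destruct (vcont_eps _ _ (arc_vcont j 0 Hj) (r / 4) ltac:(lra)) as (d6 & Hd6 & Hc6).
  fold n in Hc3. rewrite En in Hc4. rewrite Hn in Hc3, Hc4. rewrite Ep in Hc6. fold p in Hc5.
  (* [d1] and [d2] make both components along [T] positive, [d3] and [d4] keep the product of the
     normals with [n] above [1 / 2], [d5] and [d6] keep the points less than [r] apart, and [1]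
     keeps the parameters in range. *)
  destruct (common_scales (1 :: d1 :: d2 :: d3 :: d4 :: d5 :: d6 :: nil))
    as (D & HD & HDle); [simpl; repeat split; auto; lra |]. simpl in HDle.
  set (d := D / 2). assert (H0 : 0 < d) by (unfold d; lra). assert (H1 : d < D) by (unfold d; lra).
  destruct (common_value u v d) as (s & t & Hs & Ht & Euv); auto.
  - intros x. apply (continuity_pt_comp (fun s => 1 - s) (fun s => dot (vsub (g k s) p) T)).
    + apply continuity_pt_minus; [apply continuity_pt_cst | apply derivable_continuous_pt, derivable_pt_id].
    + apply continuity_pt_dot; [apply vcont_vsub; [apply arc_vcont; auto |] |]; apply vcont_const.
  - intros x. apply continuity_pt_dot; [apply vcont_vsub; [apply arc_vcont; auto |] |];
      apply vcont_const.
  - unfold u. rewrite Rminus_0_r. fold p. vec_ring.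
  - unfold v. rewrite Ep. vec_ring.
  - destruct (Hinc1 d ltac:(lra)) as [_ H]. unfold opp_fct in H. fold p in H.
    fold (u d) in H. replace (dot (vsub p p) T) with 0 in H by vec_ring. lra.
  - destruct (Hinc2 d ltac:(lra)) as [H _]. rewrite Rplus_0_l in H. unfold v in H at 1.
    rewrite Ep in H. replace (dot (vsub p p) T) with 0 in H by vec_ring. lra.
  - set (w := vsub (g j t) (g k (1 - s))).
    assert (HwT : dot w T = 0).
    { replace (dot w T) with (v t - u s) by (unfold w, u, v, dot, vsub; simpl; ring). lra. }
    set (h := dot w n).
    assert (Ew : w = vscale h n).
    { assert (Hrot : n <> (0, 0)) by (intros E; rewrite E in Hn; unfold dot in Hn; simpl in Hn; lra).
      assert (HTn : dot T T = det T n * det T n).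
      { assert (HL : det T n * det T n = dot T T * dot n n - dot n T * dot n T)
          by vec_ring. rewrite HL, Hn, HnT. ring. }
      unfold h. clear - HT HwT HnT Hn HTn. destruct w as [w1 w2], n as [n1 n2].
      unfold vscale, dot, det in *; simpl in *. set (D := fst T * n2 - snd T * n1) in *.
      assert (HD : D <> 0) by (intros E; rewrite E in HTn; lra).
      assert (Hz : w1 * n2 - w2 * n1 = 0).
      { apply Rmult_eq_reg_r with D; auto. unfold D.
        replace ((w1 * n2 - w2 * n1) * (fst T * n2 - snd T * n1)) with
          ((w1 * fst T + w2 * snd T) * (n1 * n1 + n2 * n2) -
           (w1 * n1 + w2 * n2) * (n1 * fst T + n2 * snd T)) by ring.
        rewrite HwT, HnT. ring. }
      f_equal.
      - transitivity (w1 * (n1 * n1 + n2 * n2) - n2 * (w1 * n2 - w2 * n1)); [| ring].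
        rewrite Hn, Hz; ring.
      - transitivity (w2 * (n1 * n1 + n2 * n2) + n1 * (w1 * n2 - w2 * n1)); [| ring].
        rewrite Hn, Hz; ring. }
    assert (Hwn : dot w w = h * h).
    { rewrite Ew. transitivity (h * h * dot n n); [unfold dot, vscale; simpl; ring |].
      rewrite Hn; ring. }
    assert (Hwr : vnorm w < r).
    { unfold w. assert (Htri := vnorm_triangle (g j t) p (g k (1 - s))).
      rewrite (vnorm_vsub_sym p) in Htri.
      specialize (Hc6 t ltac:(rewrite Rminus_0_r, Rabs_pos_eq; lra)).
      specialize (Hc5 (1 - s) ltac:(replace (1 - s - 1) with (- s) by ring;
        rewrite Rabs_Ropp, Rabs_pos_eq; lra)). lra. }
    apply vnorm_lt in Hwr; auto. rewrite Hwn in Hwr.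
    specialize (Hc4 t ltac:(rewrite Rminus_0_r, Rabs_pos_eq; lra)).
    specialize (Hc3 (1 - s) ltac:(replace (1 - s - 1) with (- s) by ring;
        rewrite Rabs_Ropp, Rabs_pos_eq; lra)).
    apply Rabs_lt_between' in Hc3. apply Rabs_lt_between' in Hc4.
    (* The sign of [h] tells which point is the outer one; [h = 0] would make the arcs meet away
       from their common corner. *)
    destruct (Rtotal_order h 0) as [Hh | [Hh | Hh]].
    + apply (no_stacked_points r n j t k (1 - s) (- h)); auto; try lra.
      * replace (vsub (g k (1 - s)) (g j t)) with (vscale (-1) w)
          by (unfold w, vscale, vsub; simpl; f_equal; ring).
        rewrite Ew. unfold vscale; simpl. f_equal; ring.
      * nra.
    + assert (Ez : w = (0, 0)) by (rewrite Ew, Hh; unfold vscale; simpl; f_equal; ring).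
      assert (Eg : g k (1 - s) = g j t).
      { symmetry. apply vsub_eq_0, Ez. }
      assert (Eg2 : g k (1 - s) = g k 1) by (apply (adjacent_arcs_meet k (1 - s) t); auto; lra).
      apply arc_injective in Eg2; auto; lra.
    + apply (no_stacked_points r n k (1 - s) j t h); auto; try lra. nra.
Qed.

Lemma tangent_glue k : smooth_boundary -> (k < m)%nat ->
  g1 k 1 = vscale (speed k 1 / speed (nx k) 0) (g1 (nx k) 0).
Proof.
  intros Hsm Hk. rewrite (corner_tangents k Hsm Hk). f_equal.
  rewrite orient_glue, orient_sq by auto. ring.
Qed.

(* At a boundary point [p] where the ray from the origin is tangent, the curve
   still crosses the ray outwards, and the exterior balls at nearby curve points
   contain ray points just beyond [p]. *)
Lemma tangential_ray_exit i t0 e p d : (i < m)%nat -> 0 <= t0 <= 1 ->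
  e * e = 1 -> (forall s, 0 < s < 1 -> 0 < t0 + e * s < 1) -> g i t0 = p -> p <> (0, 0) ->
  det p (g1 i t0) = 0 -> 0 < e * dot p (g1 i t0) -> 0 < d ->
  (forall s, 1 < s < 1 + d -> Om (vscale s p)) -> False.
Proof.
  intros Hi Ht0 He Hint Hp Hp0 Hdet Hdot Hd Hray.
  destruct exterior_ball_exists as (r & Hr & Hext).
  assert (Hpp : 0 < dot p p) by (apply dot_self_pos; auto).
  (* The coordinate of the curve transversal to the ray, in units of [vnorm p]. *)
  set (beta := fun t => det p (g i t) / dot p p).
  assert (Hcb : forall t, continuity_pt beta t).
  { intros t. apply continuity_pt_mult; [| apply continuity_pt_cst].
    apply continuity_pt_det; [apply vcont_const | apply arc_vcont; auto]. }
  assert (Hb0 : beta t0 = 0).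
  { unfold beta. rewrite Hp. unfold det, Rdiv. ring. }
  (* [F t > 0] is the exterior ball inequality for the foot of [g i t] on the ray, divided by
     [Rabs (beta t)]. *)
  set (F := fun t => 2 * r * (e * dot p (g1 i t) / speed i t) - Rabs (beta t) * dot p p).
  assert (Hsp := speed_pos i t0 Hi Ht0).
  assert (HcF : continuity_pt F t0).
  { apply continuity_pt_minus.
    - apply continuity_pt_mult; [apply continuity_pt_cst |].
      apply continuity_pt_mult.
      + apply continuity_pt_mult; [apply continuity_pt_cst |].
        apply continuity_pt_dot; [apply vcont_const | apply arc_vcont1; auto].
      + apply continuity_pt_inv; [apply speed_continuous; auto | lra].
    - apply continuity_pt_mult; [| apply continuity_pt_cst].
      apply (continuity_pt_comp beta Rabs); [apply Hcb | apply Rcontinuity_abs]. }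
  assert (HF0 : 0 < F t0).
  { unfold F. rewrite Hb0, Rabs_R0, Rmult_0_l, Rminus_0_r.
    apply Rmult_lt_0_compat; [lra |]. apply Rdiv_lt_0_compat; auto. }
  assert (Hcd : continuity_pt (fun t => dot p (g i t)) t0).
  { apply continuity_pt_dot; [apply vcont_const | apply arc_vcont; auto]. }
  assert (Hdd : derivable_pt_lim (fun s => dot p (g i (t0 + e * s))) 0 (e * dot p (g1 i t0))).
  { replace (e * dot p (g1 i t0)) with (dot p (g1 i (t0 + e * 0)) * e)
      by (rewrite Rmult_0_r, Rplus_0_r; ring).
    apply (derivable_pt_lim_comp (fun s => t0 + e * s) (fun t => dot p (g i t))).
    - apply derivable_pt_lim_affine.
    - replace (dot p (g1 i (t0 + e * 0))) with
        (dot (0, 0) (g i (t0 + e * 0)) + dot p (g1 i (t0 + e * 0))) by vec_ring.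
      apply (derivable_pt_lim_dot (fun _ => p) (g i)); [apply vder_const | apply arc_vder; auto]. }
  destruct (increasing_near _ _ _ Hdd Hdot) as (d1 & Hd1 & Hinc).
  destruct (continuity_pt_eps _ _ HcF (F t0) HF0) as (d2 & Hd2 & Hc2).
  destruct (continuity_pt_eps _ _ Hcd (d * dot p p) ltac:(nra)) as (d3 & Hd3 & Hc3).
  rewrite Hp in Hc3.
  destruct (common_scales (1 :: d1 :: d2 :: d3 :: nil))
    as (D & HD & HDle); [simpl; repeat split; auto; lra |]. simpl in HDle.
  assert (Hea : Rabs e = 1).
  { assert (E : (e - 1) * (e + 1) = 0) by (ring_simplify; lra).
    apply Rmult_integral in E as [E | E].
    - replace e with 1 by lra. apply Rabs_R1.
    - replace e with (-1) by lra. rewrite Rabs_left; lra. }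
  assert (Habs : forall s, 0 < s -> Rabs (t0 + e * s - t0) = s).
  { intros s Hs. replace (t0 + e * s - t0) with (e * s) by ring.
    rewrite Rabs_mult, Hea, Rabs_pos_eq; lra. }
  set (s := D / 2). set (t := t0 + e * s).
  assert (Hs : 0 < s < D) by (unfold s; lra).
  assert (Ht : 0 < t < 1) by (apply Hint; lra).
  assert (Hpz : forall s', 0 <= s' < D -> dot p p <= dot p (g i (t0 + e * s'))).
  { intros s' [[Hs' | <-] Hs'']; [| rewrite Rmult_0_r, Rplus_0_r, Hp; lra].
    destruct (Hinc s' ltac:(lra)) as [H _].
    rewrite Rmult_0_r, Rplus_0_r, Rplus_0_l, Hp in H. lra. }
  assert (Hlt : dot p p < dot p (g i t)).
  { destruct (Hinc s ltac:(lra)) as [H _].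
    rewrite Rmult_0_r, Rplus_0_r, Rplus_0_l, Hp in H. exact H. }
  assert (Hsign : 0 < orient i * e * det p (g i t)).
  (* [q] is the tangent of the angle from [p] to the curve point. Its derivative is a positive
     multiple of [e] times the determinant of position and velocity, and so has the sign of
     [orient i * e]. *)
  { set (q := fun s' => det p (g i (t0 + e * s')) / dot p (g i (t0 + e * s'))).
    destruct (MVT_cor2 q (fun s' => e * (dot p p * det (g i (t0 + e * s')) (g1 i (t0 + e * s')) /
      Rsqr (dot p (g i (t0 + e * s'))))) 0 s ltac:(lra)) as (x & Hx & Hxs).
    { intros s' Hs'. specialize (Hpz s' ltac:(lra)).
      set (t' := t0 + e * s') in *.
      replace (e * (dot p p * det (g i t') (g1 i t') / Rsqr (dot p (g i t')))) with
        ((det p (g1 i t') * dot p (g i t') - dot p (g1 i t') * det p (g i t')) /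
         Rsqr (dot p (g i t')) * e)
        by (unfold Rdiv; rewrite !Rmult_assoc, (Rmult_comm e), <- !Rmult_assoc; f_equal; f_equal;
            unfold dot, det; ring).
      apply (derivable_pt_lim_comp (fun s => t0 + e * s) (fun t => det p (g i t) / dot p (g i t))).
      - apply derivable_pt_lim_affine.
      - fold t'. assert (Hv := arc_vder i t' Hi).
        apply (derivable_pt_lim_div (fun t => det p (g i t)) (fun t => dot p (g i t))).
        + replace (det p (g1 i t')) with (dot (g1 i t') (- snd p, fst p)) by vec_ring.
          apply (derivable_pt_lim_ext (fun t => dot (g i t) (- snd p, fst p)));
            [intros; unfold dot, det; simpl; ring |].
          apply derivable_pt_lim_dot_const; auto.
        + replace (dot p (g1 i t')) with (dot (g1 i t') p) by vec_ring.
          apply (derivable_pt_lim_ext (fun t => dot (g i t) p));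
            [intros; unfold dot; ring |].
          apply derivable_pt_lim_dot_const; auto.
        + lra. }
    assert (Hq0 : q 0 = 0).
    { unfold q. rewrite Rmult_0_r, Rplus_0_r, Hp. unfold det, Rdiv; ring. }
    rewrite Hq0 in Hx. unfold q in Hx. fold t in Hx.
    assert (Hox := orient_det i (t0 + e * x) Hi (Hint x ltac:(lra))).
    specialize (Hpz x ltac:(lra)). set (z := g i (t0 + e * x)) in *.
    set (z1 := g1 i (t0 + e * x)) in *.
    assert (E : det p (g i t) = e * (dot p p * det z z1 / Rsqr (dot p z) * s) * dot p (g i t)).
    { apply Rmult_eq_reg_r with (/ dot p (g i t)); [| apply Rinv_neq_0_compat; lra].
      fold (Rdiv (det p (g i t)) (dot p (g i t))). rewrite <- (Rminus_0_r (det p (g i t) / _)), Hx.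
      unfold Rsqr. field. lra. }
    rewrite E. replace (orient i * e * (e * (dot p p * det z z1 / (dot p z)² * s) * dot p (g i t)))
      with (e * e * (orient i * det z z1 * (dot p p * s * dot p (g i t) / (dot p z)²)))
      by (unfold Rdiv; ring).
    rewrite He, Rmult_1_l. apply Rmult_lt_0_compat; auto.
    apply Rdiv_lt_0_compat; [| apply Rsqr_pos_lt; lra].
    repeat apply Rmult_lt_0_compat; lra. }
  specialize (Hc2 t ltac:(unfold t; rewrite Habs; lra)).
  specialize (Hc3 t ltac:(unfold t; rewrite Habs; lra)).
  apply Rabs_lt_between' in Hc2. apply Rabs_lt_between' in Hc3.
  (* [vscale tau p] is the orthogonal projection of [g i t] to the ray. It lies just beyond [p],
     hence in [Om] by assumption, while the exterior ball at [g i t] contains it. *)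
  set (tau := dot p (g i t) / dot p p).
  assert (Htau : 1 < tau < 1 + d).
  { unfold tau. split; apply Rmult_lt_reg_r with (dot p p); auto;
      replace (dot p (g i t) / dot p p * dot p p) with (dot p (g i t)) by (field; lra); lra. }
  apply (exterior_ball_point r i t (vscale tau p) Hr Hext Hi ltac:(lra));
    [| apply subset_closure, Hray; auto].
  assert (Hst := speed_pos i t Hi ltac:(lra)).
  assert (Eqz : vsub (vscale tau p) (g i t) = vscale (- beta t) (- snd p, fst p)).
  { unfold tau, beta. revert Hpp. unfold dot, det, vsub, vscale; simpl. intros Hpp.
    f_equal; field; lra. }
  rewrite Eqz.
  replace (dot (vscale (- beta t) (- snd p, fst p)) (vscale (- beta t) (- snd p, fst p))) with
    (Rabs (beta t) * (Rabs (beta t) * dot p p)).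
  2: { replace (Rabs (beta t) * (Rabs (beta t) * dot p p)) with
         (Rabs (beta t) * Rabs (beta t) * dot p p) by ring.
       rewrite <- Rabs_mult, Rabs_pos_eq by nra. vec_ring. }
  assert (Eb : Rabs (beta t) = orient i * e * beta t).
  { assert (Hob : 0 < orient i * e * beta t).
    { unfold beta. replace (orient i * e * (det p (g i t) / dot p p)) with
        (orient i * e * det p (g i t) / dot p p) by (unfold Rdiv; ring).
      apply Rdiv_lt_0_compat; auto. }
    rewrite <- (Rabs_pos_eq (orient i * e * beta t)) by lra.
    rewrite !Rabs_mult, Hea.
    rewrite orient_abs. ring. }
  assert (Hbpos : 0 < Rabs (beta t)).
  { rewrite Eb. unfold beta. replace (orient i * e * (det p (g i t) / dot p p)) with
        (orient i * e * det p (g i t) / dot p p) by (unfold Rdiv; ring).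
      apply Rdiv_lt_0_compat; auto. }
  replace (dot (vscale (- beta t) (- snd p, fst p)) (nrm i t)) with
    (Rabs (beta t) * (e * dot p (g1 i t) / speed i t)).
  2: { rewrite Eb. unfold nrm, unit_normal. fold (speed i t).
       transitivity (e * e * (orient i * beta t * dot p (g1 i t) / speed i t));
         [unfold Rdiv; ring |]. rewrite He.
       unfold dot, vscale, rot; simpl. field. lra. }
  replace (2 * r * (Rabs (beta t) * (e * dot p (g1 i t) / speed i t))) with
    (Rabs (beta t) * (2 * r * (e * dot p (g1 i t) / speed i t))) by ring.
  apply Rmult_lt_compat_l; auto. unfold F in Hc2. lra.
Qed.

(** With positive support at [p] the ray itself enters the exterior ball. Zero support occurs only
    at a corner, with the ray tangent; one of the two arcs then leaves [p] outwards along the ray,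
    the incoming one run backwards if [dot p (g1 j 1) < 0], the next one otherwise. *)
Lemma no_ray_beyond p d : smooth_boundary -> boundary2 Om p -> p <> (0, 0) -> 0 < d ->
  (forall s, 1 < s < 1 + d -> Om (vscale s p)) -> False.
Proof.
  intros Hsm Hb Hp0 Hd Hray. destruct (boundary_arc p Hb) as (k & t & Hk & Ht & Ep).
  assert (Hpp : 0 < dot p p) by (apply dot_self_pos; auto).
  destruct (support_nonneg k t Hk Ht) as [Hpos | Hz].
  - destruct exterior_ball_exists as (r & Hr & Hext).
    unfold support in Hpos. rewrite <- Ep in Hpos.
    destruct (common_scale (d / 2) (r * dot p (nrm k t) / dot p p)) as (e & He & He1 & He2);
      [lra | apply Rdiv_lt_0_compat; auto; apply Rmult_lt_0_compat; auto |].
    apply (exterior_ball_point r k t (vscale (1 + e) p) Hr Hext Hk Ht);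
      [| apply subset_closure, Hray; lra].
    rewrite <- Ep. replace (vsub (vscale (1 + e) p) p) with (vscale e p) by vec_ring.
    replace (dot (vscale e p) (vscale e p)) with (e * (e * dot p p)) by vec_ring.
    replace (2 * r * dot (vscale e p) (nrm k t)) with (e * (2 * (r * dot p (nrm k t)))) by vec_ring.
    apply Rmult_lt_compat_l; auto.
    apply Rle_div_r in He2; [| lra].
    assert (0 < r * dot p (nrm k t)) by (apply Rmult_lt_0_compat; auto). lra.
  - assert (Hcorner : exists j, (j < m)%nat /\ g j 1 = p).
    { destruct (Req_dec t 1) as [-> | H1]; [exists k; auto |].
      destruct (Req_dec t 0) as [-> | H0].
      - destruct (nx_surjective k Hk) as (j & Hj & <-). exists j. split; auto.
        rewrite Ep. symmetry; apply arc_glue; auto.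
      - assert (H := support_pos k t Hk ltac:(lra)). lra. }
    destruct Hcorner as (j & Hj & Ej).
    assert (Hdet : det p (g1 j 1) = 0).
    { assert (Hn : nrm j 1 = nrm k t).
      { destruct (Hsm p Hb) as (n & Hn & Hc).
        transitivity n; [symmetry |]; apply smooth_inner_cone; auto; try lra.
        - rewrite Ej; auto.
        - rewrite <- Ep; auto. }
      assert (Hs : support j 1 = 0) by (unfold support; rewrite Hn, Ej, Ep; auto).
      assert (H := support_det j 1 Hj ltac:(lra)). rewrite Hs, Ej in H.
      assert (Ho := orient_sq j). set (D := det p (g1 j 1)) in *.
      transitivity (orient j * orient j * D); [rewrite Ho; ring |].
      rewrite Rmult_assoc, <- H. ring. }
    assert (Hg1 := arc_regular j 1 Hj ltac:(lra)).
    assert (Hdot : dot p (g1 j 1) <> 0).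
    { intros E. assert (H1 := dot_self_pos _ Hg1).
      assert (HL : det p (g1 j 1) * det p (g1 j 1) + dot p (g1 j 1) * dot p (g1 j 1) =
                dot p p * dot (g1 j 1) (g1 j 1)) by vec_ring.
      rewrite E, Hdet in HL. nra. }
    destruct (Rlt_dec (dot p (g1 j 1)) 0) as [Hneg | Hnn].
    + apply (tangential_ray_exit j 1 (-1) p d); auto; try lra. intros s Hs. lra.
    + assert (Hj' := nx_lt j).
      assert (Et := tangent_glue j Hsm Hj).
      assert (Hc : 0 < speed j 1 / speed (nx j) 0)
        by (apply Rdiv_lt_0_compat; apply speed_pos; auto; lra).
      set (c := speed j 1 / speed (nx j) 0) in *.
      assert (Ed : det p (g1 j 1) = c * det p (g1 (nx j) 0))
        by (rewrite Et; unfold det; cbn [vscale fst snd]; ring).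
      assert (Eo : dot p (g1 j 1) = c * dot p (g1 (nx j) 0))
        by (rewrite Et; unfold dot; cbn [vscale fst snd]; ring).
      apply (tangential_ray_exit (nx j) 0 1 p d); auto; try lra.
      * intros s Hs. lra.
      * rewrite arc_glue; auto.
      * rewrite Hdet in Ed. symmetry in Ed. apply Rmult_integral in Ed. lra.
      * rewrite Rmult_1_l. apply Rmult_lt_reg_l with c; auto. rewrite Rmult_0_r, <- Eo. lra.
Qed.

Lemma arc_point_nonzero k t : (k < m)%nat -> 0 < t < 1 -> g k t <> (0, 0).
Proof.
  intros Hk Ht E. assert (H := support_pos k t Hk Ht). unfold support in H.
  rewrite E in H. unfold dot in H; simpl in H. lra.
Qed.

(** From a point just inside the boundary, move along the ray towards the origin. A first exit point
    would be a boundary point with a stretch of [Om] directly beyond it on its ray. *)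
Lemma starshaped k t s : smooth_boundary -> (k < m)%nat -> 0 < t < 1 -> 0 < s < 1 ->
  Om (vscale s (g k t)).
Proof.
  intros Hsm Hk Ht Hs. set (y := g k t). apply NNPP. intros Hn.
  assert (Hcone := nrm_inner_cone k t Hsm Hk ltac:(lra)). fold y in Hcone.
  destruct (Hcone (vscale (-1) y)) as (s0 & Hs0 & Hin).
  { assert (H := support_pos k t Hk Ht). unfold support in H. fold y in H.
    replace (dot (vscale (-1) y) (nrm k t)) with (- dot y (nrm k t)) by vec_ring. lra. }
  destruct (common_scale (s0 / 2) ((1 - s) / 2)) as (s1 & H3 & H1 & H2); [lra | lra |].
  assert (Hx0 : Om (vscale (1 - s1) y)).
  { replace (vscale (1 - s1) y) with (vadd y (vscale s1 (vscale (-1) y)))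
      by vec_ring. apply Hin. lra. }
  destruct (segment_exit Om _ _ HO Hx0 Hn) as (u & Hu & Hbd & Hbefore).
  assert (Eseg : forall v, seg (vscale (1 - s1) y) (vscale s y) v =
                      vscale ((1 - s1) - v * (1 - s1 - s)) y).
  { intros v. unfold seg, vadd, vsub, vscale; simpl. f_equal; ring. }
  rewrite Eseg in Hbd.
  set (L := 1 - s1 - s) in *. assert (HL : 0 < L) by (unfold L; lra).
  set (c := 1 - s1 - u * L) in *.
  assert (Hc : 0 < c) by (unfold c, L in *; nra).
  assert (Hd : 0 < u * L / c) by (apply Rdiv_lt_0_compat; nra).
  apply (no_ray_beyond (vscale c y) (u * L / c) Hsm Hbd); auto.
  - intros E. apply (arc_point_nonzero k t Hk Ht). fold y.
    unfold vscale in E. injection E; intros E2 E1.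
    apply Rmult_integral in E1. apply Rmult_integral in E2.
    rewrite (surjective_pairing y). f_equal; lra.
  - intros v Hv.
    assert (Hv1 : c < v * c < c + u * L).
    { split; [nra |]. destruct Hv as [_ Hv]. apply Rmult_lt_compat_r with (r := c) in Hv; auto.
      replace ((1 + u * L / c) * c) with (c + u * L) in Hv by (field; lra). lra. }
    replace (vscale v (vscale c y)) with (vscale (1 - s1 - ((1 - s1 - v * c) / L) * L) y).
    + rewrite <- Eseg. apply Hbefore. unfold c in *. split.
      * apply Rdiv_le_0_compat; lra.
      * apply Rmult_lt_reg_r with L; auto.
        replace ((1 - s1 - v * (1 - s1 - u * L)) / L * L) with (1 - s1 - v * (1 - s1 - u * L))
          by (field; lra). lra.
    + unfold vscale; simpl. f_equal; field; lra.
Qed.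

(** If [mu] is not [1], the point nearer to the origin is in [Om] by starshapedness, yet it is a
    boundary point. This is what makes sectors disjoint. *)
Lemma ray_injective k t j s mu : smooth_boundary -> (k < m)%nat -> (j < m)%nat ->
  0 < t < 1 -> 0 < s < 1 -> 0 < mu -> g k t = vscale mu (g j s) -> k = j /\ t = s.
Proof.
  intros Hsm Hk Hj Ht Hs Hmu E.
  destruct (Rtotal_order mu 1) as [Hlt | [-> | Hgt]].
  - exfalso. apply (arc_boundary k t Hk ltac:(lra)). rewrite E. apply starshaped; auto.
  - assert (E' : g k t = g j s).
    { rewrite E. unfold vscale. rewrite (surjective_pairing (g j s)). simpl. f_equal; ring. }
    destruct (Nat.eq_dec k j) as [-> | Hne].
    + split; auto. apply (arc_injective j); auto; lra.
    + exfalso. destruct (distinct_arcs_meet k j t s) as [[_ H] | [_ H]]; auto; lra.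
  - exfalso. apply (arc_boundary j s Hj ltac:(lra)).
    replace (g j s) with (vscale (/ mu) (g k t)).
    + apply starshaped; auto. split; [apply Rinv_0_lt_compat; auto |].
      rewrite <- Rinv_1. apply Rinv_lt_contravar; lra.
    + rewrite E. unfold vscale; simpl. rewrite (surjective_pairing (g j s)). simpl.
      f_equal; field; lra.
Qed.

(** * Minkowski's formula and rigidity *)

(* Twice the rate at which the segment from the origin to [g k t] sweeps area. *)
Definition sweep (k : nat) (t : R) : R := orient k * det (g k t) (g1 k t).

Lemma sweep_continuous k t : (k < m)%nat -> continuity_pt (sweep k) t.
Proof.
  intros Hk. apply continuity_pt_mult; [apply continuity_pt_cst |].
  apply continuity_pt_det; [apply arc_vcont | apply arc_vcont1]; auto.
Qed.

Definition total_length : R := psum (fun k => RInt (speed k) 0 1) m.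
Definition total_sweep : R := psum (fun k => RInt (sweep k) 0 1) m.

Lemma minkowski_formula : smooth_boundary ->
  psum (fun k => RInt (fun t => curv k t * sweep k t) 0 1) m = total_length.
Proof.
  (* [T] is the component of the position along the unit tangent. [tangent_glue] makes it agree
     across corners, so the cyclic sum of its increments vanishes. *)
  intros Hsm. set (T := fun k t => dot (g k t) (g1 k t) / speed k t).
  assert (Hk : forall k, (k < m)%nat ->
    RInt (speed k) 0 1 - RInt (fun t => curv k t * sweep k t) 0 1 = T (nx k) 0 - T k 0).
  { intros k Hk.
    assert (HT : RInt (fun t => speed k t - curv k t * sweep k t) 0 1 = T k 1 - T k 0).
    { apply RInt_derivative; [lra | |].
      - intros t Ht. unfold sweep. rewrite <- support_det by auto.
        apply derivable_pt_lim_support; auto using orient_sq, arc_vder, arc_vder1, arc_regular.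
      - intros t Ht. apply continuity_pt_minus; [apply speed_continuous; auto |].
        apply continuity_pt_mult; [apply curv_continuous | apply sweep_continuous]; auto. }
    assert (HTg : T (nx k) 0 = T k 1).
    { unfold T. rewrite arc_glue by auto.
      assert (H1 := speed_pos k 1 Hk ltac:(lra)).
      assert (H2 := speed_pos (nx k) 0 (nx_lt k) ltac:(lra)).
      rewrite (tangent_glue k Hsm Hk). set (j := nx k) in *. clearbody j.
      unfold dot; cbn [vscale fst snd]. field. lra. }
    rewrite HTg, <- HT. symmetry.
    apply (RInt_minus (V := R_CompleteNormedModule)); apply ex_RInt_cont; try lra; intros t Ht.
    - apply speed_continuous; auto.
    - apply continuity_pt_mult; [apply curv_continuous | apply sweep_continuous]; auto. }
  apply Rminus_diag_uniq_sym. unfold total_length. rewrite <- psum_minus.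
  rewrite (psum_ext _ _ _ Hk). apply (psum_cyclic (fun k => T k 0)), m_pos.
Qed.

Lemma constant_curvature_disk k0 : smooth_boundary -> (exists x, Om x) -> 0 < k0 ->
  (forall k t, (k < m)%nat -> 0 < t < 1 -> curv k t = k0) -> is_disk Om.
Proof.
  intros Hsm Hne Hk0 Hcurv.
  set (C := fun k t => vsub (nrm k t) (vscale k0 (g k t))).
  assert (Hder : forall k t, (k < m)%nat -> 0 < t < 1 -> vder (C k) t (0, 0)).
  { intros k t Hk Ht. assert (H := vder_vsub _ _ _ _ _ (nrm_vder k t Hk ltac:(lra))
      (vder_vscale_const k0 _ _ _ (arc_vder k t Hk))).
    rewrite Hcurv in H by auto.
    replace (vsub (vscale k0 (g1 k t)) (vscale k0 (g1 k t))) with (0, 0) in H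
      by (unfold vsub; f_equal; ring). exact H. }
  assert (Hcont : forall k t, (k < m)%nat -> 0 <= t <= 1 -> vcont (C k) t).
  { intros k t Hk Ht. apply vcont_vsub; [apply nrm_vcont; auto |].
    apply vcont_vscale; [apply continuity_pt_cst | apply arc_vcont; auto]. }
  (* The curvature is prescribed only on the open arc, so derivatives are controlled inside and
     continuity alone is used at the ends. *)
  assert (Hflat : forall (f : R -> R) t, 0 <= t <= 1 ->
    (forall s, 0 <= s <= 1 -> continuity_pt f s) ->
    (forall s, 0 < s < 1 -> derivable_pt_lim f s 0) -> f t = f 0).
  { intros f t [[Ht | <-] Ht1] Hc Hd; auto.
    destruct (MVT_gen f 0 t (fun _ => 0)) as (x & _ & Hx).
    - intros s Hs. rewrite Rmin_left, Rmax_right in Hs by lra. apply is_derive_Reals, Hd. lra.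
    - intros s Hs. rewrite Rmin_left, Rmax_right in Hs by lra. apply Hc. lra.
    - lra. }
  assert (Harc : forall k t, (k < m)%nat -> 0 <= t <= 1 -> C k t = C k 0).
  { intros k t Hk Ht. rewrite (surjective_pairing (C k t)), (surjective_pairing (C k 0)).
    f_equal.
    - apply (Hflat (fun s => fst (C k s))); auto; intros s Hs;
        [apply (Hcont k s) | apply (Hder k s)]; auto.
    - apply (Hflat (fun s => snd (C k s))); auto; intros s Hs;
        [apply (Hcont k s) | apply (Hder k s)]; auto. }
  assert (Hall : forall k, (k < m)%nat -> C k 0 = C 0%nat 0).
  { induction k as [|k IH]; intros Hk; auto. rewrite <- IH by lia.
    rewrite <- (Harc k 1) by first [lia | lra].
    unfold C at 2. rewrite <- nrm_glue, <- arc_glue by (auto; lia).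
    rewrite Nat.mod_small by lia. replace (k + 1)%nat with (S k) by lia. auto. }
  set (c := vscale (- / k0) (C 0%nat 0)).
  apply disk_of_boundary_in_circle with c (/ k0); auto.
  - apply Rinv_0_lt_compat; auto.
  - intros z Hz. destruct (boundary_arc z Hz) as (k & t & Hk & Ht & ->).
    replace (vsub (g k t) c) with (vscale (/ k0) (nrm k t)).
    + rewrite vnorm_vscale, Rabs_pos_eq by (left; apply Rinv_0_lt_compat; auto).
      unfold vnorm. rewrite nrm_unit, sqrt_1 by auto. ring.
    + unfold c. rewrite <- (Hall k Hk), <- (Harc k t Hk Ht).
      unfold C. clear - Hk0. set (n := nrm k t). clearbody n.
      unfold vsub, vscale; simpl. f_equal; field; lra.
Qed.

Lemma rigidity k0 : smooth_boundary -> (exists x, Om x) -> 0 < k0 ->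
  (forall k t, (k < m)%nat -> 0 < t < 1 -> curv k t <= k0) ->
  k0 * total_sweep <= total_length -> is_disk Om.
Proof.
  intros Hsm Hne Hk0 Hle Hint. apply (constant_curvature_disk k0); auto.
  intros k t Hk Ht.
  set (f := fun k t => (k0 - curv k t) * sweep k t).
  assert (Hcf : forall k s, (k < m)%nat -> 0 <= s <= 1 -> continuity_pt (f k) s).
  { intros j s Hj Hs. apply continuity_pt_mult; [| apply sweep_continuous; auto].
    apply continuity_pt_minus; [apply continuity_pt_cst |].
    apply curv_continuous; auto. }
  assert (Hf0 : forall k s, (k < m)%nat -> 0 < s < 1 -> 0 <= f k s).
  { intros j s Hj Hs. assert (H1 := Hle j s Hj Hs). assert (H2 := orient_det j s Hj Hs).
    unfold f, sweep. apply Rmult_le_pos; lra. }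
  assert (Hsum : psum (fun k => RInt (f k) 0 1) m = k0 * total_sweep - total_length).
  { rewrite <- (minkowski_formula Hsm). unfold total_sweep.
    rewrite <- psum_scal, <- psum_minus. apply psum_ext. intros j Hj.
    assert (Hex : ex_RInt (sweep j) 0 1).
    { apply ex_RInt_cont; [lra |]. intros; apply sweep_continuous; auto. }
    transitivity (RInt (fun t => minus (scal k0 (sweep j t)) (curv j t * sweep j t)) 0 1).
    - apply RInt_ext. intros s Hs. unfold f, minus, plus, opp, scal; simpl. unfold mult; simpl. ring.
    - rewrite (RInt_minus (V := R_CompleteNormedModule)).
      + rewrite (RInt_scal (V := R_CompleteNormedModule)) by auto. reflexivity.
      + apply (ex_RInt_scal (V := R_CompleteNormedModule)); auto.
      + apply ex_RInt_cont; [lra |]. intros s Hs.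
        apply continuity_pt_mult; [apply curv_continuous | apply sweep_continuous]; auto. }
  assert (Hz : RInt (f k) 0 1 = 0).
  { apply (psum_nonneg_eq0 (fun k => RInt (f k) 0 1) m); auto; [| lra].
    intros j Hj. apply RInt_ge_0; [lra | |].
    - apply ex_RInt_cont; [lra |]. intros; apply Hcf; auto.
    - intros s Hs. apply Hf0; auto. }
  assert (Hft : f k t = 0).
  { apply RInt_nonneg_eq0 with 0 1; auto; lra. }
  assert (H2 := orient_det k t Hk Ht). unfold f, sweep in Hft.
  apply Rmult_integral in Hft. lra.
Qed.

(** * Area swept from the origin *)

(** The arc is trimmed to [[a, b]], where the sweep rate has a positive lower bound, and cut into
    short pieces. Each chord triangle has area about half of [h * sweep]; shrunk slightly, it
    becomes disjoint from the others by [ray_injective] and keeps a margin inside [Om] by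
    compactness. *)
Lemma arc_sector_area k e : smooth_boundary -> (k < m)%nat -> 0 < e ->
  exists (S : R2 -> Prop) eta, 0 < eta /\
    (forall x, S x -> exists t c, 0 < t < 1 /\ 0 < c /\ x = vscale c (g k t)) /\
    (forall x z, S x -> vnorm (vsub z x) < eta -> Om z) /\
    area_ge S (RInt (sweep k) 0 1 / 2 - e).
Proof.
  intros Hsm Hk He.
  assert (Hcw : forall t, continuity_pt (sweep k) t) by (intros; apply sweep_continuous; auto).
  destruct (RInt_shrink (sweep k) (e / 4) ltac:(lra) ltac:(auto)) as (a & Ha & HW).
  set (W := RInt (sweep k) 0 1) in *.
  set (b := 1 - a) in *.
  assert (Hab : a < b) by (unfold b; lra).
  assert (Hba : b - a <= 1) by (unfold b; lra).
  assert (Hin : forall t, a <= t <= b -> 0 < t < 1) by (unfold b; intros; lra).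
  destruct (positive_min (sweep k) a b ltac:(lra) ltac:(auto)) as (w0 & Hw0 & Hw).
  { intros t Ht. apply orient_det; auto. }
  assert (Hcn : forall t, continuity_pt (fun t => vnorm (g k t)) t)
    by (intros; apply continuity_pt_vnorm, arc_vcont; auto).
  destruct (positive_min (fun t => vnorm (g k t)) a b ltac:(lra) ltac:(auto))
    as (rho & Hrho & Hlow).
  { intros t Ht. apply vnorm_pos, arc_point_nonzero; auto. }
  destruct (upper_bound_exists (fun t => vnorm (g k t)) a b ltac:(lra) ltac:(auto))
    as (G & HG & Hup).
  assert (HW0 : 0 <= W).
  { apply RInt_ge_0; [lra | apply ex_RInt_cont; [lra | auto] |].
    intros t Ht. left. apply orient_det; auto. }
  (* Shrinking multiplies areas by at least [1 - 2 * eta]; this bound on [eta] makes the loss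
     [eta * W] at most [e / 4]. *)
  destruct (common_scale (1 / 2) (e / (4 * (W + 1)))) as (eta & Heta0 & Heta1 & Heta2); [lra | apply Rdiv_lt_0_compat; lra |].
  apply Rle_div_r in Heta2; [| lra].
  (* [om] bounds the variation of the velocity on a piece: [G * om <= w0 / 2] keeps every chord
     determinant positive, and [G * om <= e / 4] keeps the total linearisation error small. *)
  destruct (common_scale (w0 / 2 / G) (e / 4 / G)) as (om & Hom & HGom1 & HGom2);
    [repeat apply Rdiv_lt_0_compat; lra | repeat apply Rdiv_lt_0_compat; lra |].
  apply Rle_div_r in HGom1, HGom2; auto.
  destruct (vuniform_modulus (g1 k) a b om Hom ltac:(intros; apply arc_vcont1; auto))
    as (d1 & Hd1 & Hm1).
  destruct (vuniform_modulus (g k) a b (eta * rho / 12) ltac:(nra)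
    ltac:(intros; apply arc_vcont; auto)) as (d2 & Hd2 & Hm2).
  destruct (uniform_modulus (sweep k) a b (e / 4) ltac:(lra) ltac:(auto)) as (d3 & Hd3 & Hm3).
  destruct (common_scales (d1 :: d2 :: d3 :: nil))
    as (D & HD & HDle); [simpl; repeat split; auto; lra |]. simpl in HDle.
  destruct (mesh_exists (b - a) D HD) as (M & HM & Hh).
  set (h := (b - a) / INR M) in *.
  assert (HM0 : 0 < INR M) by (apply lt_0_INR; auto).
  assert (Hh0 : 0 < h) by (apply Rdiv_lt_0_compat; lra).
  assert (HMh : INR M * h = b - a) by (unfold h; field; lra).
  set (t := fun i => a + INR i * h).
  assert (Ht : forall i, (i < M)%nat -> a <= t i /\ t i < t (S i) /\ t (S i) <= b /\ t (S i) - t i = h).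
  { intros i Hi. unfold t. rewrite S_INR. assert (H0 := pos_INR i).
    assert (Hle : INR i + 1 <= INR M) by (rewrite <- S_INR; apply le_INR; auto).
    assert (0 <= INR i * h) by (apply Rmult_le_pos; lra).
    assert ((INR i + 1) * h <= INR M * h) by (apply Rmult_le_compat_r; lra). lra. }
  set (K := fun i => shrunk_sector eta (g k (t i)) (g k (t (S i)))).
  assert (Hdet : forall i, (i < M)%nat ->
    h * sweep k (t i) - G * om * h <= orient k * det (g k (t i)) (g k (t (S i)))).
  { intros i Hi. destruct (Ht i Hi) as (T1 & T2 & T3 & T4).
    assert (Hmv := vector_mean_value (g k) (g1 k) (t i) (t (S i)) (g1 k (t i)) om ltac:(lra)
      ltac:(intros; apply arc_vder; auto)
      ltac:(intros u Hu; apply Hm1; try lra; rewrite Rabs_pos_eq; lra)).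
    rewrite T4 in Hmv.
    set (A := g k (t i)) in *. set (B := g k (t (S i))) in *.
    set (E := vsub (vsub B A) (vscale h (g1 k (t i)))) in *.
    replace (orient k * det A B) with (h * sweep k (t i) + orient k * det A E)
      by (unfold sweep, E; fold A; unfold det, vsub, vscale; simpl; ring).
    assert (Hb : Rabs (orient k * det A E) <= G * (om * h)).
    { rewrite Rabs_mult, orient_abs, Rmult_1_l. eapply Rle_trans; [apply det_bound |].
      apply Rmult_le_compat; auto using vnorm_nonneg. apply Hup. lra. }
    apply Rabs_le_between in Hb. lra. }
  assert (Hdetpos : forall i, (i < M)%nat -> 0 < orient k * det (g k (t i)) (g k (t (S i)))).
  { intros i Hi. apply Rlt_le_trans with (2 := Hdet i Hi).
    destruct (Ht i Hi) as (T1 & T2 & T3 & T4). specialize (Hw (t i) ltac:(lra)).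
    replace (h * sweep k (t i) - G * om * h) with (h * (sweep k (t i) - G * om)) by ring.
    apply Rmult_lt_0_compat; lra. }
  assert (Hray : forall i x, (i < M)%nat -> K i x ->
    exists u c, t i < u < t (S i) /\ eta / 3 <= c <= 1 - eta / 6 /\ x = vscale c (g k u)).
  { intros i x Hi Hx. destruct (Ht i Hi) as (T1 & T2 & T3 & T4).
    apply (shrunk_sector_on_ray (g k) (orient k) (t i) (t (S i)) (eta * rho / 12) eta rho x);
      auto; try lra.
    - intros u. apply arc_vcont; auto.
    - intros u Hu. apply Hm2; try lra. rewrite Rabs_pos_eq; lra.
    - intros u Hu. apply Hlow. lra. }
  destruct (compact_image_margin Om (g k) a b (eta / 3) (1 - eta / 6) HO) as (mu & Hmu & Hmargin).
  { intros u. apply arc_vcont; auto. }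
  { intros u c Hu Hc. apply starshaped; auto. lra. }
  exists (fun x => exists i, (i < M)%nat /\ K i x), mu.
  split; auto. split; [| split].
  - intros x (i & Hi & Hx). destruct (Hray i x Hi Hx) as (u & c & Hu & Hc & E).
    destruct (Ht i Hi) as (T1 & T2 & T3 & T4).
    exists u, c. split; [apply Hin; lra |]. split; [lra | auto].
  - intros x z (i & Hi & Hx) Hz. destruct (Hray i x Hi Hx) as (u & c & Hu & Hc & E).
    destruct (Ht i Hi) as (T1 & T2 & T3 & T4).
    rewrite E in Hz. apply (Hmargin u c z); auto. lra.
  - eapply area_ge_mono; [intros x Hx; exact Hx | |
      apply (area_ge_bigunion K (fun i => (1 - 2 * eta) * Rabs (det (g k (t i)) (g k (t (S i)))) / 2))].
    + apply Rle_trans with (psum (fun i => (1 - 2 * eta) / 2 * (h * sweep k (t i) - G * om * h)) M).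
      * rewrite psum_scal, psum_minus, psum_const.
        assert (HR := riemann_sum_close (sweep k) a b (e / 4) M ltac:(lra) HM ltac:(auto)
          ltac:(intros s u Hs Hu Hsu; apply Hm3; auto; fold h in Hsu; lra)).
        fold h in HR. apply Rabs_le_between in HR. fold t in HR.
        change (fun i => h * sweep k (a + INR i * h)) with (fun i => h * sweep k (t i)) in HR.
        set (P := psum (fun i => h * sweep k (t i)) M) in *.
        replace (INR M * (G * om * h)) with (G * om * (INR M * h)) by ring. rewrite HMh.
        assert (Hb1 : e / 4 * (b - a) <= e / 4) by nra.
        assert (Hb2 : G * om * (b - a) <= e / 4 * 1) by (apply Rmult_le_compat; nra).
        (* The three losses of [e / 4] come from trimming, from the Riemann sum and from the
           linearisation of chords. *)
        assert (HP : W - 3 * (e / 4) <= P - G * om * (b - a)) by lra.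
        apply Rle_trans with ((1 - 2 * eta) / 2 * (W - 3 * (e / 4)));
          [| apply Rmult_le_compat_l; lra].
        assert (0 <= eta * e) by (apply Rmult_le_pos; lra). lra.
      * apply psum_le. intros i Hi.
        replace ((1 - 2 * eta) * Rabs (det (g k (t i)) (g k (t (S i)))) / 2) with
          ((1 - 2 * eta) / 2 * Rabs (det (g k (t i)) (g k (t (S i))))) by field.
        apply Rmult_le_compat_l; [lra |]. apply Rle_trans with (1 := Hdet i Hi).
        apply Rle_trans with (1 := Rle_abs _). rewrite Rabs_mult, orient_abs. lra.
    + intros i Hi. apply shrunk_sector_area. lra.
    + intros i j x Hij Hx Hy.
      destruct (Hray i x ltac:(lia) Hx) as (u & c & Hu & Hc & E).
      destruct (Hray j x ltac:(lia) Hy) as (u' & c' & Hu' & Hc' & E').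
      destruct (Ht i ltac:(lia)) as (T1 & T2 & T3 & T4).
      destruct (Ht j ltac:(lia)) as (T1' & T2' & T3' & T4').
      destruct (ray_injective k u k u' (c' / c)) as [_ Euu]; auto.
      * apply Hin; lra.
      * apply Hin; lra.
      * apply Rdiv_lt_0_compat; lra.
      * transitivity (vscale (/ c) x).
        -- rewrite E. unfold vscale; simpl. rewrite (surjective_pairing (g k u)). simpl.
           f_equal; field; lra.
        -- rewrite E'. unfold vscale; simpl. f_equal; field; lra.
      * assert (Hle : t (S i) <= t j).
        { unfold t. apply Rplus_le_compat_l, Rmult_le_compat_r; [lra |]. apply le_INR. lia. }
        lra.
Qed.

Lemma sectors_area e : smooth_boundary -> 0 < e ->
  exists (S : R2 -> Prop) eta, 0 < eta /\
    (forall x z, S x -> vnorm (vsub z x) < eta -> Om z) /\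
    area_ge S (total_sweep / 2 - e).
Proof.
  intros Hsm He. set (e' := e / INR m).
  assert (Hm : 0 < INR m) by (apply lt_0_INR, m_pos).
  assert (He' : 0 < e') by (apply Rdiv_lt_0_compat; auto).
  (* The induction records that the set built so far lies on rays through the first [n] arcs; this
     gives disjointness from the sectors of the next arc. *)
  assert (H : forall n, (n <= m)%nat -> exists (S : R2 -> Prop) eta, 0 < eta /\
    (forall x, S x -> exists k t c, (k < n)%nat /\ 0 < t < 1 /\ 0 < c /\ x = vscale c (g k t)) /\
    (forall x z, S x -> vnorm (vsub z x) < eta -> Om z) /\
    area_ge S (psum (fun k => RInt (sweep k) 0 1) n / 2 - INR n * e')).
  { induction n as [|n IH]; intros Hn.
    - exists (fun _ => False), 1. split; [lra |]. split; [tauto |]. split; [tauto |].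
      apply area_ge_nonpos. simpl. lra.
    - destruct (IH ltac:(lia)) as (S1 & eta1 & He1 & Hr1 & Hm1 & Ha1).
      destruct (arc_sector_area n e' Hsm ltac:(lia) He') as (S2 & eta2 & He2 & Hr2 & Hm2 & Ha2).
      destruct (common_scale eta1 eta2 He1 He2) as (eta & Heta & M1 & M2).
      exists (fun x => S1 x \/ S2 x), eta. split; auto. split; [| split].
      + intros x [Hx | Hx].
        * destruct (Hr1 x Hx) as (k & t & c & Hk & Hrest). exists k, t, c. split; [lia | auto].
        * destruct (Hr2 x Hx) as (t & c & Hrest). exists n, t, c. split; [lia | auto].
      + intros x z [Hx | Hx] Hz; [apply (Hm1 x) | apply (Hm2 x)]; auto; lra.
      + eapply area_ge_mono; [intros x Hx; exact Hx | | apply (area_ge_union _ _ _ _) with (2 := Ha1) (3 := Ha2)].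
        * rewrite S_INR. simpl psum. lra.
        * intros x Hx Hy. destruct (Hr1 x Hx) as (k & t & c & Hk & Ht & Hc & E).
          destruct (Hr2 x Hy) as (t' & c' & Ht' & Hc' & E').
          destruct (ray_injective k t n t' (c' / c)) as [Ekn _]; auto; try lia.
          -- apply Rdiv_lt_0_compat; lra.
          -- transitivity (vscale (/ c) x).
             ++ rewrite E. unfold vscale; simpl. rewrite (surjective_pairing (g k t)). simpl.
                f_equal; field; lra.
             ++ rewrite E'. unfold vscale; simpl. f_equal; field; lra. }
  destruct (H m (le_n m)) as (S & eta & Heta & _ & Hmar & Ha).
  exists S, eta. split; auto. split; auto.
  replace (total_sweep / 2 - e) with (psum (fun k => RInt (sweep k) 0 1) m / 2 - INR m * e'); auto.
  unfold total_sweep, e'. field. lra.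
Qed.

Lemma total_sweep_le_area : smooth_boundary -> total_sweep <= 2 * area Om.
Proof.
  intros Hsm. assert (H : total_sweep / 2 <= area Om); [| lra].
  apply le_epsilon. intros e He.
  destruct (sectors_area e Hsm He) as (S & eta & Heta & Hmar & Ha).
  assert (H := area_ge_area Om S eta _ HB Heta Hmar Ha). lra.
Qed.

Lemma total_sweep_nonneg : 0 <= total_sweep.
Proof.
  apply psum_nonneg. intros k Hk. apply RInt_ge_0; [lra | |].
  - apply ex_RInt_cont; [lra |]. intros; apply sweep_continuous; auto.
  - intros t Ht. left. apply orient_det; auto.
Qed.

Lemma total_length_pos : 0 < total_length.
Proof.
  apply psum_pos; [apply m_pos |]. intros k Hk. apply RInt_gt_0; [lra | |].
  - intros t Ht. apply speed_pos; auto; lra.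
  - intros t Ht. apply continuity_pt_continuous, speed_continuous; auto.
Qed.

(** The reverse of the inequality assumed in [rigidity]; it forces a curvature bound [k0] to be
    positive, as lengths are. *)
Lemma length_le_curvature_bound k0 : smooth_boundary ->
  (forall k t, (k < m)%nat -> 0 < t < 1 -> curv k t <= k0) ->
  total_length <= k0 * total_sweep.
Proof.
  intros Hsm Hle. rewrite <- (minkowski_formula Hsm). unfold total_sweep.
  rewrite <- psum_scal. apply psum_le. intros k Hk.
  assert (Hex : ex_RInt (sweep k) 0 1).
  { apply ex_RInt_cont; [lra |]. intros; apply sweep_continuous; auto. }
  apply Rle_trans with (RInt (fun t => scal k0 (sweep k t)) 0 1).
  - apply RInt_le; [lra | | apply (ex_RInt_scal (V := R_CompleteNormedModule)); auto |].
    + apply ex_RInt_cont; [lra |]. intros t Ht.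
      apply continuity_pt_mult; [apply curv_continuous | apply sweep_continuous]; auto.
    + intros t Ht. apply Rmult_le_compat_r; [left; apply orient_det | apply Hle]; auto.
  - rewrite (RInt_scal (V := R_CompleteNormedModule)) by auto. apply Rle_refl.
Qed.

(** * The case of a boundary point of maximal curvature *)

(** Pairing the velocity with the chord [v] gives [dot v v] as an integral, which is at most
    [vnorm v] times the integral of the speed. *)
Lemma chord_le_length k a b : (k < m)%nat -> a <= b ->
  vnorm (vsub (g k b) (g k a)) <= RInt (speed k) a b.
Proof.
  intros Hk Hab. set (v := vsub (g k b) (g k a)).
  assert (Hex : ex_RInt (speed k) a b).
  { apply ex_RInt_cont; auto. intros; apply speed_continuous; auto. }
  assert (H0 : 0 <= RInt (speed k) a b).
  { apply RInt_ge_0; auto. intros; apply vnorm_nonneg. }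
  assert (Hv : RInt (fun t => dot (g1 k t) v) a b = dot v v).
  { rewrite (RInt_derivative (fun t => dot (g k t) v)); auto.
    - unfold v, dot, vsub; simpl; ring.
    - intros t Ht. apply derivable_pt_lim_dot_const, arc_vder; auto.
    - intros t Ht. apply continuity_pt_dot; [apply arc_vcont1; auto | apply vcont_const]. }
  assert (Hle : dot v v <= vnorm v * RInt (speed k) a b).
  { rewrite <- Hv.
    replace (vnorm v * RInt (speed k) a b) with (RInt (fun t => scal (vnorm v) (speed k t)) a b)
      by (rewrite (RInt_scal (V := R_CompleteNormedModule)) by auto; reflexivity).
    apply RInt_le; auto.
    - apply ex_RInt_cont; auto. intros t Ht.
      apply continuity_pt_dot; [apply arc_vcont1; auto | apply vcont_const].
    - apply (ex_RInt_scal (V := R_CompleteNormedModule)); auto.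
    - intros t Ht. apply Rle_trans with (1 := Rle_abs _).
      apply Rle_trans with (1 := cauchy_schwarz _ _). right. apply Rmult_comm. }
  rewrite <- vnorm_sq in Hle. destruct (vnorm_nonneg v) as [Hp | Hz]; [| lra].
  apply Rmult_le_reg_l with (vnorm v); auto.
Qed.

Lemma chord_sum_le_length k l a : (k < m)%nat -> increasing_from a l ->
  chord_sum (g k) a l <= RInt (speed k) a (last l a) /\ a <= last l a.
Proof.
  intros Hk. revert a. induction l as [|b l IH]; intros a Hinc.
  - simpl. rewrite RInt_point. unfold zero; simpl. lra.
  - destruct Hinc as [Hab Hinc]. destruct (IH b Hinc) as [H1 H2].
    assert (El : last (b :: l) a = last l b).
    { clear. revert a b. induction l as [|c l IH]; intros a b; auto.
      transitivity (last l c); [apply (IH a c) | symmetry; apply (IH b c)]. }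
    rewrite El. split; [| lra].
    assert (Hex : forall x y, x <= y -> ex_RInt (speed k) x y).
    { intros x y Hxy. apply ex_RInt_cont; auto. intros; apply speed_continuous; auto. }
    rewrite <- (RInt_Chasles (V := R_CompleteNormedModule) (speed k) a b (last l b))
      by (apply Hex; lra).
    unfold plus; simpl. apply Rplus_le_compat; auto. apply chord_le_length; auto; lra.
Qed.

(** The perimeter will occur as an upper bound for [2 * k0 * area Om], hence the comparison with the
    integral in this direction; positivity allows division by the perimeter. *)
Lemma arc_length_bounds k : (k < m)%nat -> 0 < arc_length (g k) <= RInt (speed k) 0 1.
Proof.
  intros Hk. unfold arc_length.
  set (E := fun L => exists l : list R, l <> nil /\ increasing_from 0 l /\
                  last l 0 = 1 /\ L = chord_sum (g k) 0 l).
  assert (Hub : forall L, E L -> L <= RInt (speed k) 0 1).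
  { intros L (l & _ & Hinc & Hlast & ->). rewrite <- Hlast. apply chord_sum_le_length; auto. }
  assert (H1 : E (vnorm (vsub (g k 1) (g k 0)))).
  { exists (1 :: nil). split; [discriminate |]. simpl. repeat split; try lra. }
  destruct (Rsup_is_lub E) as [HU HL].
  - eexists; eauto.
  - exists (RInt (speed k) 0 1). intros L. apply Hub.
  - split.
    + apply Rlt_le_trans with (2 := HU _ H1). apply vnorm_pos. intros E0.
      assert (Eg : g k 1 = g k 0).
      { apply vsub_eq_0, E0. }
      apply arc_injective in Eg; auto; lra.
    + apply HL. intros L. apply Hub.
Qed.

Lemma perimeter_psum n (h : nat -> R -> R2) : perimeter n h = psum (fun k => arc_length (h k)) n.
Proof.
  unfold perimeter. induction n as [|n IH]; auto.
  rewrite seq_S, map_app, fold_right_app. simpl. rewrite <- IH.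
  generalize (arc_length (h n)). generalize (map (fun k => arc_length (h k)) (seq 0 n)).
  intros l x. induction l as [|y l IHl]; simpl; [ring | rewrite IHl; ring].
Qed.

Lemma perimeter_bounds : 0 < perimeter m g <= total_length.
Proof.
  rewrite perimeter_psum. split.
  - apply psum_pos; [apply m_pos |]. intros k Hk. apply arc_length_bounds; auto.
  - apply psum_le. intros k Hk. apply arc_length_bounds; auto.
Qed.

Lemma C1_domain_smooth : C1_domain Om -> smooth_boundary.
Proof.
  intros HC p Hp. destruct (HC p Hp) as (r & a & b & f & f' & Hr & Hab & Hf & _ & Hloc).
  assert (Hpp : vnorm (vsub p p) < r) by (apply vnorm_lt; auto; unfold dot, vsub; simpl; nra).
  assert (Hiso : forall x, Rabs (a * fst x + b * snd x) <= vnorm x /\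
                      Rabs (- b * fst x + a * snd x) <= vnorm x).
  { intros x. split.
    - replace (a * fst x + b * snd x) with (dot x (a, b)) by vec_ring.
      eapply Rle_trans; [apply cauchy_schwarz |].
      replace (vnorm (a, b)) with 1; [lra |]. unfold vnorm, dot; simpl.
      replace (a * a + b * b) with 1 by lra. rewrite sqrt_1; auto.
    - replace (- b * fst x + a * snd x) with (dot x (- b, a)) by vec_ring.
      eapply Rle_trans; [apply cauchy_schwarz |].
      replace (vnorm (- b, a)) with 1; [lra |]. unfold vnorm, dot; simpl.
      replace (- b * - b + a * a) with 1 by lra. rewrite sqrt_1; auto. }
  (* A value [f 0 < 0] would separate [p] from [Om], and [f 0 > 0] would put [p] in [Om]. *)
  assert (Hf0 : f 0 = 0).
  { destruct (Rtotal_order (f 0) 0) as [Hlt | [Heq | Hgt]]; auto; exfalso.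
    - destruct (continuity_pt_eps f 0 (derivable_continuous_pt _ _ (exist _ _ (Hf 0))) (- f 0 / 2)
        ltac:(lra)) as (d & Hd & Hs).
      destruct (common_scales (r :: d :: - f 0 / 2 :: nil))
        as (e & He & Hele); [simpl; repeat split; auto; lra |]. simpl in Hele.
      destruct (proj1 Hp e He) as (x & Hx & Hxp).
      apply Hloc in Hx; [| lra]. destruct (Hiso (vsub x p)) as [I1 I2].
      unfold vsub in I1, I2 at 1; simpl in I1, I2.
      specialize (Hs (a * (fst x - fst p) + b * (snd x - snd p))
        ltac:(rewrite Rminus_0_r; unfold vsub in *; simpl in *; lra)).
      apply Rabs_lt_between' in Hs. apply Rabs_le_between in I2.
      unfold vsub in *; simpl in *. lra.
    - apply (proj2 Hp). apply Hloc; auto.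
      replace (a * (fst p - fst p) + b * (snd p - snd p)) with 0 by ring. lra. }
  set (c := f' 0). set (q := sqrt (1 + c * c)).
  assert (Hq : q * q = 1 + c * c) by (apply sqrt_sqrt; nra).
  assert (Hq0 : 0 < q) by (apply sqrt_lt_R0; nra).
  (* The graph normal [(-c, 1) / q], written back from the rotated frame with axes [(a, b)] and
     [(-b, a)]. *)
  exists ((- c * a - b) / q, (- c * b + a) / q). split.
  - unfold vnorm, dot; simpl.
    replace ((- c * a - b) / q * ((- c * a - b) / q) + (- c * b + a) / q * ((- c * b + a) / q))
      with ((1 + c * c) * (a ^ 2 + b ^ 2) / (q * q)) by (field; lra).
    rewrite Hab, Hq. replace ((1 + c * c) * 1 / (1 + c * c)) with 1 by (field; nra).
    apply sqrt_1.
  - intros v Hv. set (vu := a * fst v + b * snd v). set (vw := - b * fst v + a * snd v).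
    assert (Hneg : 0 < c * vu - vw).
    { apply Rmult_lt_compat_r with (r := q) in Hv; auto. unfold dot in Hv; simpl in Hv.
      replace ((fst v * ((- c * a - b) / q) + snd v * ((- c * b + a) / q)) * q) with
        (- (c * vu - vw)) in Hv by (unfold vu, vw; field; lra). lra. }
    assert (Hd : derivable_pt_lim (fun s => f (vu * s) - vw * s) 0 (c * vu - vw)).
    { apply derivable_pt_lim_minus.
      - apply (derivable_pt_lim_comp (fun s => vu * s) f).
        + apply derivable_pt_lim_linear.
        + rewrite Rmult_0_r. apply Hf.
      - apply derivable_pt_lim_linear. }
    destruct (increasing_near _ _ _ Hd Hneg) as (d & Hd0 & Hinc).
    assert (Hvn := vnorm_nonneg v).
    assert (Hd1 : 0 < r / (vnorm v + 1)) by (apply Rdiv_lt_0_compat; lra).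
    destruct (common_scale d (r / (vnorm v + 1)) Hd0 Hd1) as (e & He & M1 & M2).
    exists e. split; auto. intros s Hs.
    apply Hloc.
    + replace (vsub (vadd p (vscale s v)) p) with (vscale s v) by vec_ring.
      rewrite vnorm_vscale, Rabs_pos_eq by lra.
      assert (Hsr : s < r / (vnorm v + 1)) by lra.
      apply Rlt_div_r in Hsr; [| lra]. nra.
    + destruct (Hinc s ltac:(lra)) as [H _]. rewrite Rplus_0_l, !Rmult_0_r, Hf0 in H.
      unfold vadd, vscale; simpl.
      replace (a * (fst p + s * fst v - fst p) + b * (snd p + s * snd v - snd p)) with (vu * s)
        by (unfold vu; ring).
      replace (- b * (fst p + s * fst v - fst p) + a * (snd p + s * snd v - snd p)) with (vw * s)
        by (unfold vw; ring). lra.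
Qed.

Lemma phi_max_curvature_case y0 : C1_domain Om -> (exists x, Om x) -> reg_bd Om m g y0 ->
  (forall y, reg_bd Om m g y -> kappa y <= kappa y0) ->
  phi Om nu kappa y0 >= area Om / perimeter m g -> is_disk Om.
Proof.
  intros HC Hne Hy0 Hmax Hphi. assert (Hsm := C1_domain_smooth HC).
  set (k0 := kappa y0) in *.
  assert (Hle : forall k t, (k < m)%nat -> 0 < t < 1 -> curv k t <= k0).
  { intros k t Hk Ht. rewrite <- kappa_curv by auto. apply Hmax, arc_interior_reg; auto. }
  assert (H1 := length_le_curvature_bound k0 Hsm Hle).
  assert (H2 := total_length_pos). assert (H3 := total_sweep_nonneg).
  assert (Hk0 : 0 < k0).
  { apply Rnot_le_lt. intros Hn. assert (k0 * total_sweep <= 0 * total_sweep)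
      by (apply Rmult_le_compat_r; auto). lra. }
  apply (rigidity k0); auto.
  destruct perimeter_bounds as [Hp1 Hp2]. assert (H4 := total_sweep_le_area Hsm).
  assert (Hphi2 : phi Om nu kappa y0 <= / (2 * k0)).
  { unfold phi. fold k0. set (l := cut_value Om nu y0).
    apply Rmult_le_reg_r with (2 * k0); [lra |].
    replace (/ (2 * k0) * (2 * k0)) with 1 by (field; lra).
    (* The gap in the inequality is exactly this square, so the bound holds for any real [l],
       whatever the cut value is. *)
    assert (0 <= (1 - l * k0) ^ 2) by apply pow2_ge_0. lra. }
  assert (H5 : area Om / perimeter m g <= / (2 * k0)) by lra.
  apply Rmult_le_compat_r with (r := 2 * k0 * perimeter m g) in H5;
    [| apply Rmult_le_pos; lra].
  replace (area Om / perimeter m g * (2 * k0 * perimeter m g)) with (k0 * (2 * area Om)) in H5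
    by (field; lra).
  replace (/ (2 * k0) * (2 * k0 * perimeter m g)) with (perimeter m g) in H5 by (field; lra).
  assert (k0 * total_sweep <= k0 * (2 * area Om)) by (apply Rmult_le_compat_l; lra). lra.
Qed.

(** * The case of constant [phi] *)

Lemma dist_bd_glb x : (forall z, boundary2 Om z -> dist_bd Om x <= vnorm (vsub x z)) /\
  (forall b, (forall z, boundary2 Om z -> b <= vnorm (vsub x z)) -> b <= dist_bd Om x).
Proof.
  unfold dist_bd, Rinf.
  set (E := fun d => exists z, boundary2 Om z /\ - d = vnorm (vsub x z)).
  destruct (Rsup_is_lub E) as [HU HL].
  - exists (- vnorm (vsub x (g 0 0))), (g 0%nat 0). split; [| ring].
    apply arc_boundary; [apply m_pos | lra].
  - exists 0. intros d (z & _ & Hd). assert (H := vnorm_nonneg (vsub x z)). lra.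
  - split.
    + intros z Hz. assert (H : E (- vnorm (vsub x z))) by (exists z; split; auto; ring).
      apply HU in H. lra.
    + intros b Hb. assert (H : Rsup E <= - b); [| lra].
      apply HL. intros d (z & Hz & Hd). specialize (Hb z Hz). lra.
Qed.

(** The equation [dist_bd = u] of the cut value, reduced to its substantial half: [g k t] itself is
    at distance [u] from the centre. This form is monotone in [u], passes to limits and makes sense
    at corners. *)
Definition inner_touch (k : nat) (t u : R) : Prop :=
  forall z, boundary2 Om z -> u <= vnorm (vsub z (vsub (g k t) (vscale u (nrm k t)))).

Lemma nrm_norm k t : (k < m)%nat -> 0 <= t <= 1 -> vnorm (nrm k t) = 1.
Proof. intros Hk Ht. unfold vnorm. rewrite nrm_unit by auto. apply sqrt_1. Qed.

Lemma dist_bd_inner_touch k t u : (k < m)%nat -> 0 <= t <= 1 -> 0 <= u ->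
  dist_bd Om (vsub (g k t) (vscale u (nrm k t))) = u <-> inner_touch k t u.
Proof.
  intros Hk Ht Hu. destruct (dist_bd_glb (vsub (g k t) (vscale u (nrm k t)))) as [H1 H2].
  split.
  - intros E z Hz. rewrite vnorm_vsub_sym, <- E at 1. apply H1; auto.
  - intros Hin. apply Rle_antisym.
    + eapply Rle_trans; [apply H1, (arc_boundary k t); auto |].
      replace (vsub (vsub (g k t) (vscale u (nrm k t))) (g k t)) with (vscale (- u) (nrm k t))
        by vec_ring.
      rewrite vnorm_vscale, nrm_norm, Rabs_Ropp, Rabs_pos_eq by auto. lra.
    + apply H2. intros z Hz. rewrite vnorm_vsub_sym. apply Hin; auto.
Qed.

(** Balls tangent at the same point from the same side are nested. *)
Lemma inner_touch_mono k t u u' : (k < m)%nat -> 0 <= t <= 1 -> 0 <= u' <= u ->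
  inner_touch k t u -> inner_touch k t u'.
Proof.
  intros Hk Ht Hu Hin z Hz. specialize (Hin z Hz).
  assert (H := vnorm_triangle z (vsub (g k t) (vscale u' (nrm k t)))
    (vsub (g k t) (vscale u (nrm k t)))).
  replace (vsub (vsub (g k t) (vscale u' (nrm k t))) (vsub (g k t) (vscale u (nrm k t))))
    with (vscale (u - u') (nrm k t)) in H by vec_ring.
  rewrite vnorm_vscale, nrm_norm, Rabs_pos_eq in H by (auto; lra). lra.
Qed.

(** The tangent ball contains no boundary point and, by the inward segment, at least one point of
    [Om]. *)
Lemma inner_touch_ball k t u : (k < m)%nat -> 0 < t < 1 -> 0 < u -> inner_touch k t u ->
  forall x, vnorm (vsub x (vsub (g k t) (vscale u (nrm k t)))) < u -> Om x.
Proof.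
  intros Hk Ht Hu Hin. destruct (HNU k t Hk Ht) as (_ & _ & d & Hd & Hs).
  rewrite nu_nrm in Hs by auto.
  destruct (common_scale (d / 2) u) as (s & H3 & H1 & H2); [lra | lra |].
  apply boundary_free_ball_inside with (vsub (g k t) (vscale s (nrm k t))); auto.
  - replace (vsub (vsub (g k t) (vscale s (nrm k t))) (vsub (g k t) (vscale u (nrm k t))))
      with (vscale (u - s) (nrm k t)) by vec_ring.
    rewrite vnorm_vscale, nrm_norm, Rabs_pos_eq by (auto; lra). lra.
  - apply Hs. lra.
Qed.

(** The supremum is finite because the centres lie in the bounded set [Om], and it is attained
    because [inner_touch] is closed in [u]. *)
Lemma cut_value_spec k t : (k < m)%nat -> 0 < t < 1 ->
  0 <= cut_value Om nu (g k t) /\ inner_touch k t (cut_value Om nu (g k t)) /\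
  forall u, 0 <= u -> inner_touch k t u -> u <= cut_value Om nu (g k t).
Proof.
  intros Hk Ht. assert (Ht' : 0 <= t <= 1) by lra.
  unfold cut_value. rewrite nu_nrm by auto.
  set (E := fun u => 0 <= u /\ dist_bd Om (vsub (g k t) (vscale u (nrm k t))) = u).
  assert (HE : forall u, E u <-> 0 <= u /\ inner_touch k t u).
  { intros u. unfold E. split; intros [Hu H]; split; auto; apply dist_bd_inner_touch; auto. }
  assert (HE0 : E 0).
  { apply HE. split; [lra |]. intros z Hz. apply vnorm_nonneg. }
  destruct HB as [M HM].
  destruct (Rsup_is_lub E) as [HU HL].
  - exists 0; auto.
  - exists (Rabs M + vnorm (g k t)). intros u Hu. apply HE in Hu as [[Hu | <-] Hin].
    + assert (Hc : Om (vsub (g k t) (vscale u (nrm k t)))).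
      { apply (inner_touch_ball k t u); auto. apply vnorm_lt; auto.
        unfold dot, vsub; simpl. nra. }
      apply HM in Hc. assert (H := vnorm_vadd_le (g k t) (vscale (-1) (vsub (g k t) (vscale u (nrm k t))))).
      replace (vadd (g k t) (vscale (-1) (vsub (g k t) (vscale u (nrm k t)))))
        with (vscale u (nrm k t)) in H by vec_ring.
      rewrite !vnorm_vscale, nrm_norm, Rabs_pos_eq in H by (auto; lra).
      rewrite (Rabs_left (-1)) in H by lra. assert (H1 := Rle_abs M). lra.
    + assert (H1 := Rabs_pos M). assert (H2 := vnorm_nonneg (g k t)). lra.
  - assert (H0 : 0 <= Rsup E) by (apply HU; auto).
    split; auto. split.
    + intros z Hz. apply Rnot_lt_le. intros Hlt.
      set (l := Rsup E) in *. set (q := vnorm (vsub z (vsub (g k t) (vscale l (nrm k t))))) in *.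
      assert (Hle : l <= (l + q) / 2); [| lra].
      apply HL. intros u Hu. assert (Hul := HU u Hu). apply HE in Hu as [Hu Hin].
      specialize (Hin z Hz).
      assert (H := vnorm_triangle z (vsub (g k t) (vscale l (nrm k t)))
        (vsub (g k t) (vscale u (nrm k t)))). fold q in H.
      replace (vsub (vsub (g k t) (vscale l (nrm k t))) (vsub (g k t) (vscale u (nrm k t))))
        with (vscale (- (l - u)) (nrm k t)) in H by vec_ring.
      rewrite vnorm_vscale, nrm_norm, Rabs_Ropp, Rabs_pos_eq in H by (auto; lra). lra.
    + intros u Hu Hin. apply HU, HE. auto.
Qed.

(** The squared distance from the centre of the ball to [g k s] is least at [s = t]; its second
    derivative there is [2 * dot (g1 k t) (g1 k t) * (1 - u * curv k t)]. *)
Lemma inner_touch_curvature k t u : (k < m)%nat -> 0 < t < 1 -> 0 <= u ->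
  inner_touch k t u -> u * curv k t <= 1.
Proof.
  intros Hk Ht Hu Hin. set (c := vsub (g k t) (vscale u (nrm k t))).
  set (F := fun s => dot (vsub (g k s) c) (vsub (g k s) c)).
  assert (Hv : forall s, vder (fun s => vsub (g k s) c) s (g1 k s)).
  { intros s. replace (g1 k s) with (vsub (g1 k s) (0, 0))
      by (unfold vsub; rewrite (surjective_pairing (g1 k s)); simpl; f_equal; ring).
    apply (vder_vsub (g k) (fun _ => c)); [apply arc_vder; auto | apply vder_const]. }
  assert (Hd : 0 <= dot (g2 k t) (vsub (g k t) c) + dot (g1 k t) (g1 k t) +
                  (dot (g1 k t) (g1 k t) + dot (vsub (g k t) c) (g2 k t))).
  { apply (second_derivative_at_min F
      (fun s => dot (g1 k s) (vsub (g k s) c) + dot (vsub (g k s) c) (g1 k s)) 0 1 t); auto.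
    - intros s Hs. apply (derivable_pt_lim_dot (fun s => vsub (g k s) c) (fun s => vsub (g k s) c));
        apply Hv.
    - apply (derivable_pt_lim_plus (fun s => dot (g1 k s) (vsub (g k s) c))
        (fun s => dot (vsub (g k s) c) (g1 k s)));
        [apply (derivable_pt_lim_dot (g1 k) (fun s => vsub (g k s) c))
        |apply (derivable_pt_lim_dot (fun s => vsub (g k s) c) (g1 k))];
        auto; apply arc_vder1; auto.
    - intros s Hs. unfold F. rewrite <- !vnorm_sq.
      assert (H := Hin (g k s) ltac:(apply arc_boundary; auto; lra)). fold c in H.
      replace (vsub (g k t) c) with (vscale u (nrm k t))
        by (unfold c, vsub, vscale; simpl; f_equal; ring).
      rewrite vnorm_vscale, nrm_norm, Rabs_pos_eq by (auto; lra). nra. }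
  replace (vsub (g k t) c) with (vscale u (nrm k t)) in Hd
    by (unfold c, vsub, vscale; simpl; f_equal; ring).
  assert (Hg := dot_self_pos _ (arc_regular k t Hk ltac:(lra))).
  assert (Hcurv : dot (g2 k t) (nrm k t) = - curv k t * dot (g1 k t) (g1 k t)).
  { unfold curv, signed_curvature. fold (nrm k t). field. lra. }
  replace (dot (g2 k t) (vscale u (nrm k t)) + dot (g1 k t) (g1 k t) +
    (dot (g1 k t) (g1 k t) + dot (vscale u (nrm k t)) (g2 k t))) with
    (2 * (u * dot (g2 k t) (nrm k t) + dot (g1 k t) (g1 k t))) in Hd by vec_ring.
  rewrite Hcurv in Hd.
  replace (2 * (u * (- curv k t * dot (g1 k t) (g1 k t)) + dot (g1 k t) (g1 k t))) with
    (2 * dot (g1 k t) (g1 k t) * (1 - u * curv k t)) in Hd by ring.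
  apply Rnot_lt_le. intros Hlt. nra.
Qed.

Lemma nearest_boundary_point x : exists k t, (k < m)%nat /\ 0 <= t <= 1 /\
  forall z, boundary2 Om z -> vnorm (vsub x (g k t)) <= vnorm (vsub x z).
Proof.
  assert (H : forall n, (0 < n <= m)%nat -> exists k t, (k < n)%nat /\ 0 <= t <= 1 /\
    forall j s, (j < n)%nat -> 0 <= s <= 1 -> vnorm (vsub x (g k t)) <= vnorm (vsub x (g j s))).
  { induction n as [|n IH]; intros Hn; [lia |].
    destruct (continuity_ab_min (fun s => vnorm (vsub x (g n s))) 0 1 ltac:(lra)) as (t & Ht & Ht01).
    { intros s Hs. apply continuity_pt_vnorm, vcont_vsub; [apply vcont_const |].
      apply arc_vcont. lia. }
    destruct (Nat.eq_dec n 0) as [-> | Hn0].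
    { exists 0%nat, t. repeat split; try lia; try lra. intros j s Hj Hs.
      replace j with 0%nat by lia. auto. }
    destruct (IH ltac:(lia)) as (k & t' & Hk & Ht' & Hmin).
    destruct (Rle_dec (vnorm (vsub x (g k t'))) (vnorm (vsub x (g n t)))) as [Hle | Hgt].
    - exists k, t'. repeat split; try lia; try lra. intros j s Hj Hs.
      destruct (Nat.eq_dec j n) as [-> | Hne]; [| apply Hmin; auto; lia].
      eapply Rle_trans; [exact Hle |]. apply Ht; auto.
    - exists n, t. repeat split; try lia; try lra. intros j s Hj Hs.
      destruct (Nat.eq_dec j n) as [-> | Hne]; [apply Ht; auto |].
      eapply Rle_trans; [| apply Hmin; auto; lia]. lra. }
  destruct (H m ltac:(generalize m_pos; lia)) as (k & t & Hk & Ht & Hmin).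
  exists k, t. repeat split; auto; try lra. intros z Hz.
  destruct (boundary_arc z Hz) as (j & s & Hj & Hs & ->). auto.
Qed.

(** The ball around [x] up to its nearest boundary point and the exterior ball at that point are
    disjoint, yet both touch it; their centres are thus [d + r] apart and aligned with it. The
    argument covers corners, where differentiating the distance along one arc would not. *)
Lemma nearest_point_on_normal x : Om x -> exists k t d, (k < m)%nat /\ 0 <= t <= 1 /\ 0 < d /\
  d = vnorm (vsub x (g k t)) /\ x = vsub (g k t) (vscale d (nrm k t)) /\ inner_touch k t d /\
  forall z, boundary2 Om z -> d <= vnorm (vsub x z).
Proof.
  intros Hx. destruct (nearest_boundary_point x) as (k & t & Hk & Ht & Hmin).
  set (y := g k t) in *. set (d := vnorm (vsub x y)) in *.
  assert (Hd : 0 < d).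
  { apply vnorm_pos. intros E. apply (arc_boundary k t Hk Ht). fold y.
    replace y with x; auto. apply vsub_eq_0, E. }
  assert (Hball : forall w, vnorm (vsub w x) < d -> Om w).
  { apply boundary_free_ball_inside with x; auto.
    - intros z Hz. rewrite vnorm_vsub_sym. auto.
    - rewrite vsub_diag. unfold vnorm, dot; simpl. replace (0 * 0 + 0 * 0) with 0 by ring. rewrite sqrt_0; auto. }
  destruct exterior_ball_exists as (r & Hr & Hext).
  assert (Hsep : d + r <= vnorm (vsub x (vadd y (vscale r (nrm k t))))).
  { apply separated_balls; auto. intros w Hw1 Hw2. apply (Hext k t Hk Ht w Hw2).
    apply subset_closure; auto. }
  assert (Hsq : (d + r) * (d + r) <= dot (vsub x (vadd y (vscale r (nrm k t))))
                                    (vsub x (vadd y (vscale r (nrm k t))))).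
  { rewrite <- vnorm_sq. apply Rmult_le_compat; lra. }
  assert (Hu := nrm_unit k t Hk Ht). assert (Hdd := vnorm_sq (vsub x y)). fold d in Hdd.
  replace (dot (vsub x (vadd y (vscale r (nrm k t)))) (vsub x (vadd y (vscale r (nrm k t)))))
    with (dot (vsub x y) (vsub x y) - 2 * r * dot (vsub x y) (nrm k t) + r * r * dot (nrm k t) (nrm k t))
    in Hsq by vec_ring.
  rewrite <- Hdd, Hu in Hsq.
  assert (Hdn : dot (vsub x y) (nrm k t) <= - d).
  { apply Rmult_le_reg_l with (2 * r); [lra |]. lra. }
  assert (Hz : dot (vadd (vsub x y) (vscale d (nrm k t))) (vadd (vsub x y) (vscale d (nrm k t))) = 0).
  { apply Rle_antisym; [| apply dot_self_nonneg].
    replace (dot (vadd (vsub x y) (vscale d (nrm k t))) (vadd (vsub x y) (vscale d (nrm k t))))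
      with (dot (vsub x y) (vsub x y) + 2 * d * dot (vsub x y) (nrm k t) + d * d * dot (nrm k t) (nrm k t))
      by vec_ring.
    rewrite <- Hdd, Hu. assert (d * dot (vsub x y) (nrm k t) <= d * - d)
      by (apply Rmult_le_compat_l; lra). lra. }
  apply dot_self_0 in Hz.
  assert (Ex : x = vsub y (vscale d (nrm k t))).
  { rewrite (surjective_pairing x). set (n := nrm k t) in *. clearbody n y.
    unfold vadd, vsub, vscale in *; simpl in *. injection Hz; intros. f_equal; lra. }
  exists k, t, d. repeat split; auto; try lra.
  intros z Hz'. fold y. rewrite <- Ex, vnorm_vsub_sym. auto.
Qed.

Lemma phi_arc c k t : (forall y, reg_bd Om m g y -> phi Om nu kappa y = c) ->
  (k < m)%nat -> 0 < t < 1 -> exists l, 0 <= l /\ inner_touch k t l /\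
    (forall u, 0 <= u -> inner_touch k t u -> u <= l) /\
    l - / 2 * l ^ 2 * curv k t = c /\ l * curv k t <= 1.
Proof.
  intros Hphi Hk Ht. destruct (cut_value_spec k t Hk Ht) as (H1 & H2 & H3).
  exists (cut_value Om nu (g k t)). repeat split; auto.
  - rewrite <- (Hphi (g k t)) by (apply arc_interior_reg; auto).
    unfold phi. rewrite kappa_curv by auto. reflexivity.
  - apply inner_touch_curvature; auto.
Qed.

(** A point just inside the middle of an arc has its nearest boundary point away from all corners,
    which yields a regular point with positive cut value. *)
Lemma interior_point_near_arc : exists k t d, (k < m)%nat /\ 0 < t < 1 /\ 0 < d /\
  inner_touch k t d.
Proof.
  assert (Hm := m_pos). set (y := g 0%nat (1 / 2)).
  assert (Hrho : forall n, (n <= m)%nat -> exists rho, 0 < rho /\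
    forall k, (k < n)%nat -> rho <= vnorm (vsub y (g k 1))).
  { induction n as [|n IH]; intros Hn.
    - exists 1. split; [lra |]. intros; lia.
    - destruct (IH ltac:(lia)) as (rho & Hr & Hlow).
      assert (Hp : 0 < vnorm (vsub y (g n 1))).
      { apply vnorm_pos. intros E. apply (arc_interior_reg 0 (1 / 2) Hm ltac:(lra)).
        exists n. split; [lia |]. apply vsub_eq_0, E. }
      exists (Rmin rho (vnorm (vsub y (g n 1)))). split; [apply Rmin_glb_lt; auto |].
      intros k Hk. destruct (Nat.eq_dec k n) as [-> | Hne]; [apply Rmin_r |].
      eapply Rle_trans; [apply Rmin_l | apply Hlow; lia]. }
  destruct (Hrho m (le_n m)) as (rho & Hr & Hlow).
  destruct (HNU 0%nat (1 / 2) Hm ltac:(lra)) as (Hn1 & _ & d & Hd & Hs).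
  (* The nearest boundary point will be within [2 * s] of [y], less than the distance [rho] to the
     corners. *)
  destruct (common_scale (d / 2) (rho / 4)) as (s & H3 & H1 & H2); [lra | lra |].
  specialize (Hs s ltac:(lra)). fold y in Hs, Hn1.
  set (x := vsub y (vscale s (nu y))) in *.
  assert (Hxy : vnorm (vsub y x) = s).
  { replace (vsub y x) with (vscale s (nu y)) by (unfold x, vsub, vscale; simpl; f_equal; ring).
    rewrite vnorm_vscale, Hn1, Rabs_pos_eq by lra. ring. }
  destruct (nearest_point_on_normal x Hs) as (k & t & e & Hk & Ht & He & Ee & _ & Hin & Hmin).
  assert (Hes : e <= s).
  { rewrite <- Hxy, vnorm_vsub_sym. apply Hmin. apply arc_boundary; auto; lra. }
  assert (Hfar : forall j, (j < m)%nat -> g k t <> g j 1).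
  { intros j Hj E. assert (H := vnorm_triangle y x (g k t)). rewrite <- Ee, Hxy, E in H.
    specialize (Hlow j Hj). lra. }
  exists k, t, e. repeat split; auto.
  - destruct Ht as [[Ht0 | <-] _]; auto. exfalso.
    destruct (nx_surjective k Hk) as (j & Hj & <-). apply (Hfar j Hj), arc_glue; auto.
  - destruct Ht as [_ [Ht0 | ->]]; auto. exfalso. apply (Hfar k); auto.
Qed.

(** As [l * curv <= 1], the value of [phi] is at least [l / 2], and some [l] is positive. *)
Lemma phi_const_pos c : (forall y, reg_bd Om m g y -> phi Om nu kappa y = c) -> 0 < c.
Proof.
  intros Hphi. destruct interior_point_near_arc as (k & t & d & Hk & Ht & Hd & Hin).
  destruct (phi_arc c k t Hphi Hk Ht) as (l & Hl & _ & Hmax & Hc & Hcurv).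
  specialize (Hmax d ltac:(lra) Hin).
  assert (l * (l * curv k t) <= l * 1) by (apply Rmult_le_compat_l; lra). lra.
Qed.

(** With [curv >= -K] a small cut value would make [phi] small: [l < d <= 1] gives
    [phi <= l * (1 + K) < c]. *)
Lemma uniform_inner_touch c : (forall y, reg_bd Om m g y -> phi Om nu kappa y = c) ->
  exists d, 0 < d /\ forall k t, (k < m)%nat -> 0 < t < 1 -> inner_touch k t d.
Proof.
  intros Hphi. assert (Hc := phi_const_pos c Hphi).
  destruct (finite_upper_bound (fun k t => - curv k t) m) as (K & HK & Hb).
  { intros k t Hk Ht. apply continuity_pt_opp, curv_continuous; auto. }
  destruct (common_scale 1 (c / (1 + K))) as (d & H3 & H1 & H2); [lra | apply Rdiv_lt_0_compat; lra |].
  exists d. split; auto. intros k t Hk Ht.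
  destruct (phi_arc c k t Hphi Hk Ht) as (l & Hl & Hin & _ & Heq & _).
  apply inner_touch_mono with l; auto; try lra. split; [lra |].
  apply Rnot_lt_le. intros Hlt.
  specialize (Hb k t Hk ltac:(lra)). simpl in Hb.
  apply Rle_div_r in H2; [| lra].
  assert (Hl2 : l * l * (- curv k t) <= l * 1 * K).
  { apply Rle_trans with (l * l * K); [apply Rmult_le_compat_l; nra |].
    apply Rmult_le_compat_r; [lra |]. apply Rmult_le_compat_l; lra. }
  assert (l * (1 + K) < d * (1 + K)) by (apply Rmult_lt_compat_r; lra).
  assert (0 <= l * K) by (apply Rmult_le_pos; lra). simpl in Heq. lra.
Qed.

(** The inner balls of radius [d] pass to the limit at corners, along either arc, and an open ball
    touching the boundary point contains every short step in a strictly inward direction. That the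
    two normals at a corner then agree comes from [smooth_inner_cone]. *)
Lemma phi_const_smooth c : (forall y, reg_bd Om m g y -> phi Om nu kappa y = c) ->
  smooth_boundary.
Proof.
  intros Hphi p Hp. destruct (uniform_inner_touch c Hphi) as (d & Hd & Hin).
  destruct (boundary_arc p Hp) as (k & t & Hk & Ht & ->).
  exists (nrm k t). split; [apply nrm_norm; auto |].
  assert (Hball : forall x, vnorm (vsub x (vsub (g k t) (vscale d (nrm k t)))) < d -> Om x).
  { intros x Hx.
    set (F := fun s => vsub x (vsub (g k s) (vscale d (nrm k s)))).
    assert (HF : vcont F t).
    { apply vcont_vsub; [apply vcont_const | apply vcont_vsub; [apply arc_vcont; auto |]].
      apply vcont_vscale; [apply continuity_pt_cst | apply nrm_vcont; auto]. }
    destruct (continuity_pt_eps _ _ (continuity_pt_vnorm _ _ HF) (d - vnorm (F t)))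
      as (e & He & Hs); [unfold F; lra |].
    destruct (interior_parameter_near t e Ht He) as (s & Hs1 & Hs2).
    apply (inner_touch_ball k s d Hk Hs1 Hd (Hin k s Hk Hs1)).
    specialize (Hs s Hs2). apply Rabs_lt_between' in Hs. unfold F in Hs. lra. }
  intros v Hv. assert (Hvv := dot_self_nonneg v).
  assert (Hs0 : 0 < - 2 * d * dot v (nrm k t) / (dot v v + 1)).
  { apply Rdiv_lt_0_compat; [| lra]. assert (0 < d * - dot v (nrm k t)) by
      (apply Rmult_lt_0_compat; lra). lra. }
  eexists. split; [exact Hs0 |]. intros s [Hs1 Hs2]. apply Hball.
  apply vnorm_lt; auto.
  replace (dot (vsub (vadd (g k t) (vscale s v)) (vsub (g k t) (vscale d (nrm k t))))
               (vsub (vadd (g k t) (vscale s v)) (vsub (g k t) (vscale d (nrm k t)))))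
    with (s * (s * dot v v) + s * (2 * d * dot v (nrm k t)) + d * d * dot (nrm k t) (nrm k t))
    by vec_ring.
  rewrite nrm_unit by auto.
  apply Rmult_lt_compat_r with (r := dot v v + 1) in Hs2; [| lra].
  replace (- 2 * d * dot v (nrm k t) / (dot v v + 1) * (dot v v + 1)) with
    (- (2 * d * dot v (nrm k t))) in Hs2 by (field; lra).
  assert (s * (s * dot v v + 2 * d * dot v (nrm k t)) < s * 0) by (apply Rmult_lt_compat_l; lra).
  lra.
Qed.

(* The cut value expressed through the curvature when [phi] is constant equal to
   [c]: the smaller root of [l - l^2 curv / 2 = c], in a form without division by
   the curvature. *)
Definition cut_of_curv (c : R) (k : nat) (t : R) : R := 2 * c / (1 + sqrt (1 - 2 * c * curv k t)).

(** On the open arc the expression is the square of [1 - l * curv]; continuity carries the sign to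
    the ends. *)
Lemma curv_le_phi_const c k t : (forall y, reg_bd Om m g y -> phi Om nu kappa y = c) ->
  (k < m)%nat -> 0 <= t <= 1 -> 0 <= 1 - 2 * c * curv k t.
Proof.
  intros Hphi Hk Ht.
  assert (Hint : forall s, 0 < s < 1 -> 0 <= 1 - 2 * c * curv k s).
  { intros s Hs. destruct (phi_arc c k s Hphi Hk Hs) as (l & Hl & _ & _ & Heq & _).
    rewrite <- Heq. replace (1 - 2 * (l - / 2 * l ^ 2 * curv k s) * curv k s) with
      ((1 - l * curv k s) ^ 2) by field. apply pow2_ge_0. }
  apply Rnot_lt_le. intros Hlt.
  assert (Hc : continuity_pt (fun s => 1 - 2 * c * curv k s) t).
  { apply continuity_pt_minus; [apply continuity_pt_cst |].
    apply continuity_pt_mult; [apply continuity_pt_cst |].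
    apply curv_continuous; auto. }
  destruct (continuity_pt_eps _ _ Hc (- (1 - 2 * c * curv k t)) ltac:(lra)) as (d & Hd & Hs).
  destruct (interior_parameter_near t d Ht Hd) as (s & Hs1 & Hs2).
  specialize (Hs s Hs2). assert (Hp := Hint s Hs1). apply Rabs_lt_between' in Hs. lra.
Qed.

Lemma cut_of_curv_spec c k t : (forall y, reg_bd Om m g y -> phi Om nu kappa y = c) ->
  (k < m)%nat -> 0 <= t <= 1 -> let l := cut_of_curv c k t in
  0 < l <= 2 * c /\ l - / 2 * l ^ 2 * curv k t = c /\ l * curv k t <= 1.
Proof.
  intros Hphi Hk Ht l. assert (Hc := phi_const_pos c Hphi).
  assert (H0 := curv_le_phi_const c k t Hphi Hk Ht).
  set (q := sqrt (1 - 2 * c * curv k t)) in *.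
  assert (Hq0 : 0 <= q) by apply sqrt_pos.
  assert (Hq : q * q = 1 - 2 * c * curv k t) by (apply sqrt_sqrt; auto).
  assert (El : l * (1 + q) = 2 * c) by (unfold l, cut_of_curv; fold q; field; lra).
  assert (Hl : 0 < l) by (unfold l, cut_of_curv; fold q; apply Rdiv_lt_0_compat; lra).
  assert (Ek : l * curv k t = 1 - q).
  { apply Rmult_eq_reg_r with (1 + q); [| lra].
    replace (l * curv k t * (1 + q)) with (l * (1 + q) * curv k t) by ring. rewrite El.
    replace ((1 - q) * (1 + q)) with (1 - q * q) by ring. rewrite Hq. ring. }
  split; [| split].
  - split; auto. assert (0 <= l * q) by (apply Rmult_le_pos; lra). lra.
  - replace (/ 2 * l ^ 2 * curv k t) with (/ 2 * l * (l * curv k t)) by ring. rewrite Ek.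
    replace c with (l * (1 + q) / 2) by lra. field.
  - lra.
Qed.

(** The focal bound [l * curv <= 1] makes the square root equal to [1 - l * curv], which singles out
    the root defining [cut_of_curv] as the cut value. *)
Lemma inner_touch_le_cut c k t u : (forall y, reg_bd Om m g y -> phi Om nu kappa y = c) ->
  (k < m)%nat -> 0 < t < 1 -> 0 <= u -> inner_touch k t u -> u <= cut_of_curv c k t.
Proof.
  intros Hphi Hk Ht Hu Hin. assert (Hc := phi_const_pos c Hphi).
  destruct (phi_arc c k t Hphi Hk Ht) as (l & Hl & _ & Hmax & Heq & Hle).
  replace (cut_of_curv c k t) with l; [auto |].
  assert (H0 := curv_le_phi_const c k t Hphi Hk ltac:(lra)).
  assert (Hq0 := sqrt_pos (1 - 2 * c * curv k t)).
  assert (Hq : sqrt (1 - 2 * c * curv k t) = 1 - l * curv k t).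
  { replace (1 - 2 * c * curv k t) with ((1 - l * curv k t) * (1 - l * curv k t))
      by (rewrite <- Heq; field). apply sqrt_square. lra. }
  unfold cut_of_curv. apply Rmult_eq_reg_r with (1 + sqrt (1 - 2 * c * curv k t)); [| lra].
  replace (2 * c / (1 + sqrt (1 - 2 * c * curv k t)) * (1 + sqrt (1 - 2 * c * curv k t)))
    with (2 * c) by (field; lra).
  rewrite Hq, <- Heq. field.
Qed.

Lemma cut_of_curv_continuous c k t : (k < m)%nat -> 0 <= t <= 1 ->
  0 <= 1 - 2 * c * curv k t -> continuity_pt (cut_of_curv c k) t.
Proof.
  intros Hk Ht H0. apply continuity_pt_mult; [apply continuity_pt_cst |].
  apply continuity_pt_inv.
  - apply continuity_pt_plus; [apply continuity_pt_cst |].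
    apply (continuity_pt_comp (fun s => 1 - 2 * c * curv k s) sqrt).
    + apply continuity_pt_minus; [apply continuity_pt_cst |].
      apply continuity_pt_mult; [apply continuity_pt_cst |].
      apply curv_continuous; auto.
    + apply continuity_pt_sqrt; auto.
  - assert (H := sqrt_pos (1 - 2 * c * curv k t)). lra.
Qed.

(** Arithmetic for one cell: [d] is the progress along the base, [u] the depth, [kap] and [v] are
    curvature and speed at its start, [en] and [et] the normal and tangential parts of the
    linearisation error. The factor [1 - u * kap] may turn negative just past the cut value [L], by
    at most [om * K], which the tolerances absorb. *)
Lemma tube_cell_bounds om c K V h d u L kap v en et : 0 < om -> 0 < c -> 0 <= K -> 0 < V ->
  0 <= d <= h -> h <= 1 -> 0 <= u <= L + om -> L * kap <= 1 -> Rabs kap <= K -> 0 < v <= V ->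
  Rabs en <= om * (1 + 2 * c) * h -> Rabs et <= om * (1 + 2 * c) * h ->
  let eps := om * (2 + 2 * c) * (1 + K * V) in let eps2 := eps * (1 + K * V) in
  - eps <= u - en <= L + eps /\
  - (eps2 * h) <= d * (1 - u * kap) * v + et <= h * (v + eps2) + - (h * kap * v) * (u - en).
Proof.
  intros Hom Hc HK HV Hd Hh Hu HL Hkap Hv Hen Het eps eps2.
  assert (HKV : 0 <= K * V) by (apply Rmult_le_pos; lra).
  set (w := om * (1 + 2 * c)) in *.
  assert (Hw : 0 < w) by (apply Rmult_lt_0_compat; lra).
  assert (Hwe : om + w + (om + w) * (K * V) = eps) by (unfold w, eps; ring).
  assert (H1 : 0 <= (om + w) * (K * V)) by (apply Rmult_le_pos; lra).
  assert (Hee : eps <= eps2).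
  { unfold eps2. assert (0 <= eps * (K * V)) by (apply Rmult_le_pos; lra). lra. }
  assert (Hwh : w * h <= w * 1) by (apply Rmult_le_compat_l; lra).
  apply Rabs_le_between in Hen. apply Rabs_le_between in Het. apply Rabs_le_between in Hkap.
  assert (Hlow : - (om * K) <= 1 - u * kap).
  { destruct (Rle_dec kap 0) as [Hn | Hp].
    - assert (0 <= u * - kap) by (apply Rmult_le_pos; lra).
      assert (0 <= om * K) by (apply Rmult_le_pos; lra). lra.
    - assert (u * kap <= (L + om) * kap) by (apply Rmult_le_compat_r; lra).
      assert (om * kap <= om * K) by (apply Rmult_le_compat_l; lra). lra. }
  assert (Hlow2 : forall x, 0 <= x <= h -> - (h * (om * (K * V))) <= x * (1 - u * kap) * v).
  { intros x Hx. assert (Hxv : 0 <= x * v <= h * V).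
    { split; [apply Rmult_le_pos; lra | apply Rmult_le_compat; lra]. }
    assert (H2 : x * v * - (om * K) <= x * v * (1 - u * kap)) by (apply Rmult_le_compat_l; lra).
    assert (H3 : x * v * (om * K) <= h * V * (om * K))
      by (apply Rmult_le_compat_r; [apply Rmult_le_pos; lra | lra]). lra. }
  assert (Heh : eps * h <= eps2 * h) by (apply Rmult_le_compat_r; lra).
  assert (Eeh : eps * h = om * h + w * h + h * (om * (K * V)) + h * (w * (K * V)))
    by (rewrite <- Hwe; ring).
  assert (P1 : 0 <= om * h) by (apply Rmult_le_pos; lra).
  assert (P2 : 0 <= h * (w * (K * V)))
    by (apply Rmult_le_pos; [lra | apply Rmult_le_pos; lra]).
  split; [lra |]. split.
  - assert (H2 := Hlow2 d Hd). lra.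
  - assert (H2 := Hlow2 (h - d) ltac:(lra)).
    assert (H3 : - (h * (w * (K * V))) <= h * (en * kap * v)).
    { replace (- (h * (w * (K * V)))) with (h * (- (w * (K * V)))) by ring.
      apply Rmult_le_compat_l; [lra |].
      assert (Ha : Rabs (en * kap * v) <= w * K * V).
      { rewrite !Rabs_mult. apply Rmult_le_compat; auto using Rabs_pos.
        - apply Rmult_le_pos; apply Rabs_pos.
        - apply Rmult_le_compat; auto using Rabs_pos; apply Rabs_le_between; lra.
        - rewrite Rabs_pos_eq; lra. }
      apply Rabs_le_between in Ha. lra. }
    lra.
Qed.

(* To first order in [h] the cell is a trapezoid on a base of length [h * speed k a],
   of height the cut value, whose width shrinks at rate [curv k a]: its area is
   [h * speed k a * phi]. *)
Lemma tube_cell_area c k K V om a h : (forall y, reg_bd Om m g y -> phi Om nu kappa y = c) ->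
  (k < m)%nat -> 0 < om -> 0 <= K -> 0 < V -> 0 <= a -> 0 < h <= 1 -> a + h <= 1 ->
  (forall t, 0 <= t <= 1 -> Rabs (curv k t) <= K) -> (forall t, 0 <= t <= 1 -> speed k t <= V) ->
  (forall t, a <= t <= a + h -> vnorm (vsub (g1 k t) (g1 k a)) <= om) ->
  (forall t, a <= t <= a + h ->
     vnorm (vsub (vscale (curv k t) (g1 k t)) (vscale (curv k a) (g1 k a))) <= om) ->
  (forall t, a <= t <= a + h -> cut_of_curv c k t <= cut_of_curv c k a + om) ->
  let eps := om * (2 + 2 * c) * (1 + K * V) in eps <= 1 ->
  area_le (fun x => exists s u, a <= s <= a + h /\ 0 <= u <= cut_of_curv c k s /\
      x = vsub (g k s) (vscale u (nrm k s)))
    (h * (c * speed k a + eps * (2 * V * (1 + c * K) + 2 * (1 + K * V) * (2 * c + 2)))).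
Proof.
  intros Hphi Hk Hom HK HV Ha Hh Hah HcK HsV Hm1 Hm2 Hm3 eps Heps.
  assert (Hc := phi_const_pos c Hphi).
  destruct (cut_of_curv_spec c k a Hphi Hk ltac:(lra)) as (HL1 & HL2 & HL3).
  set (L := cut_of_curv c k a) in *. set (kap := curv k a) in *.
  assert (Hkap : Rabs kap <= K) by (apply HcK; lra).
  set (v := speed k a) in *. assert (Hv : 0 < v <= V)
    by (split; [apply speed_pos; auto; lra | apply HsV; lra]).
  set (N := nrm k a). set (tau := vscale (/ v) (g1 k a)).
  assert (Htau : dot tau tau = 1).
  { unfold tau. replace (dot (vscale (/ v) (g1 k a)) (vscale (/ v) (g1 k a))) with
      (/ v * / v * dot (g1 k a) (g1 k a)) by vec_ring.
    rewrite <- vnorm_sq. fold (speed k a). fold v. field. lra. }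
  assert (HN : N = vscale (orient k) (rot tau)).
  { unfold N, nrm, unit_normal, tau, v, speed, vscale, rot; simpl. f_equal; unfold Rdiv; ring. }
  assert (Ho := orient_sq k).
  assert (HNN : dot N N = 1) by (apply nrm_unit; auto; lra).
  assert (Hdec : forall E, E = vadd (vscale (dot E N) N) (vscale (dot E tau) tau)).
  { intros E. rewrite HN. apply orthonormal_decomposition; auto. }
  set (eps2 := eps * (1 + K * V)).
  assert (HKV : 0 <= K * V) by (apply Rmult_le_pos; lra).
  assert (Heps0 : 0 < eps) by (unfold eps; repeat apply Rmult_lt_0_compat; lra).
  assert (HekV : - (eps * (K * V)) <= eps * (kap * v) <= eps * (K * V)).
  { assert (Hb : Rabs (kap * v) <= K * V).
    { rewrite Rabs_mult. apply Rmult_le_compat; auto using Rabs_pos. rewrite Rabs_pos_eq; lra. }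
    apply Rabs_le_between in Hb. split.
    - replace (- (eps * (K * V))) with (eps * - (K * V)) by ring.
      apply Rmult_le_compat_l; lra.
    - apply Rmult_le_compat_l; lra. }
  assert (Hdet : Rabs (det (vscale (-1) N) tau) = 1).
  { rewrite HN. replace (det (vscale (-1) (vscale (orient k) (rot tau))) tau) with
      (- orient k * dot tau tau) by vec_ring.
    rewrite Htau, Rmult_1_r, Rabs_Ropp. apply orient_abs. }
  eapply area_le_mono; [| | apply (trapezoid_area (g k a) (vscale (-1) N) tau (- eps) (L + eps)
    (- (eps2 * h)) (h * (v + eps2)) (- (h * kap * v))); auto; [lra | |]].
  - intros x (s & u & Hs & Hu & Ex).
    (* The parallel curve at depth [u] and its velocity; on the cell that velocity varies by at most
       [om + u * om], and [u <= 2 * c]. *)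
    set (Y := fun r => vsub (g k r) (vscale u (nrm k r))).
    set (Y' := fun r => vsub (g1 k r) (vscale u (vscale (curv k r) (g1 k r)))).
    assert (Hmv : vnorm (vsub (vsub (Y s) (Y a)) (vscale (s - a) (Y' a))) <=
              om * (1 + 2 * c) * (s - a)).
    { apply (vector_mean_value Y Y'); [lra | |].
      - intros r Hr. apply vder_vsub; [apply arc_vder; auto |].
        apply vder_vscale_const, nrm_vder; auto; lra.
      - intros r Hr. replace (vsub (Y' r) (Y' a)) with
          (vadd (vsub (g1 k r) (g1 k a))
            (vscale (- u) (vsub (vscale (curv k r) (g1 k r)) (vscale kap (g1 k a)))))
          by (unfold Y'; fold kap; unfold vadd, vsub, vscale; simpl; f_equal; ring).
        eapply Rle_trans; [apply vnorm_vadd_le |].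
        rewrite vnorm_vscale, Rabs_Ropp, Rabs_pos_eq by lra.
        assert (B1 := Hm1 r ltac:(lra)). assert (B2 := Hm2 r ltac:(lra)).
        destruct (cut_of_curv_spec c k s Hphi Hk ltac:(lra)) as ([_ B3] & _).
        set (n2 := vnorm (vsub (vscale (curv k r) (g1 k r)) (vscale kap (g1 k a)))) in *.
        assert (u * n2 <= (2 * c) * om) by (apply Rmult_le_compat; try lra; apply vnorm_nonneg).
        lra. }
    set (E := vsub (vsub (Y s) (Y a)) (vscale (s - a) (Y' a))) in *.
    assert (HE : vnorm E <= om * (1 + 2 * c) * h).
    { eapply Rle_trans; [exact Hmv |]. apply Rmult_le_compat_l; [| lra].
      apply Rmult_le_pos; lra. }
    assert (HEN : Rabs (dot E N) <= om * (1 + 2 * c) * h).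
    { eapply Rle_trans; [apply cauchy_schwarz |]. unfold vnorm at 2. rewrite HNN, sqrt_1. lra. }
    assert (HET : Rabs (dot E tau) <= om * (1 + 2 * c) * h).
    { eapply Rle_trans; [apply cauchy_schwarz |]. unfold vnorm at 2. rewrite Htau, sqrt_1. lra. }
    assert (HuL : 0 <= u <= L + om) by (assert (B := Hm3 s Hs); lra).
    destruct (tube_cell_bounds om c K V h (s - a) u L kap v (dot E N) (dot E tau)) as [Q1 Q2];
      auto; try lra.
    exists (u - dot E N), ((s - a) * (1 - u * kap) * v + dot E tau).
    split; [exact Q1 |]. split; [exact Q2 |].
    rewrite Ex. fold (Y s).
    assert (EY : Y s = vadd (Y a) (vadd (vscale (s - a) (Y' a)) E))
      by (unfold E, vadd, vsub, vscale; rewrite (surjective_pairing (Y s)); simpl; f_equal; ring).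
    assert (EY' : Y' a = vscale ((1 - u * kap) * v) tau).
    { unfold Y', tau. fold kap. unfold vsub, vscale; simpl. f_equal; field; lra. }
    rewrite EY, EY', (Hdec E) at 1. unfold Y. fold N. unfold frame_point.
    clear. clearbody N tau E. unfold vadd, vsub, vscale; simpl. f_equal; ring.
  (* The term of order zero in the errors is [h * v * (L - L^2 * kap / 2)], that is [h * v * c]:
     constancy of [phi] makes each cell contribute [c] times its length. *)
  - replace ((L + eps - - eps) * (h * (v + eps2) + - (h * kap * v) * - eps - - (eps2 * h) +
      (h * (v + eps2) + - (h * kap * v) * (L + eps) - - (eps2 * h))) / 2) with
      (h * (v * (L - / 2 * L ^ 2 * kap) + eps * (v * (2 - L * kap)) + eps2 * (2 * (L + 2 * eps))))
      by field.
    rewrite HL2. apply Rmult_le_compat_l; [lra |].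
    assert (B1 : v * (2 - L * kap) <= V * (2 * (1 + c * K))).
    { apply Rmult_le_compat; try lra. apply Rabs_le_between in Hkap.
      assert (L * - kap <= 2 * c * K).
      { apply Rle_trans with (L * K); [apply Rmult_le_compat_l; lra |].
        apply Rmult_le_compat_r; lra. }
      lra. }
    assert (B2 : eps * (v * (2 - L * kap)) <= eps * (V * (2 * (1 + c * K))))
      by (apply Rmult_le_compat_l; lra).
    assert (B3 : eps2 * (2 * (L + 2 * eps)) <= eps2 * (2 * (2 * c + 2))).
    { apply Rmult_le_compat_l; [unfold eps2; apply Rmult_le_pos; lra | lra]. }
    unfold eps2 in *. lra.
  - assert (B : 0 <= h * (v + eps * (kap * v) + 2 * eps2)).
    { apply Rmult_le_pos; [lra |]. unfold eps2. lra. }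
    lra.
  - assert (B : 0 <= h * (v * (1 - L * kap) - eps * (kap * v) + 2 * eps2)).
    { apply Rmult_le_pos; [lra |].
      assert (0 <= v * (1 - L * kap)) by (apply Rmult_le_pos; lra). unfold eps2. lra. }
    lra.
Qed.

Lemma tube_area c k e : (forall y, reg_bd Om m g y -> phi Om nu kappa y = c) ->
  (k < m)%nat -> 0 < e ->
  area_le (fun x => exists s u, 0 <= s <= 1 /\ 0 <= u <= cut_of_curv c k s /\
      x = vsub (g k s) (vscale u (nrm k s))) (c * RInt (speed k) 0 1 + e).
Proof.
  intros Hphi Hk He. assert (Hc := phi_const_pos c Hphi).
  destruct (upper_bound_exists (fun t => Rabs (curv k t)) 0 1 ltac:(lra)) as (K & HK & HcK).
  { intros t Ht. apply (continuity_pt_comp (curv k) Rabs);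
      [apply curv_continuous; auto | apply Rcontinuity_abs]. }
  destruct (upper_bound_exists (speed k) 0 1 ltac:(lra)) as (V & HV & HsV).
  { intros t Ht. apply speed_continuous; auto. }
  set (C1 := (2 + 2 * c) * (1 + K * V)).
  set (C2 := 2 * V * (1 + c * K) + 2 * (1 + K * V) * (2 * c + 2)).
  assert (HKV : 0 < K * V) by (apply Rmult_lt_0_compat; auto).
  assert (HcK0 : 0 < c * K) by (apply Rmult_lt_0_compat; auto).
  assert (HC1 : 0 < C1) by (apply Rmult_lt_0_compat; lra).
  assert (HC2 : 0 < C2).
  { unfold C2. apply Rplus_lt_0_compat; repeat apply Rmult_lt_0_compat; lra. }
  assert (HC12 : 0 < C1 * C2) by (apply Rmult_lt_0_compat; auto).
  (* [om * C1 <= 1] is the requirement [eps <= 1] of the cells; [om * C1 * C2 <= e / 2] bounds their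
     total error, the other half being left to the Riemann sum. *)
  destruct (common_scale (/ C1) (e / (2 * (C1 * C2)))) as (om & Hom & Hom1 & Hom2); [apply Rinv_0_lt_compat; auto | apply Rdiv_lt_0_compat; lra |].
  apply Rmult_le_compat_r with (r := C1) in Hom1; [| lra].
  rewrite Rinv_l in Hom1 by lra.
  apply Rle_div_r in Hom2; [| lra].
  destruct (vuniform_modulus (g1 k) 0 1 om Hom ltac:(intros; apply arc_vcont1; auto))
    as (d1 & Hd1 & Hm1).
  destruct (vuniform_modulus (fun t => vscale (curv k t) (g1 k t)) 0 1 om Hom) as (d2 & Hd2 & Hm2).
  { intros t Ht. apply vcont_vscale; [apply curv_continuous | apply arc_vcont1]; auto. }
  destruct (uniform_modulus (cut_of_curv c k) 0 1 om Hom) as (d3 & Hd3 & Hm3).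
  { intros t Ht. apply cut_of_curv_continuous; auto. apply curv_le_phi_const; auto. }
  destruct (uniform_modulus (speed k) 0 1 (e / (2 * c))) as (d4 & Hd4 & Hm4).
  { apply Rdiv_lt_0_compat; lra. }
  { intros t Ht. apply speed_continuous; auto. }
  destruct (common_scales (d1 :: d2 :: d3 :: d4 :: nil))
    as (D & HD & HDle); [simpl; repeat split; auto; lra |]. simpl in HDle.
  destruct (mesh_exists 1 D HD) as (M & HM & HhD).
  assert (HM0 : 0 < INR M) by (apply lt_0_INR; auto).
  set (h := 1 / INR M) in *.
  assert (HMh : INR M * h = 1) by (unfold h; field; lra).
  assert (Hh0 : 0 < h) by (apply Rdiv_lt_0_compat; lra).
  assert (Ht : forall i, (i < M)%nat -> 0 <= INR i * h /\ INR i * h + h <= 1).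
  { intros i Hi. assert (H0 := pos_INR i).
    assert (Hle : INR i + 1 <= INR M) by (rewrite <- S_INR; apply le_INR; auto).
    assert (0 <= INR i * h) by (apply Rmult_le_pos; lra).
    assert ((INR i + 1) * h <= INR M * h) by (apply Rmult_le_compat_r; lra). lra. }
  assert (Hh1 : h <= 1) by (destruct (Ht 0%nat HM); simpl in *; lra).
  set (eps := om * (2 + 2 * c) * (1 + K * V)).
  assert (Eeps : eps = om * C1) by (unfold eps, C1; ring).
  set (S := fun i x => exists s u, INR i * h <= s <= INR i * h + h /\
      0 <= u <= cut_of_curv c k s /\ x = vsub (g k s) (vscale u (nrm k s))).
  eapply area_le_mono; [| | apply (area_le_bigunion S
    (fun i => h * (c * speed k (INR i * h) + eps * C2)) M)].
  - intros x (s & u & Hs & Hu & Ex). destruct (mesh_cell M s HM Hs) as (i & Hi & Hsi).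
    exists i. split; auto. exists s, u. split; [| auto].
    fold h in Hsi. rewrite S_INR in Hsi. lra.
  - rewrite (psum_ext _ (fun i => c * (h * speed k (INR i * h)) - - (h * (eps * C2))))
      by (intros; ring).
    rewrite psum_minus, psum_scal, psum_const.
    assert (HR := riemann_sum_close (speed k) 0 1 (e / (2 * c)) M ltac:(lra) HM
      ltac:(intros; apply speed_continuous; auto)
      ltac:(intros s t Hs Hst Hd; apply Hm4; auto; rewrite Rminus_0_r in Hd; fold h in Hd; lra)).
    rewrite (psum_ext _ (fun i => h * speed k (INR i * h))) in HR
      by (intros i Hi; rewrite Rminus_0_r, Rplus_0_l; reflexivity).
    apply Rabs_le_between in HR. destruct HR as [_ HR].
    set (P := psum (fun i => h * speed k (INR i * h)) M) in *.
    apply Rmult_le_compat_l with (r := c) in HR; [| lra].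
    replace (c * (e / (2 * c) * (1 - 0))) with (e / 2) in HR by (field; lra).
    replace (INR M * - (h * (eps * C2))) with (- (INR M * h * (eps * C2))) by ring.
    rewrite HMh, Eeps. lra.
  - intros i Hi. destruct (Ht i Hi) as [T1 T2].
    apply tube_cell_area; auto; try lra.
    + intros t Hti. apply Hm1; try lra. rewrite Rabs_pos_eq; lra.
    + intros t Hti. apply (Hm2 t (INR i * h)); try lra. rewrite Rabs_pos_eq; lra.
    + intros t Hti. assert (B := Hm3 t (INR i * h) ltac:(lra) ltac:(lra)
        ltac:(rewrite Rabs_pos_eq; lra)). apply Rabs_le_between in B. lra.
    + fold eps. rewrite Eeps. lra.
Qed.

Lemma domain_area_le c : (forall y, reg_bd Om m g y -> phi Om nu kappa y = c) ->
  area_le Om (c * total_length).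
Proof.
  intros Hphi. apply area_le_closed. intros e He.
  assert (Hm : 0 < INR m) by (apply lt_0_INR, m_pos).
  assert (He' : 0 < e / INR m) by (apply Rdiv_lt_0_compat; auto).
  destruct HB as [M HM].
  (* [inner_touch_le_cut] speaks of open arcs only. Points whose nearest boundary point is an arc
     end lie on normal segments of length [D], long enough to cross [Om], and these have no area. *)
  set (D := fun k t => Rabs M + vnorm (g k t) + 1).
  set (ray := fun k t x => exists s, 0 <= s <= 1 /\
     x = seg (g k t) (vsub (g k t) (vscale (D k t) (nrm k t))) s).
  set (tube := fun k x => exists s u, 0 <= s <= 1 /\ 0 <= u <= cut_of_curv c k s /\
      x = vsub (g k s) (vscale u (nrm k s))).
  eapply area_le_mono; [| | apply (area_le_bigunion
    (fun k x => tube k x \/ (ray k 0 x \/ ray k 1 x))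
    (fun k => (c * RInt (speed k) 0 1 + e / INR m) + (0 + 0)) m)].
  - intros x Hx. destruct (nearest_point_on_normal x Hx) as (k & t & d & Hk & Ht & Hd & Ed & Ex & Hin & _).
    exists k. split; auto.
    assert (Hray : ray k t x).
    { assert (HD : 0 < D k t).
      { unfold D. assert (H1 := Rabs_pos M). assert (H2 := vnorm_nonneg (g k t)). lra. }
      assert (HdD : d <= D k t).
      { rewrite Ed. apply HM in Hx. assert (H := vnorm_vadd_le x (vscale (-1) (g k t))).
        replace (vadd x (vscale (-1) (g k t))) with (vsub x (g k t)) in H by vec_ring.
        rewrite vnorm_vscale, (Rabs_left (-1)) in H by lra.
        assert (H1 := Rle_abs M). unfold D. lra. }
      exists (d / D k t). split.
      - split; [apply Rdiv_le_0_compat; lra |]. apply Rmult_le_reg_r with (D k t); auto.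
        replace (d / D k t * D k t) with d by (field; lra). lra.
      - rewrite Ex. set (n := nrm k t). clearbody n.
        unfold seg, vadd, vsub, vscale; simpl. f_equal; field; lra. }
    destruct (Req_dec t 0) as [-> | H0]; [auto |].
    destruct (Req_dec t 1) as [-> | H1]; [auto |].
    left. exists t, d. split; auto. split; auto. split; [lra |].
    apply inner_touch_le_cut; auto; lra.
  - rewrite (psum_ext _ (fun k => c * RInt (speed k) 0 1 - - (e / INR m))) by (intros; ring).
    rewrite psum_minus, psum_scal, psum_const. fold total_length.
    right. field. lra.
  - intros k Hk. apply area_le_union; [apply tube_area; auto |].
    apply area_le_union; apply segment_area.
Qed.

Lemma phi_constant_case c : (forall y, reg_bd Om m g y -> phi Om nu kappa y = c) ->
  (exists x, Om x) -> is_disk Om.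
Proof.
  intros Hphi Hne. assert (Hc := phi_const_pos c Hphi).
  assert (Hsm := phi_const_smooth c Hphi).
  assert (Hsweep : total_sweep / 2 <= c * total_length).
  { apply le_epsilon. intros e He.
    destruct (sectors_area e Hsm He) as (S & eta & Heta & Hmar & Ha).
    assert (H : total_sweep / 2 - e <= c * total_length); [| lra].
    (* The sectors lie in [Om], so its lattice points are bounded from both sides without passing
       through [area Om]. *)
    apply (area_ge_le Om); [| apply domain_area_le; auto].
    apply area_ge_mono with (3 := Ha); [| lra]. intros x Hx. apply (Hmar x x Hx).
    rewrite vsub_diag. apply vnorm_lt; auto. unfold dot; simpl. nra. }
  apply (rigidity (/ (2 * c))); auto.
  - apply Rinv_0_lt_compat. lra.
  - intros k t Hk Ht. assert (H := curv_le_phi_const c k t Hphi Hk ltac:(lra)).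
    apply Rmult_le_reg_l with (2 * c); [lra |]. rewrite Rinv_r by lra. lra.
  - apply Rmult_le_reg_l with (2 * c); [lra |].
    replace (2 * c * (/ (2 * c) * total_sweep)) with total_sweep by (field; lra). lra.
Qed.

End Domain.

Theorem theorem3p1 (Om : R2 -> Prop) (m : nat) (g g1 g2 : nat -> R -> R2)
    (nu : R2 -> R2) (kappa : R2 -> R) :
  open2 Om -> bounded2 Om -> connected2 Om ->
  piecewise_C2_no_concave Om m g g1 g2 ->
  outward_normal_spec Om m g g1 nu ->
  curvature_spec m g g1 g2 nu kappa ->
  (forall y, reg_bd Om m g y -> dot y (nu y) > 0) ->
  ((C1_domain Om /\
    exists y0, reg_bd Om m g y0 /\
      (forall y, reg_bd Om m g y -> kappa y <= kappa y0) /\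
      phi Om nu kappa y0 >= area Om / perimeter m g)
   \/
   (exists c, forall y, reg_bd Om m g y -> phi Om nu kappa y = c)) ->
  is_disk Om.
Proof.
  intros HO HB [Hne _] HPC HNU HKA HST [(HC & y0 & Hy0 & Hmax & Hphi) | (c & Hphi)].
  - eapply phi_max_curvature_case; eauto.
  - eapply phi_constant_case; eauto.
Qed.
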